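(* Every braced triangulation $G=(P,B)$ with $|B|=1$ and at least six vertices has an edge of $P$ that is contractible in $G$. Equivalently, the unique (up to isomorphism) braced triangulation with one brace and five vertices is the only irreducible braced triangulation with exactly one brace.
   Context: A sphere graph is a simple graph with a fixed embedding in the 2-sphere without edge crossings. A (sphere) triangulation $P$ is a maximal sphere graph with at least 3 vertices. An edge $e$ of $P$ is contractible in $P$ if it belongs to precisely two 3-cycles of $P$. A braced triangulation $G=(P,B)$ is the simple graph obtained from a triangulation $P$ by adjoining a set $B$ of additional edges (braces) joining pairs of vertices non-adjacent in $P$. An edge $e$ of $P$ is contractible in $G$ if $e$ is contractible in $P$ and $e$ does not belong to any 3-cycle of $G$ containing a brace. $G$ is irreducible if no edge of $P$ is contractible in $G$. *)

(* Defs.v *)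
From HB Require Import structures.
From mathcomp Require Import all_boot all_order all_algebra.
From mathcomp Require Import all_classical all_reals all_analysis.
Import Order.TTheory GRing.Theory Num.Theory.
Import numFieldNormedType.Exports.

Set Implicit Arguments.
Unset Strict Implicit.
Unset Printing Implicit Defensive.

Local Open Scope ring_scope.

(** * Finite simple graphs *)

Record sgraph (V : finType) := SGraph {
  adj :> rel V;
  adj_sym : symmetric adj;
  adj_irr : irreflexive adj
}.

Definition edges (V : finType) (G : sgraph V) : {set {set V}} :=
  [set [set p.1; p.2] | p : V * V & G p.1 p.2].

(* A 3-cycle of a simple graph is determined by its vertex set, and its edges
   are the 2-element subsets of that set; so an edge [e] belongs to the 3-cycle
   [T] iff [e \subset T]. *)
Definition three_cycles (V : finType) (G : sgraph V) : {set {set V}} :=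
  [set T : {set V} |
     (#|T| == 3)%N && [forall u in T, forall v in T, (u != v) ==> G u v]].

(** * Graphs embedded in the 2-sphere *)

(* The topology on ['rV[R]_3] is the usual one; the equation below is that of
   the Euclidean unit sphere (the library norm on ['rV] is the sup norm). *)
Definition sphere2 (R : realType) : set 'rV[R]_3 :=
  [set p : 'rV[R]_3 | \sum_(i < 3) p ord0 i ^+ 2 = 1]%classic.

(* [A] is a simple arc on the sphere with endpoints [p] and [q]. As [0,1] is
   compact, the injective continuous [g] is a homeomorphism onto [A]. *)
Definition is_arc (R : realType) (p q : 'rV[R]_3) (A : set 'rV[R]_3) : Prop :=
  exists g : R -> 'rV[R]_3,
    [/\ {within `[0, 1], continuous g}%classic,
        {in `[0, 1] &, injective g},
        g 0 = p, g 1 = q &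
        A = (g @` `[0, 1])%classic /\ (A `<=` @sphere2 R)%classic].

(* [curve u v] is the closed arc, endpoints included, that represents the edge
   uv; it is irrelevant when u and v are not adjacent. *)
Record sphere_graph (R : realType) (V : finType) := SphereGraph {
  sg_graph :> sgraph V;
  pt : V -> 'rV[R]_3;
  curve : V -> V -> set 'rV[R]_3;
  pt_sphere : forall v, sphere2 (pt v);
  pt_inj : injective pt;
  curve_sym : forall u v, sg_graph u v -> curve u v = curve v u;
  curve_arc : forall u v, sg_graph u v -> is_arc (pt u) (pt v) (curve u v);
  curve_pt : forall u v w,
    sg_graph u v -> curve u v (pt w) -> w \in [set u; v];
  curve_no_crossing : forall u v x y,
    sg_graph u v -> sg_graph x y -> [set u; v] != [set x; y] ->
    forall p, curve u v p -> curve x y p ->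
    exists2 w, w \in [set u; v] :&: [set x; y] & p = pt w
}.

(* [P] is contained in [Q], as embedded graphs with the same vertices. *)
Definition sg_sub (R : realType) (V : finType) (P Q : sphere_graph R V) : Prop :=
  pt P =1 pt Q /\
  forall u v, P u v -> Q u v /\ curve P u v = curve Q u v.

Definition sg_maximal (R : realType) (V : finType) (P : sphere_graph R V) :
  Prop := forall Q : sphere_graph R V, sg_sub P Q -> sg_sub Q P.

Definition triangulation (R : realType) (V : finType) (P : sphere_graph R V) :
  Prop := sg_maximal P /\ (3 <= #|V|)%N.

Definition contractible (V : finType) (P : sgraph V) (e : {set V}) : bool :=
  (e \in edges P) && (#|[set T in three_cycles P | e \subset T]| == 2)%N.

(** * Braced triangulations *)

Record braced_triangulation (R : realType) (V : finType) :=
  BracedTriangulation {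
  bt_tri : sphere_graph R V;
  bt_triP : triangulation bt_tri;
  braces : {set {set V}};
  bracesP : forall b, b \in braces ->
    exists x y, [/\ x != y, ~~ bt_tri x y & b = [set x; y]]
}.

Section BracedGraph.
Variables (R : realType) (V : finType) (G : braced_triangulation R V).

Let bg_adj : rel V :=
  fun u v => bt_tri G u v || ([set u; v] \in braces G).

Fact bg_adj_sym : symmetric bg_adj.
Proof. by move=> u v; rewrite /bg_adj adj_sym finset.setUC. Qed.

Fact bg_adj_irr : irreflexive bg_adj.
Proof.
move=> u; rewrite /bg_adj adj_irr /=; apply/negP => /bracesP[x [y [nxy _ E]]].
have := cards2 x y; rewrite -E nxy cards2 eqxx; exact/eqP.
Qed.

Definition bt_graph : sgraph V := SGraph bg_adj_sym bg_adj_irr.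

Definition bt_contractible (e : {set V}) : bool :=
  contractible (bt_tri G) e &&
  ~~ [exists T in three_cycles bt_graph,
        (e \subset T) && [exists b in braces G, b \subset T]].

Definition bt_irreducible : Prop :=
  forall e, e \in edges (bt_tri G) -> ~~ bt_contractible e.

End BracedGraph.

Definition bt_iso (R : realType) (V W : finType)
    (G : braced_triangulation R V) (H : braced_triangulation R W) : Prop :=
  exists f : V -> W,
    [/\ bijective f,
        forall u v, bt_tri H (f u) (f v) = bt_tri G u v &
        forall b : {set V}, (f @: b \in braces H) = (b \in braces G)].

(* Main.v *)
Require Import Defs.
From mathcomp Require Import all_boot all_order all_algebra.
From mathcomp Require Import all_classical all_reals all_analysis.
From mathcomp Require Import perm complex ring lra.
Import Order.TTheory GRing.Theory Num.Theory.
Import numFieldNormedType.Exports.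
Set Implicit Arguments.
Unset Strict Implicit.
Unset Printing Implicit Defensive.
Local Open Scope ring_scope.

(** Let z be a point off a curve T. Following a continuous square root of w - z along T produces a
    factor, which is a sign when T is closed, and two points off a triangle T are joined off T iff
    their signs agree; this replaces the Jordan curve theorem. If a face of a maximal sphere graph
    touched two non-adjacent vertices, then an arc through that face could be added as an edge.
    So in a triangulation with at least four vertices each edge ab lies in two 3-cycles abc and abd,
    coming from the faces on the two sides of ab, and every other 3-cycle abw separates c from d.
    Hence an edge of P that is not contractible in P lies on a separating 3-cycle.

    Let xy be the brace and assume that no edge is contractible in G. Suppose that some side of some
    3-cycle T contains a vertex but neither x nor y, and take a smallest such side. A vertex v in it
    has a neighbour b outside {x, y}, and vb lies on a separating 3-cycle, one side of which is
    strictly contained in the chosen one: a contradiction. So every side of a separating 3-cycle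
    contains x or y, and no separating 3-cycle passes through x or y. Hence the edges at x (or y) are
    contractible in P, so that each of them lies in a 3-cycle with the brace: x and y have the same
    set N of neighbours. An edge avoiding x and y lies on a 3-cycle that separates x from y, hence
    contains N, and |N| >= 3. Therefore all the vertices except x and y are in N, and |N| = 3.

    With five vertices, every vertex has degree at least 3 and every edge at least two common
    neighbours, which leaves only K5 minus an edge. K5 itself is not a sphere graph: with the notation
    above, the cycle abw would separate the adjacent vertices c and d. So a sphere graph on five
    points with as many edges as possible is the required triangulation. *)

(** * Finite graphs *)

(** The engine is [sep_not_sqrt]: a compact set that carries a continuous square root of
    [(w - p) * (w - q)] does not separate p from q. On a finite union of arcs such a root is built
    arc by arc, by transport from one end to the other, and the only obstruction is a product of
    signs. Hence an arc separates nothing, and a triangle leaves a single sign to compare. Two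
    obstacles shape the rest. First, a face may touch a vertex without any evident arc in the face
    ending there, yet a new edge needs such an arc. Only finitely many edges end at a vertex, so the
    signs of nearby points with respect to these edges form finitely many patterns; a pattern that
    recurs arbitrarily close to the vertex provides polygons in shrinking discs, and loop erasure
    makes the resulting path injective. Second, the edges are arbitrary arcs on the sphere, so a
    projection to the plane needs a point off all of them, hence a proof that arcs have no interior.
    No count of faces and no Euler formula occurs: the combinatorial part uses only which vertices
    lie on the same side of a 3-cycle. *)

Lemma uniq_size (V : finType) (s : seq V) : uniq s -> (size s <= #|V|)%N.
Proof. by move/card_uniqP => <-; apply: max_card. Qed.

Lemma exists_notin (V : finType) (s : seq V) : (size s < #|V|)%N -> exists v, v \notin s.
Proof.
move=> lt; apply: contrapT => h; have : (#|V| <= #|s|)%N.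
  by apply: subset_leq_card; apply/fintype.subsetP => v _; apply: contrapT => hv; apply: h; exists v; apply/negP.
by move=> /(leq_trans lt); rewrite ltnNge card_size.
Qed.

Lemma set2_in (V : finType) (a b : V) (T : {set V}) : ([set a; b] \subset T) = (a \in T) && (b \in T).
Proof. by rewrite finset.subUset !finset.sub1set. Qed.

Lemma set2_eq (V : finType) (a b u v : V) : a != b -> [set a; b] = [set u; v] -> (a = u /\ b = v) \/ (a = v /\ b = u).
Proof.
move=> ab E; have : a \in [set u; v] by rewrite -E !inE eqxx.
have : b \in [set u; v] by rewrite -E !inE eqxx orbT.
by rewrite !inE => /orP[] /eqP Eb /orP[] /eqP Ea; subst a b; rewrite ?eqxx // in ab; [right|left].
Qed.

Lemma cycleP (V : finType) (G : sgraph V) a b c : G a b -> G b c -> G c a -> [set a; b; c] \in three_cycles G.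
Proof.
move=> ab bc ca; have irr u v : G u v -> u != v by apply: contraTneq => ->; rewrite adj_irr.
have ba : G b a by rewrite adj_sym.
have cb : G c b by rewrite adj_sym.
have ac : G a c by rewrite adj_sym.
rewrite inE; apply/andP; split.
  by rewrite finset.setUC cardsU1 cards2 (irr _ _ ab) finset.in_set2 negb_or (irr _ _ ca) (irr _ _ cb).
apply/forall_inP => u; rewrite !inE -orbA => uT; apply/forall_inP => v; rewrite !inE -orbA => vT.
by case/or3P: uT => /eqP ->; case/or3P: vT => /eqP ->; rewrite ?eqxx //=; apply/implyP.
Qed.

Lemma cycle_adj (V : finType) (G : sgraph V) T u v : T \in three_cycles G -> u \in T -> v \in T -> u != v -> G u v.
Proof. by rewrite inE => /andP[_ /forall_inP H] uT vT uv; move/forall_inP: (H u uT) => /(_ v vT) /implyP; apply. Qed.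

Lemma cycle_card (V : finType) (G : sgraph V) T : T \in three_cycles G -> #|T| = 3%N.
Proof. by rewrite inE => /andP[/eqP]. Qed.

Lemma cycle_third (V : finType) (G : sgraph V) T a b : T \in three_cycles G -> a \in T -> b \in T -> a != b ->
  exists c, [/\ T = [set a; b; c], G a c & G b c].
Proof.
move=> cT aT bT ab; have T3 := cycle_card cT.
have h1 : #|T :\ a| = 2%N by move: (cardsD1 a T); rewrite aT T3 => -[].
have bTa : b \in T :\ a by rewrite finset.in_setD1 eq_sym ab.
have h2 : #|T :\ a :\ b| == 1%N by move: (cardsD1 b (T :\ a)); rewrite bTa h1 => -[->].
have [c Ec] := cards1P h2; have : c \in T :\ a :\ b by rewrite Ec finset.in_set1.
rewrite !finset.in_setD1 => /and3P[cb ca cT'].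
exists c; split.
- by rewrite -(finset.setD1K aT) -(finset.setD1K bTa) Ec finset.setUA.
- by apply: (cycle_adj cT) => //; rewrite eq_sym.
- by apply: (cycle_adj cT) => //; rewrite eq_sym.
Qed.


(** * Continuity and compactness in the plane *)

Import Normc.

Section Plane.
Variable R : realType.
Notation C := R[i].
Notation Re := (@complex.Re R).
Notation Im := (@complex.Im R).
Notation "x %:c" := (real_complex R x) (at level 1, format "x %:c").
Implicit Types (x y z w : C) (t s : R).

(** The modulus as an element of [R]; the norm of [R[i]] takes its values in [R[i]]. *)
Definition nm z : R := normc z.

Lemma nmM x y : nm (x * y) = nm x * nm y. Proof. exact: normcM. Qed.
Lemma nm0 : nm 0 = 0. Proof. exact: normc0. Qed.
Lemma nm1 : nm 1 = 1. Proof. exact: normc1. Qed.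
Lemma nmD x y : nm (x + y) <= nm x + nm y. Proof. exact: le_normcD. Qed.
Lemma nmN x : nm (- x) = nm x. Proof. exact: normcN. Qed.
Lemma nmV x : nm x^-1 = (nm x)^-1. Proof. exact: normcV. Qed.
Lemma nmB x y : nm (x - y) = nm (y - x). Proof. by rewrite -nmN opprB. Qed.
Lemma nm_ge0 x : 0 <= nm x. Proof. by case: x => a b; rewrite /nm /= sqrtr_ge0. Qed.

Lemma nm_eq0 x : (nm x == 0) = (x == 0).
Proof. by apply/eqP/eqP => [/eq0_normc //|->]; rewrite nm0. Qed.

Lemma nm_gt0 x : (0 < nm x) = (x != 0).
Proof. by rewrite lt_neqAle nm_ge0 andbT eq_sym nm_eq0. Qed.

Lemma nm_tri y x z : nm (x - z) <= nm (x - y) + nm (y - z).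
Proof. by rewrite (_ : x - z = (x - y) + (y - z)) ?nmD //; ring. Qed.

Lemma nm_sq z : nm z ^+ 2 = Re z ^+ 2 + Im z ^+ 2.
Proof. by case: z => a b; rewrite /nm /= sqr_sqrtr // addr_ge0 ?sqr_ge0. Qed.

Lemma rcB s t : (s - t)%:c = s%:c - t%:c. Proof. exact: rmorphB. Qed.
Lemma rcD s t : (s + t)%:c = s%:c + t%:c. Proof. exact: rmorphD. Qed.
Lemma rcM s t : (s * t)%:c = s%:c * t%:c. Proof. exact: rmorphM. Qed.
Lemma rcX s n : (s ^+ n)%:c = s%:c ^+ n. Proof. exact: rmorphXn. Qed.
Lemma rc_eq0 s : (s%:c == 0) = (s == 0). Proof. exact: (fmorph_eq0 (real_complex R)). Qed.

Lemma nm_real t : nm t%:c = `|t|.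
Proof. by rewrite /nm /= expr0n /= addr0 sqrtr_sqr. Qed.

Lemma nmJ z : nm z^*%C = nm z.
Proof. by case: z => a b; rewrite /nm /= sqrrN. Qed.

Lemma le_Re_nm z : `|Re z| <= nm z.
Proof.
rewrite -(@ler_pXn2r _ 2) ?nnegrE ?normr_ge0 ?nm_ge0 //.
by rewrite nm_sq -normrX ger0_norm ?sqr_ge0 // lerDl sqr_ge0.
Qed.

Lemma le_Im_nm z : `|Im z| <= nm z.
Proof.
rewrite -(@ler_pXn2r _ 2) ?nnegrE ?normr_ge0 ?nm_ge0 //.
by rewrite nm_sq -normrX ger0_norm ?sqr_ge0 // lerDr sqr_ge0.
Qed.

Lemma nm_le z : nm z <= `|Re z| + `|Im z|.
Proof.
rewrite -(@ler_pXn2r _ 2) ?nnegrE ?addr_ge0 ?nm_ge0 //.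
rewrite nm_sq sqrrD -(normrX _ (Re z)) -(normrX _ (Im z)) !(ger0_norm (sqr_ge0 _)).
by rewrite lerD2r lerDl mulrn_wge0 // mulr_ge0.
Qed.

Lemma nm_rtri x y : `|nm x - nm y| <= nm (x - y).
Proof.
rewrite ler_norml lerBlDr lerBrDl; apply/andP; split.
  by have := nmD (y - x) x; rewrite subrK nmB addrC lerBlDr addrC => h; lra.
by have := nmD (x - y) y; rewrite subrK addrC => h; lra.
Qed.

Lemma ReB x y : Re (x - y) = Re x - Re y. Proof. by case: x; case: y. Qed.
Lemma ImB x y : Im (x - y) = Im x - Im y. Proof. by case: x; case: y. Qed.

Section Continuity.
Context {X : Type} (d : X -> X -> R) (K : X -> Prop).
Implicit Types (f g : X -> C) (p q : X).

(** Continuity at p along K. No axiom on [d] is imposed and p need not belong to K, so that one set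
    of lemmas serves the interval, the plane and pairs of points. *)
Definition cAt f p := forall e, 0 < e ->
  exists2 r, 0 < r & forall q, K q -> d q p < r -> nm (f q - f p) < e.

Lemma cAt_cst (c : C) p : cAt (fun=> c) p.
Proof. by move=> e e0; exists 1 => // q _ _; rewrite subrr nm0. Qed.

Lemma cAt_ext f g p r : 0 < r -> f p = g p ->
  (forall q, K q -> d q p < r -> f q = g q) -> cAt f p -> cAt g p.
Proof.
move=> r0 fgp fg cf e e0; have [s s0 H] := cf e e0.
exists (Num.min r s); first by rewrite lt_min r0.
by move=> q Kq; rewrite lt_min => /andP[h1 h2]; rewrite -fg // -fgp H.
Qed.

Lemma eq_cAt f g p : f =1 g -> cAt f p -> cAt g p.
Proof. by move=> fg; apply: (@cAt_ext _ _ _ 1) => // q _ _. Qed.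

Lemma cAtD f g p : cAt f p -> cAt g p -> cAt (fun q => f q + g q) p.
Proof.
move=> cf cg e e0; have e2 : 0 < e / 2 by lra.
have [r r0 H] := cf _ e2; have [s s0 K1] := cg _ e2.
exists (Num.min r s); first by rewrite lt_min r0.
move=> q Kq; rewrite lt_min => /andP[h1 h2].
rewrite (_ : _ - _ = (f q - f p) + (g q - g p)); last by ring.
by apply: le_lt_trans (nmD _ _) _; have := H _ Kq h1; have := K1 _ Kq h2; lra.
Qed.

Lemma cAtM f g p : cAt f p -> cAt g p -> cAt (fun q => f q * g q) p.
Proof.
move=> cf cg e e0.
pose S := nm (f p) + nm (g p) + 1.
have S0 : 0 < S by have := nm_ge0 (f p); have := nm_ge0 (g p); rewrite /S; lra.
pose e' := Num.min 1 (e / S).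
have e'0 : 0 < e' by rewrite lt_min ltr01 divr_gt0.
have [r r0 H] := cf _ e'0; have [s s0 K1] := cg _ e'0.
exists (Num.min r s); first by rewrite lt_min r0.
move=> q Kq; rewrite lt_min => /andP[h1 h2].
have {H h1} := H _ Kq h1; have {K1 h2} := K1 _ Kq h2.
rewrite (_ : f q * g q - _ = (f q - f p) * (g q - g p) + f p * (g q - g p) + (f q - f p) * g p); last by ring.
move=> h1 h2; have h3 : e' <= 1 by rewrite ge_min lexx.
have h4 : e' * S <= e by rewrite -ler_pdivlMr // ge_min lexx orbT.
apply: le_lt_trans (nmD _ _) _; apply: le_lt_trans (lerD (nmD _ _) (lexx _)) _.
rewrite !nmM; have := nm_ge0 (f p); have := nm_ge0 (g p).
have := nm_ge0 (f q - f p); have := nm_ge0 (g q - g p); rewrite /S in h4.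
by nra.
Qed.

Lemma cAtN f p : cAt f p -> cAt (fun q => - f q) p.
Proof.
move=> cf; apply: eq_cAt (cAtM (cAt_cst (-1) p) cf) => q /=.
by rewrite mulN1r.
Qed.

Lemma cAtB f g p : cAt f p -> cAt g p -> cAt (fun q => f q - g q) p.
Proof. by move=> cf cg; apply: cAtD => //; apply: cAtN. Qed.

Lemma cAtV f p : f p != 0 -> cAt f p -> cAt (fun q => (f q)^-1) p.
Proof.
rewrite -nm_gt0 => a0 cf e e0; set a := nm (f p) in a0 *.
pose e' := Num.min (a / 2) (e * a ^+ 2 / 2).
have e'0 : 0 < e' by rewrite lt_min; apply/andP; split; [lra|rewrite divr_gt0 // mulr_gt0 // exprn_gt0].
have [r r0 H] := cf _ e'0; exists r => // q Kq h1.
have {H} := H _ Kq h1; rewrite lt_min => /andP[h2 h3].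
have h4 : a / 2 <= nm (f q).
  by have := nm_rtri (f q) (f p); rewrite ler_norml -/a => /andP[]; lra.
have fq0 : f q != 0 by rewrite -nm_gt0; lra.
have fp0 : f p != 0 by rewrite -nm_gt0.
rewrite (_ : _ - _ = (f p - f q) * (f q * f p)^-1); last by field; rewrite fq0 fp0.
rewrite nmM nmV nmM -/a nmB ltr_pdivrMr; last by rewrite mulr_gt0 // nm_gt0.
apply: lt_le_trans h3 _; rewrite (_ : e * a ^+ 2 / 2 = e * (a / 2 * a)); last by field.
by rewrite ler_wpM2l ?(ltW e0) // ler_wpM2r // ltW.
Qed.

Lemma cAt_div f g p : g p != 0 -> cAt f p -> cAt g p -> cAt (fun q => f q / g q) p.
Proof. by move=> g0 cf cg; apply: cAtM => //; apply: cAtV. Qed.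

Lemma cAt_conj f p : cAt f p -> cAt (fun q => (f q)^*%C) p.
Proof.
move=> cf e e0; have [r r0 H] := cf e e0; exists r => // q Kq h.
by rewrite -rmorphB /= nmJ H.
Qed.

Lemma cAt_nm f p : cAt f p -> cAt (fun q => (nm (f q))%:c) p.
Proof.
move=> cf e e0; have [r r0 H] := cf e e0; exists r => // q Kq h.
by rewrite -rcB nm_real (le_lt_trans (nm_rtri _ _)) // H.
Qed.

Lemma cAt_Re f p : cAt f p -> cAt (fun q => (Re (f q))%:c) p.
Proof.
move=> cf e e0; have [r r0 H] := cf e e0; exists r => // q Kq h.
by rewrite -rcB nm_real -ReB (le_lt_trans (le_Re_nm _)) // H.
Qed.

Lemma cAt_Im f p : cAt f p -> cAt (fun q => (Im (f q))%:c) p.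
Proof.
move=> cf e e0; have [r r0 H] := cf e e0; exists r => // q Kq h.
by rewrite -rcB nm_real -ImB (le_lt_trans (le_Im_nm _)) // H.
Qed.

Lemma cAt_sqrt (f : X -> R) p : 0 < f p -> cAt (fun q => (f q)%:c) p ->
  cAt (fun q => (Num.sqrt (f q))%:c) p.
Proof.
move=> f0 cf e e0.
have s0 : 0 < Num.sqrt (f p) by rewrite sqrtr_gt0.
pose e' := Num.min (f p) (e * Num.sqrt (f p)).
have e'0 : 0 < e' by rewrite lt_min f0 mulr_gt0.
have [r r0 H] := cf _ e'0; exists r => // q Kq h.
have {H} := H _ Kq h; rewrite -!rcB !nm_real lt_min => /andP[h1 h2].
have fq : 0 <= f q by move: h1; rewrite ltr_norml => /andP[]; lra.
have /(congr1 Num.norm) : f q - f p = (Num.sqrt (f q) - Num.sqrt (f p)) * (Num.sqrt (f q) + Num.sqrt (f p)).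
  by rewrite -subr_sqr !sqr_sqrtr // ltW.
rewrite normrM [X in _ * X]ger0_norm ?addr_ge0 ?sqrtr_ge0 // => E.
rewrite -(ltr_pM2r s0) (le_lt_trans _ h2) // E ler_wpM2l //.
by rewrite lerDr sqrtr_ge0.
Qed.

Lemma cAt_prod (f : nat -> X -> C) n p : (forall i, (i < n)%N -> cAt (f i) p) ->
  cAt (fun q => \prod_(i < n) f i q) p.
Proof.
elim: n => [|n IH] cf.
  by apply: eq_cAt (cAt_cst 1 p) => q; rewrite big_ord0.
apply: eq_cAt (cAtM (IH _) (cf n _)) => // [q|i ?]; last exact/cf/ltnW.
by rewrite big_ord_recr.
Qed.

Lemma cAt_near0 f p : cAt f p -> f p != 0 ->
  exists2 r, 0 < r & forall q, K q -> d q p < r -> f q != 0.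
Proof.
rewrite -nm_gt0 => cf f0; have [r r0 H] := cf _ f0; exists r => // q Kq h.
have := H _ Kq h; case: eqP => // ->; by rewrite sub0r nmN ltxx.
Qed.

End Continuity.

Lemma cAt_sub {X : Type} (d : X -> X -> R) (K K' : X -> Prop) f p :
  (forall q, K q -> K' q) -> cAt d K' f p -> cAt d K f p.
Proof.
move=> KK cf e e0; have [r r0 H] := cf e e0; exists r => // q Kq.
exact/H/KK.
Qed.

Lemma cAt_pre {X Y : Type} (dX : X -> X -> R) (dY : Y -> Y -> R) (K : X -> Prop)
    (K' : Y -> Prop) (a : X -> Y) (f : Y -> C) p :
  (forall q, K q -> K' (a q)) ->
  (forall r, 0 < r -> exists2 s, 0 < s & forall q, K q -> dX q p < s -> dY (a q) (a p) < r) ->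
  cAt dY K' f (a p) -> cAt dX K (fun q => f (a q)) p.
Proof.
move=> KK ca cf e e0; have [r r0 H] := cf e e0; have [s s0 H'] := ca r r0.
by exists s => // q Kq h; apply: H; [apply: KK|apply: H'].
Qed.

Definition dR (t s : R) : R := `|t - s|.
Definition dC (z w : C) : R := nm (z - w).
Definition I01 (t : R) : Prop := 0 <= t <= 1.
Definition full (z : C) : Prop := True.

Definition con (K : C -> Prop) (f : C -> C) := forall z, K z -> cAt dC K f z.
Definition pcon (f : R -> C) := forall t, I01 t -> cAt dR I01 f t.

Lemma cAt_comp {X : Type} (d : X -> X -> R) (K : X -> Prop) (K' : C -> Prop) (f : X -> C) (g : C -> C) p :
  (forall q, K q -> K' (f q)) -> cAt d K f p -> cAt dC K' g (f p) -> cAt d K (fun q => g (f q)) p.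
Proof. by move=> KK cf cg; apply: (cAt_pre KK) cg => r r0; exact: cf. Qed.

Lemma cAt_id K z : cAt dC K (fun w => w) z.
Proof. by move=> e e0; exists e. Qed.

Lemma cAt_rc K t : cAt dR K (fun s => s%:c) t.
Proof. by move=> e e0; exists e => // s _; rewrite -rcB nm_real. Qed.

(** * Compactness and connectedness as induction principles *)

Lemma archN (r : R) : 0 < r -> exists n : nat, n.+1%:R^-1 < r.
Proof.
move=> r0; have [n _ /(_ n (leqnn n))] := near_infty_natSinv_lt (PosNum r0).
by exists n.
Qed.

(** Compactness in the form of an induction on sets. If [P] failed for the disc it would fail for
    the square [Q], and the sets whose complement in the square satisfies [P] would form a proper
    filter; the local hypothesis is violated at a cluster point of it. *)
Lemma CI (M : R) (P : (C -> Prop) -> Prop) :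
  P (fun _ => False) -> (forall A B, P A -> P B -> P (fun z => A z \/ B z)) ->
  (forall A B : C -> Prop, (forall z, A z -> B z) -> P B -> P A) ->
  (forall z, exists2 r, 0 < r & P (fun w => nm (w - z) < r)) ->
  P (fun z => nm z <= M).
Proof.
move=> P0 PU PS PL.
have cK : compact (`[-M, M] `*` `[-M, M])%classic by apply: compact_setX; exact: segment_compact.
apply: contrapT => nP.
pose Q z := `|Re z| <= M /\ `|Im z| <= M.
have QP : P Q -> False.
  by move=> h; apply: nP; apply: PS h => z h; split; apply: le_trans h; [exact: le_Re_nm|exact: le_Im_nm].
pose F : set_system (R * R) := fun A => P (fun z => Q z /\ ~ A (Re z, Im z)).
have FF : ProperFilter F.
  split; first by move=> h; apply: QP; apply: PS h => z Qz; split.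
  split; first by apply: PS P0 => z [_ []].
    move=> A B fA fB; apply: PS (PU _ _ fA fB) => z [Qz nAB].
    have [Az|nA] := pselect (A (Re z, Im z)); last by left.
    by right; split=> // Bz; apply: nAB.
  by move=> A B AB; apply: PS => z [Qz nB]; split=> // /AB.
have FK : F (`[-M, M] `*` `[-M, M])%classic.
  apply: PS P0 => z [[h1 h2]] []; split; rewrite /= in_itv /=.
    by rewrite -ler_norml.
  by rewrite -ler_norml.
have [[a b] [_ clab]] := cK F FF FK.
have [r r0 Pr] := PL (Complex a b).
have [] := clab (fun p => ~ nm (Complex p.1 p.2 - Complex a b) < r) (ball (a, b) (r / 2)).
- by apply: PS Pr => -[c d'] [_ /contrapT].
- by apply: nbhsx_ballx; lra.
move=> [c d'] [h []]; rewrite /ball /= => h1 h2; apply: h.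
apply: le_lt_trans (nm_le _) _; rewrite /= distrC [`|d' - b|]distrC; lra.
Qed.

(** The interval is placed on the real axis of the plane; a point whose real part is outside the
    interval has a ball that misses it. *)
Lemma CIR (a b : R) (P : (R -> Prop) -> Prop) :
  P (fun _ => False) -> (forall A B, P A -> P B -> P (fun u => A u \/ B u)) ->
  (forall A B : R -> Prop, (forall u, A u -> B u) -> P B -> P A) ->
  (forall t, a <= t <= b -> exists2 r, 0 < r & P (fun s => a <= s <= b /\ `|s - t| < r)) ->
  P (fun s => a <= s <= b).
Proof.
move=> P0 PU PS PL.
have := @CI (Num.max `|a| `|b|) (fun A => P (fun t => a <= t <= b /\ A t%:c)).
move=> H; apply: (PS _ _ _ (H _ _ _ _)).
- move=> t /andP[at_ tb]; split; first by rewrite at_.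
  rewrite nm_real le_max.
  have [t0|t0] := leP 0 t; first by rewrite ger0_norm // (le_trans tb (ler_norm _)) orbT.
  by rewrite ltr0_norm // -[`|a|]normrN (le_trans _ (ler_norm _)) // lerN2.
- by apply: PS P0 => t [].
- by move=> A B PA PB; apply: PS (PU _ _ PA PB) => t [h [At|Bt]]; [left|right].
- by move=> A B AB; apply: PS => t [h /AB].
- move=> z; have [h|] := boolP (a <= Re z <= b).
    have [r r0 Pr] := PL _ h; exists r => //; apply: PS Pr => t [h1 h2]; split=> //.
    by apply: le_lt_trans h2; have := le_Re_nm (t%:c - z); rewrite ReB.
  rewrite negb_and -!ltNge => /orP[h|h].
    exists (a - Re z); first lra.
    apply: PS P0 => t [/andP[h1 h2]]; have := le_Re_nm (t%:c - z).
    by rewrite ReB /= ler_norml; lra.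
  exists (Re z - b); first lra.
  apply: PS P0 => t [/andP[h1 h2]]; have := le_Re_nm (t%:c - z).
  by rewrite ReB /= ler_norml; lra.
Qed.

(** A Lebesgue number for the interval; the radius is halved so that both points fall into one ball
    of the cover. *)
Lemma uniR (Q : R -> R -> Prop) :
  (forall t, I01 t -> exists2 r, 0 < r &
     forall s s', I01 s -> I01 s' -> `|s - t| < r -> `|s' - t| < r -> Q s s') ->
  exists2 r, 0 < r & forall s s', I01 s -> I01 s' -> `|s - s'| < r -> Q s s'.
Proof.
move=> H.
pose P (A : R -> Prop) := exists2 r, 0 < r & forall s s', A s -> I01 s -> I01 s' -> `|s - s'| < r -> Q s s'.
suff [r r0 h] : P (fun s => 0 <= s <= 1) by exists r => // s s' h1 h2 h3; apply: h.
apply: CIR.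
- by exists 1.
- move=> A B [r r0 hr] [s s0 hs]; exists (Num.min r s); first by rewrite lt_min r0.
  by move=> u v [Au|Bu] hu hv; rewrite lt_min => /andP[h1 h2]; [apply: hr|apply: hs].
- by move=> A B AB [r r0 hr]; exists r => // s s' /AB; exact: hr.
- move=> t ht; have [r r0 hr] := H t ht; exists (r / 2); first lra.
  exists (r / 2); first lra.
  move=> s s' [_ h1] h2 h3 h4; apply: hr => //; first lra.
  apply: le_lt_trans (_ : _ <= `|s - s'| + `|s - t|) _; last lra.
  by rewrite (_ : s' - t = - (s - s') + (s - t)) ?(le_trans (ler_normD _ _)) ?normrN //; ring.
Qed.

(** A Lebesgue number for the disc; the second point may lie outside the disc. *)
Lemma uniC (M : R) (Q : C -> C -> Prop) :
  (forall z, exists2 r, 0 < r & forall w w', nm (w - z) < r -> nm (w' - z) < r -> Q w w') ->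
  exists2 r, 0 < r & forall w w', nm w <= M -> nm (w - w') < r -> Q w w'.
Proof.
move=> H.
pose P (A : C -> Prop) := exists2 r, 0 < r & forall w w', A w -> nm (w - w') < r -> Q w w'.
suff : P (fun z => nm z <= M) by [].
apply: CI.
- by exists 1.
- move=> A B [r r0 hr] [s s0 hs]; exists (Num.min r s); first by rewrite lt_min r0.
  by move=> u v [Au|Bu]; rewrite lt_min => /andP[h1 h2]; [apply: hr|apply: hs].
- by move=> A B AB [r r0 hr]; exists r => // s s' /AB; exact: hr.
- move=> z; have [r r0 hr] := H z; exists (r / 2); first lra.
  exists (r / 2); first lra.
  move=> s s' h1 h2; apply: hr => //; first lra.
  by apply: le_lt_trans (nm_tri s _ _) _; rewrite nmB; lra.
Qed.

(** Connectedness of the interval: [uniR] makes the local constancy uniform, and finitely many equal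
    steps carry [D] from 0 to t. *)
Lemma locconst (D : R -> Prop) :
  (forall t, I01 t -> exists2 r, 0 < r & forall s, I01 s -> `|s - t| < r -> (D s <-> D t)) ->
  D 0 -> forall t, I01 t -> D t.
Proof.
move=> H D0 t /andP[t0 t1].
have [|r r0 hr] := @uniR (fun s s' => D s <-> D s').
  move=> u /H [r r0 hr]; exists r => // s s' h1 h2 h3 h4.
  by rewrite (hr s) // (hr s').
have [n hn] := archN r0.
have n0 : 0 < n.+1%:R :> R by rewrite ltr0n.
suff h k : (k <= n.+1)%N -> D (t * (k%:R / n.+1%:R)).
  by have := h n.+1 (leqnn _); rewrite divff ?mulr1 // gt_eqF.
have hI j : (j <= n.+1)%N -> I01 (t * (j%:R / n.+1%:R)).
  move=> jn; have h1 : 0 <= j%:R / n.+1%:R :> R by rewrite divr_ge0.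
  have h2 : j%:R / n.+1%:R <= 1 :> R by rewrite ler_pdivrMr // mul1r ler_nat.
  by apply/andP; split; [exact: mulr_ge0|exact: mulr_ile1].
elim: k => [|k IH] kn; first by rewrite mul0r mulr0.
have := IH (ltnW kn); apply: (hr _ _ _ _ _).1; [exact/hI/ltnW|exact: hI|].
rewrite -mulrBr -mulrBl -natr1 opprD addrA subrr sub0r mulNr mul1r mulrN normrN.
rewrite normrM normfV (ger0_norm t0) (ger0_norm (ltW n0)); apply: le_lt_trans hn.
by rewrite ler_piMl ?invr_ge0.
Qed.

(** The principal branch on the right half-plane: [z + nm z] halves the argument of z, and the
    square of its modulus is [2 * nm z * (nm z + Re z)]. *)
Definition psqrt z : C := (z + (nm z)%:c) / (Num.sqrt (2 * (nm z + Re z)))%:c.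

Lemma psqrtE z : 0 < Re z -> psqrt z ^+ 2 = z.
Proof.
move=> z0; have h : 0 < 2 * (nm z + Re z) by have := nm_ge0 z; lra.
rewrite /psqrt expr_div_n -rcX sqr_sqrtr ?ltW //.
have h' : (2 * (nm z + Re z))%:c != 0 :> C by rewrite rc_eq0 gt_eqF.
apply: (mulIf h'); rewrite divfK //.
move: (nm z) (nm_sq z) {z0 h h'} => n; case: z => a b /= E.
by rewrite expr2; apply/eqP; rewrite eq_complex /=; apply/andP; split; apply/eqP; nra.
Qed.

Lemma psqrt_neq0 z : 0 < Re z -> psqrt z != 0.
Proof.
move=> z0; apply/eqP => E; have := psqrtE z0; rewrite E expr0n /= => Ez.
by move: z0; rewrite -Ez ltxx.
Qed.

Lemma cAt_psqrt {X : Type} (d : X -> X -> R) K f (p : X) :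
  0 < Re (f p) -> cAt d K f p -> cAt d K (fun q => psqrt (f q)) p.
Proof.
move=> f0 cf; have h : 0 < 2 * (nm (f p) + Re (f p)) by have := nm_ge0 (f p); lra.
apply: cAt_div.
- by rewrite rc_eq0 gt_eqF // sqrtr_gt0.
- by apply: cAtD => //; apply: cAt_nm.
apply: (@cAt_sqrt _ d K (fun q => 2 * (nm (f q) + Re (f q)))) => //.
apply: eq_cAt (cAtM (cAt_cst _ _ (2 : R)%:c p) (cAtD (cAt_nm cf) (cAt_Re cf))) => q /=.
by rewrite rcM rcD.
Qed.

Lemma Re_near1 z : nm (z - 1) < 1 -> 0 < Re z.
Proof. by move=> h; have := le_lt_trans (le_Re_nm _) h; rewrite ReB /= ltr_norml; lra. Qed.

Lemma sqr_sign x y : x ^+ 2 = y ^+ 2 -> x = y \/ x = - y.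
Proof. by move/eqP; rewrite eqf_sqr => /orP[] /eqP ->; [left|right]. Qed.

End Plane.

(** * Transport of square roots along a curve *)

Section Plane.
Variable R : realType.
Notation C := R[i].
Notation Re := (@complex.Re R).
Notation Im := (@complex.Im R).
Notation "x %:c" := (real_complex R x) (at level 1, format "x %:c").
Implicit Types (x y z w : C) (t s : R).

Lemma sq_neq0 x : x ^+ 2 != 0 -> x != 0.
Proof. by apply: contra => /eqP ->; rewrite expr0n. Qed.

Definition closedK (K : C -> Prop) := forall z, ~ K z ->
  exists2 r, 0 < r & forall w, nm (w - z) < r -> ~ K w.
Definition bddK (K : C -> Prop) := exists M, forall z, K z -> nm z <= M.

Definition lerp x y t : C := x + t%:c * (y - x).

Lemma lerp0 x y : lerp x y 0 = x. Proof. by rewrite /lerp mul0r addr0. Qed.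
Lemma lerp1 x y : lerp x y 1 = y. Proof. by rewrite /lerp mul1r addrC subrK. Qed.

Lemma cAt_lerp K x y t : cAt (@dR R) K (lerp x y) t.
Proof. by apply: cAtD; [exact: cAt_cst|apply: cAtM; [exact: cAt_rc|exact: cAt_cst]]. Qed.

Lemma lerp_ball x y z (r : R) t : I01 t -> nm (x - z) < r -> nm (y - z) < r ->
  nm (lerp x y t - z) < r.
Proof.
move=> /andP[t0 t1] h1 h2.
rewrite (_ : _ - z = (1 - t)%:c * (x - z) + t%:c * (y - z)); last by rewrite /lerp rcB; ring.
apply: le_lt_trans (nmD _ _) _; rewrite !nmM !nm_real !ger0_norm ?subr_ge0 //.
have [E|E] := eqVneq t 0; first by rewrite E; lra.
have tp : 0 < t by rewrite lt_neqAle eq_sym E.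
have h3 : t * nm (y - z) < t * r by rewrite ltr_pM2l.
have h4 : (1 - t) * nm (x - z) <= (1 - t) * r by rewrite ler_wpM2l ?subr_ge0 // ltW.
lra.
Qed.

(** Connection by a polygon of n + 1 segments inside O. Polygons are easy to concatenate, to follow
    by induction and to build inside balls. *)
Definition joined (O : C -> Prop) x y := exists n (v : nat -> C),
  [/\ v 0%N = x, v n.+1 = y &
   forall i, (i <= n)%N -> forall t, I01 t -> O (lerp (v i) (v i.+1) t)].

Lemma I01_0 : @I01 R 0. Proof. by rewrite /I01 lexx ler01. Qed.
Lemma I01_1 : @I01 R 1. Proof. by rewrite /I01 lexx ler01. Qed.

Lemma joined_seg O x y : (forall t, I01 t -> O (lerp x y t)) -> joined O x y.
Proof.
move=> H; exists 0%N, (fun i => if i is 0%N then x else y); split=> // i.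
by rewrite leqn0 => /eqP -> t; apply: H.
Qed.

Lemma joined_refl (O : C -> Prop) x : O x -> joined O x x.
Proof. by move=> Ox; apply: joined_seg => t _; rewrite /lerp subrr mulr0 addr0. Qed.

Lemma joined_sub (O O' : C -> Prop) x y : (forall z, O z -> O' z) -> joined O x y -> joined O' x y.
Proof. by move=> OO [n [v [h1 h2 h3]]]; exists n, v; split=> // i hi t ht; exact/OO/h3. Qed.

Lemma joined_sym O x y : joined O x y -> joined O y x.
Proof.
move=> [n [v [h1 h2 h3]]]; exists n, (fun i => v (n.+1 - i)%N); split.
- by rewrite subn0.
- by rewrite subnn.
move=> i hi t /andP[t0 t1].
have /h3 /(_ (1 - t)) : (n - i <= n)%N by rewrite leq_subr.
rewrite subSS subSn // => h.
rewrite (_ : lerp _ _ _ = lerp (v (n - i)%N) (v (n - i).+1) (1 - t)).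
  by apply: h; rewrite /I01; apply/andP; split; lra.
by rewrite /lerp rcB; ring.
Qed.

Lemma joined_trans O y x z : joined O x y -> joined O y z -> joined O x z.
Proof.
move=> [n [v [h1 h2 h3]]] [m [u [k1 k2 k3]]].
exists (n + m).+1, (fun i => if (i <= n.+1)%N then v i else u (i - n.+1)%N); split=> //.
  by rewrite ltnS ltnNge leq_addr /= -addnS subSS addKn.
move=> i hi t ht; case: (leqP i n) => hin.
  by rewrite leqW //= ltnS hin; apply: h3.
have F : (i < n.+1)%N = false by rewrite ltnS leqNgt hin.
rewrite F subSn //.
have E : (if (i <= n.+1)%N then v i else u (i - n.+1)%N) = u (i - n.+1)%N.
  by case: ifP => // hi'; rewrite (_ : i = n.+1) ?subnn ?h2 ?k1 //; apply/eqP; rewrite eqn_leq hi' hin.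
by rewrite E; apply: k3 => //; rewrite leq_subLR addSn.
Qed.

Lemma joinedl O x y : joined O x y -> O x.
Proof.
move=> [n [v [h1 h2 h3]]]; have := h3 0%N (leq0n n) 0 I01_0.
by rewrite lerp0 h1.
Qed.

Lemma joinedr O x y : joined O x y -> O y.
Proof. by move/joined_sym/joinedl. Qed.

Lemma joined_ball (O : C -> Prop) z (r : R) x y : (forall w, nm (w - z) < r -> O w) ->
  nm (x - z) < r -> nm (y - z) < r -> joined O x y.
Proof. by move=> H hx hy; apply: joined_seg => t ht; apply: H; apply: lerp_ball. Qed.

Lemma joined_ind (O D : C -> Prop) x y :
  (forall u v, (forall t, I01 t -> O (lerp u v t)) -> D u -> D v) ->
  joined O x y -> D x -> D y.
Proof.
move=> H [n [v [<- <- h3]]] D0.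
suff h k : (k <= n.+1)%N -> D (v k) by apply: h.
by elim: k => // k IH kn; apply: (H (v k)); [exact: h3|exact/IH/ltnW].
Qed.

(** The four half-planes where [Re], [Im] or one of their opposites exceeds M are convex and miss
    the disc. A point of modulus above 2M + 1 lies in one of them, and from each of them the corner
    [P] is reached through at most one other corner. *)
Lemma joined_far (M : R) x y : 0 <= M -> 2 * M + 1 < nm x -> 2 * M + 1 < nm y ->
  joined (fun w => M < nm w) x y.
Proof.
move=> M0.
have HP (L : C -> R) : (forall u v t, L (lerp u v t) = (1 - t) * L u + t * L v) ->
  (forall u, L u <= nm u) -> forall u v, M < L u -> M < L v -> joined (fun w => M < nm w) u v.
  move=> Ll Ln u v hu hv; apply: joined_seg => t /andP[t0 t1].
  apply: lt_le_trans (Ln _); rewrite Ll.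
  have [->|E] := eqVneq t 0; first by rewrite subr0 mul1r mul0r addr0.
  have tp : 0 < t by rewrite lt_neqAle eq_sym E.
  have := ltr_pM2l tp M (L v); rewrite hv => h3.
  have h4 : (1 - t) * M <= (1 - t) * L u by rewrite ler_wpM2l ?subr_ge0 // ltW.
  lra.
pose P : C := Complex (M + 1) (M + 1).
have toP u : 2 * M + 1 < nm u -> joined (fun w => M < nm w) u P.
  move=> hu.
  have H1 := HP Re _ _; have H2 := HP Im _ _.
  have H3 := HP (fun u => - Re u) _ _; have H4 := HP (fun u => - Im u) _ _.
  have e1 a b t : Re (lerp a b t) = (1 - t) * Re a + t * Re b.
    by case: a => a1 a2; case: b => b1 b2; rewrite /lerp /=; ring.
  have e2 a b t : Im (lerp a b t) = (1 - t) * Im a + t * Im b.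
    by case: a => a1 a2; case: b => b1 b2; rewrite /lerp /=; ring.
  have {}H1 := H1 e1 (fun u => le_trans (ler_norm _) (le_Re_nm u)).
  have {}H2 := H2 e2 (fun u => le_trans (ler_norm _) (le_Im_nm u)).
  have {}H3 : forall u v, M < - Re u -> M < - Re v -> joined (fun w => M < nm w) u v.
    apply: H3 => [a b t|a]; first by rewrite e1; ring.
    by apply: le_trans (le_Re_nm a); rewrite -normrN ler_norm.
  have {}H4 : forall u v, M < - Im u -> M < - Im v -> joined (fun w => M < nm w) u v.
    apply: H4 => [a b t|a]; first by rewrite e2; ring.
    by apply: le_trans (le_Im_nm a); rewrite -normrN ler_norm.
  have hP : M < M + 1 by lra.
  have [h|h] := ltP M (Re u); first exact: H1.
  have [h'|h'] := ltP M (Im u); first exact: H2.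
  have [k|k] := ltP M (- Re u).
    apply: (@joined_trans _ (Complex (- (M + 1)) (M + 1))); first by apply: H3 => //=; lra.
    exact: H2.
  have [k'|k'] := ltP M (- Im u).
    apply: (@joined_trans _ (Complex (M + 1) (- (M + 1)))); first by apply: H4 => //=; lra.
    exact: H1.
  have h5 : `|Re u| <= M by rewrite ler_norml; apply/andP; split; lra.
  have h6 : `|Im u| <= M by rewrite ler_norml; apply/andP; split; lra.
  by have := nm_le u; lra.
by move=> hx hy; apply: (@joined_trans _ P); [exact: toP|exact/joined_sym/toP].
Qed.

(** The two square roots of 1 are at distance 2, so a continuous choice cannot jump. *)
Lemma pm1_const (f : R -> C) : pcon f -> (forall t, I01 t -> f t ^+ 2 = 1) ->
  forall t, I01 t -> f t = f 0.
Proof.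
move=> cf f1; apply: (@locconst _ (fun t => f t = f 0)) => // t ht.
have [r r0 H] := cf t ht 1 ltr01; exists r => // s hs hst.
suff -> : f s = f t by [].
have := H s hs hst; have /sqr_sign[//|->] : f s ^+ 2 = f t ^+ 2 by rewrite !f1.
have : nm (f t) ^+ 2 = 1 by rewrite -nm1 -(f1 t ht) [in RHS]expr2 nmM expr2.
rewrite -opprD nmN -mulr2n -[f t *+ 2]mulr_natr nmM => h.
have h2 : nm (2%:R : C) = 2.
  by rewrite (_ : 2%:R = (2 : R)%:c) ?nm_real ?ger0_norm // rmorph_nat.
rewrite h2 => h3; exfalso; have := nm_ge0 (f t); nra.
Qed.

Lemma ratio_pos (k : R -> C) t : I01 t -> cAt (@dR R) (@I01 R) k t -> k t != 0 ->
  exists2 r, 0 < r & forall s s', I01 s -> I01 s' -> `|s - t| < r -> `|s' - t| < r ->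
    0 < Re (k s / k s').
Proof.
move=> ht ck; rewrite -nm_gt0 => k0.
have [|r r0 H] := ck (nm (k t) / 3); first lra.
exists r => // s s' hs hs' h1 h2; have {h1} := H s hs h1; have {h2} := H s' hs' h2.
move=> h2 h1; apply: Re_near1.
have h3 := nm_rtri (k s') (k t); have h4 := nm_tri (k t) (k s) (k s').
rewrite nmB in h2 *; rewrite nmB ler_norml in h3; case/andP: h3 => h3 h3'.
have h5 : 0 < nm (k s') by lra.
have ks0 : k s' != 0 by rewrite -nm_gt0.
rewrite (_ : _ - 1 = (k s - k s') / k s'); last by field.
by rewrite nmM nmV ltr_pdivrMr // mul1r; lra.
Qed.

Lemma pcon_scale (k : R -> C) (c : R) : I01 c -> pcon k -> pcon (fun t => k (t * c)).
Proof.
move=> /andP[c0 c1] ck t /andP[t0 t1].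
have hI s : I01 s -> I01 (s * c).
  by move=> /andP[s0 s1]; apply/andP; split; [exact: mulr_ge0|exact: mulr_ile1].
apply: (@cAt_pre _ _ _ (@dR R) (@dR R) _ (@I01 R) (fun t => t * c)) => //; last first.
  by apply: ck; apply: hI; apply/andP.
move=> r r0; exists r => // s _; rewrite /dR -mulrBl normrM (ger0_norm c0).
by apply: le_lt_trans; rewrite ler_piMr.
Qed.

(** The root at t is a telescoping product: [0, t] is cut into n + 1 equal pieces, and the ratio of
    k at the two ends of a piece has positive real part, so that its principal root is available. As
    n does not depend on t, the product is continuous in t. *)
Lemma sqrt_lift (k : R -> C) : pcon k -> (forall t, I01 t -> k t != 0) ->
  exists2 h, pcon h & forall t, I01 t -> h t ^+ 2 = k t.
Proof.
move=> ck k0.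
have [|r r0 H] := @uniR _ (fun s s' => 0 < Re (k s / k s')).
  by move=> t ht; apply: ratio_pos => //; [exact: ck|exact: k0].
have [n hn] := archN r0.
have n0 : 0 < n.+1%:R :> R by rewrite ltr0n.
pose c (j : nat) : R := j%:R / n.+1%:R.
have hc j : (j <= n.+1)%N -> I01 (c j).
  by move=> jn; rewrite /I01 /c divr_ge0 //= ler_pdivrMr // mul1r ler_nat.
have hI s j : (j <= n.+1)%N -> I01 s -> I01 (s * c j).
  move=> /hc /andP[c0 c1] /andP[s0 s1].
  by apply/andP; split; [exact: mulr_ge0|exact: mulr_ile1].
have hRe j t : (j < n.+1)%N -> I01 t -> 0 < Re (k (t * c j.+1) / k (t * c j)).
  move=> jn ht; apply: H; [exact: hI|by apply: hI => //; apply: ltnW|].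
  rewrite -mulrBr /c -mulrBl -natr1 addrAC subrr add0r mul1r normrM normfV.
  case/andP: ht => t0 t1; rewrite (ger0_norm t0) (ger0_norm (ltW n0)).
  by apply: le_lt_trans hn; rewrite ler_piMl ?invr_ge0.
exists (fun t => sqrtc (k 0) * \prod_(j < n.+1) psqrt (k (t * c j.+1) / k (t * c j))).
  move=> t ht; apply: cAtM; first exact: cAt_cst.
  apply: (@cAt_prod _ _ _ _ (fun j t => psqrt (k (t * c j.+1) / k (t * c j)))) => j jn.
  apply: cAt_psqrt; first exact: hRe.
  apply: cAt_div; first by apply: k0; apply: hI => //; apply: ltnW.
    by apply: (pcon_scale _ ck) => //; apply: hc.
  by apply: (pcon_scale _ ck) => //; apply: hc; apply: ltnW.
move=> t ht; rewrite exprMn sqr_sqrtc.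
suff h m : (m <= n.+1)%N -> k 0 * (\prod_(j < m) psqrt (k (t * c j.+1) / k (t * c j))) ^+ 2 = k (t * c m).
  by rewrite h // /c divff ?gt_eqF // mulr1.
elim: m => [|m IH] mn; first by rewrite big_ord0 /c mul0r mulr0 expr1n mulr1.
rewrite big_ord_recr /= exprMn mulrA IH; last exact: ltnW.
rewrite psqrtE; last exact: hRe.
by rewrite mulrC divfK //; apply: k0; apply: hI => //; apply: ltnW.
Qed.

(** * Half windings of a curve about a point *)

Definition off (g : R -> C) z := forall t, I01 t -> g t != z.
(* A multiplicative half winding: for a closed curve [g] the value is the sign (-1) ^ n, with [n] the
   winding number of [g] about [z]. *)
Definition isrho (g : R -> C) z (r : C) := exists2 h : R -> C,
  pcon h /\ (forall t, I01 t -> h t ^+ 2 = g t - z) & r = h 1 / h 0.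
Definition rho g z : C := xget 0 (isrho g z).

Lemma rhoP g z : pcon g -> off g z -> isrho g z (rho g z).
Proof.
move=> cg og; apply: xgetPex.
have [||h ch h2] := @sqrt_lift (fun t => g t - z).
- by move=> t ht; apply: cAtB; [exact: cg|exact: cAt_cst].
- by move=> t ht; rewrite subr_eq0 og.
by exists (h 1 / h 0), h.
Qed.

(** The quotient of two lifts is a continuous square root of 1, hence constant. *)
Lemma rho_uniq g z r r' : off g z -> isrho g z r -> isrho g z r' -> r = r'.
Proof.
move=> og [h [ch h2] ->] [k [ck k2] ->].
have h0 t : I01 t -> h t != 0.
  by move=> ht; apply: sq_neq0; rewrite h2 // subr_eq0 og.
have k0 t : I01 t -> k t != 0.
  by move=> ht; apply: sq_neq0; rewrite k2 // subr_eq0 og.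
have E : h 1 / k 1 = h 0 / k 0.
  apply: (@pm1_const (fun t => h t / k t)); last exact: I01_1.
    by move=> t ht; apply: cAt_div; [exact: k0|exact: ch|exact: ck].
  by move=> t ht; rewrite expr_div_n h2 // k2 // divff // subr_eq0 og.
have := (h0 _ I01_0); have := (k0 _ I01_0); have := (k0 _ I01_1) => a b c.
by rewrite -[h 1](divfK a) E; field; apply/andP; split.
Qed.

Lemma rho_eq g z r : pcon g -> off g z -> isrho g z r -> rho g z = r.
Proof. by move=> cg og; apply: rho_uniq => //; apply: rhoP. Qed.

Lemma rho_sq g z : pcon g -> off g z -> rho g z ^+ 2 = (g 1 - z) / (g 0 - z).
Proof.
move=> cg og; have [h [_ h2] ->] := rhoP cg og.
by rewrite expr_div_n !h2 //; [exact: I01_0|exact: I01_1].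
Qed.

Lemma rho_neq0 g z : pcon g -> off g z -> rho g z != 0.
Proof.
move=> cg og; apply: sq_neq0; rewrite rho_sq // mulf_neq0 ?invr_eq0 ?subr_eq0 //; apply: og.
  exact: I01_1.
exact: I01_0.
Qed.

Lemma off_dist g z : pcon g -> off g z ->
  exists2 r, 0 < r & forall t, I01 t -> r <= nm (g t - z).
Proof.
move=> cg og.
pose P (A : R -> Prop) := exists2 r, 0 < r & forall t, A t -> I01 t -> r <= nm (g t - z).
suff [r r0 h] : P (fun s => 0 <= s <= 1) by exists r => // t ht; apply: h.
apply: CIR.
- by exists 1.
- move=> A B [r r0 hr] [s s0 hs]; exists (Num.min r s); first by rewrite lt_min r0.
  by move=> u [Au|Bu] hu; rewrite ge_min; apply/orP; [left; exact: hr|right; exact: hs].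
- by move=> A B AB [r r0 hr]; exists r => // s /AB; exact: hr.
- move=> t ht; have d0 : 0 < nm (g t - z) by rewrite nm_gt0 subr_eq0 og.
  have [|r r0 H] := cg t ht (nm (g t - z) / 2); first lra.
  exists r => //; exists (nm (g t - z) / 2); first lra.
  move=> s [_ h1] hs; have := H s hs h1; have := nm_tri (g s) (g t) z.
  by rewrite (nmB (g t) (g s)); lra.
Qed.

(** While z is closer to z0 than the curve is, the ratio [(g t - z) / (g t - z0)] has positive real
    part, so a lift for z0 times its principal root is a lift for z. Only the two ends of the curve
    enter the result, which makes the continuity of [rho g] in z visible. *)
Lemma rho_near g z z0 (r : R) : pcon g -> 0 < r -> (forall t, I01 t -> r <= nm (g t - z0)) ->
  nm (z - z0) < r ->
  rho g z = rho g z0 * (psqrt ((g 1 - z) / (g 1 - z0)) / psqrt ((g 0 - z) / (g 0 - z0))).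
Proof.
move=> cg r0 H hz.
have o0 : off g z0.
  by move=> t /H h; rewrite -subr_eq0 -nm_gt0; apply: lt_le_trans h.
have oz : off g z.
  move=> t /H h; apply/eqP => E; move: h; rewrite E; lra.
have hRe t : I01 t -> 0 < Re ((g t - z) / (g t - z0)).
  move=> ht; apply: Re_near1; have g0 : g t - z0 != 0 by rewrite subr_eq0 o0.
  rewrite (_ : _ - 1 = (z0 - z) / (g t - z0)); last by field.
  rewrite nmM nmV ltr_pdivrMr ?nm_gt0 // mul1r nmB.
  by apply: lt_le_trans hz _; apply: H.
have [h [ch h2] E] := rhoP cg o0.
apply: rho_eq => //; exists (fun t => h t * psqrt ((g t - z) / (g t - z0))).
  split=> t ht.
    apply: cAtM; first exact: ch.
    apply: cAt_psqrt; first exact: hRe.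
    by apply: cAt_div; rewrite ?subr_eq0 ?o0 //; apply: cAtB; try exact: cAt_cst; apply: cg.
  by rewrite exprMn h2 // psqrtE ?hRe // mulrC divfK // subr_eq0 o0.
by rewrite E mulrACA -invfM.
Qed.

Lemma rho_cont g z : pcon g -> off g z -> cAt (@dC R) (@full R) (rho g) z.
Proof.
move=> cg og; have [r r0 H] := off_dist cg og.
have nz t : I01 t -> g t - z != 0 by move=> ht; rewrite subr_eq0 og.
apply: (@cAt_ext _ _ _ _ (fun w => rho g z * (psqrt ((g 1 - w) / (g 1 - z)) / psqrt ((g 0 - w) / (g 0 - z)))) _ _ r) => //.
- by rewrite -(rho_near cg r0 H) // subrr nm0.
- by move=> w _ hw; rewrite -(rho_near cg r0 H).
have hc t : I01 t -> cAt (@dC R) (@full R) (fun w => psqrt ((g t - w) / (g t - z))) z.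
  move=> ht; apply: cAt_psqrt; first by rewrite divff ?nz //= ltr01.
  by apply: cAt_div; [exact: nz| |exact: cAt_cst]; apply: cAtB; [exact: cAt_cst|exact: cAt_id].
apply: cAtM; first exact: cAt_cst.
apply: cAt_div; [|exact: (hc _ I01_1)|exact: (hc _ I01_0)].
by rewrite psqrt_neq0 // divff ?nz //= ?ltr01 //; exact: I01_0.
Qed.

(** When a exceeds b the piece is traversed backwards; [new_arc] relies on this. *)
Definition sub (g : R -> C) (a b : R) (t : R) := g (a + t * (b - a)).

Lemma I01_sub (a b : R) t : I01 a -> I01 b -> I01 t -> I01 (a + t * (b - a)).
Proof.
move=> /andP[a0 a1] /andP[b0 b1] /andP[t0 t1].
rewrite (_ : a + t * (b - a) = (1 - t) * a + t * b); last by ring.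
have h1 : 0 <= (1 - t) * a by rewrite mulr_ge0 // subr_ge0.
have h2 : (1 - t) * a <= (1 - t) * 1 by rewrite ler_wpM2l ?subr_ge0.
have h3 : 0 <= t * b by rewrite mulr_ge0.
have h4 : t * b <= t * 1 by rewrite ler_wpM2l.
by apply/andP; split; lra.
Qed.

Lemma pcon_sub g (a b : R) : I01 a -> I01 b -> pcon g -> pcon (sub g a b).
Proof.
move=> ha hb cg t ht.
apply: (@cAt_pre _ _ _ (@dR R) (@dR R) _ (@I01 R) (fun t => a + t * (b - a))).
- by move=> s hs; apply: I01_sub.
- move=> r r0; exists r => // s _; rewrite /dR (_ : a + _ - _ = (s - t) * (b - a)); last by ring.
  rewrite normrM; apply: le_lt_trans; rewrite ler_piMr // ler_norml.
  by case/andP: ha => a0 a1; case/andP: hb => b0 b1; apply/andP; split; lra.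
- by apply: cg; apply: I01_sub.
Qed.

Lemma off_sub g (a b : R) z : I01 a -> I01 b -> off g z -> off (sub g a b) z.
Proof. by move=> ha hb og t ht; apply: og; apply: I01_sub. Qed.

Lemma rho_cat g (s : R) z : I01 s -> pcon g -> off g z ->
  rho g z = rho (sub g 0 s) z * rho (sub g s 1) z.
Proof.
move=> hs cg og; have [h [ch h2] ->] := rhoP cg og.
rewrite (@rho_eq (sub g 0 s) z (h s / h 0)); first last.
- exists (sub h 0 s).
    by split; [apply: pcon_sub => //; exact: I01_0|move=> t ht; apply: h2; apply: I01_sub => //; exact: I01_0].
  by rewrite /sub !subr0 !add0r mul1r mul0r.
- by apply: off_sub => //; exact: I01_0.
- by apply: pcon_sub => //; exact: I01_0.
rewrite (@rho_eq (sub g s 1) z (h 1 / h s)); first last.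
- exists (sub h s 1).
    by split; [apply: pcon_sub => //; exact: I01_1|move=> t ht; apply: h2; apply: I01_sub => //; exact: I01_1].
  by rewrite /sub mul0r mul1r addr0 addrC subrK.
- by apply: off_sub => //; exact: I01_1.
- by apply: pcon_sub => //; exact: I01_1.
have hs0 : h s != 0 by apply: sq_neq0; rewrite h2 // subr_eq0 og.
have h00 : h 0 != 0 by apply: sq_neq0; rewrite h2 ?subr_eq0 ?og //; exact: I01_0.
by field; rewrite hs0 h00.
Qed.

(** The function [k w = f (- w) / (i * f w)] has a positive real square, so it is real and nonzero
    on the circle; but [k 1 * k (-1) = -1], so its sign would change along a half circle. A positive
    factor c is allowed so that applications need not normalise. *)
Lemma no_sqrt_circle (f : C -> C) : con (fun w => nm w = 1) f ->
  (forall w, nm w = 1 -> exists2 c : R, 0 < c & f w ^+ 2 = c%:c * w) -> False.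
Proof.
move=> cf f2.
have f0 w : nm w = 1 -> f w != 0.
  move=> hw; have [c c0 E] := f2 w hw; apply: sq_neq0; rewrite E mulf_neq0 //.
    by rewrite rc_eq0 gt_eqF.
  by rewrite -nm_gt0 hw.
pose i : C := 'i%C.
have i2 : i ^+ 2 = -1 := sqr_i R.
have i0 : i != 0 by apply: sq_neq0; rewrite i2 oppr_eq0 oner_eq0.
pose k w := f (- w) / (i * f w).
have kR w : nm w = 1 -> Im (k w) = 0 /\ Re (k w) != 0.
  move=> hw; have [c c0 E] := f2 w hw; have [|c' c'0 E'] := f2 (- w); first by rewrite nmN.
  have w0 : w != 0 by rewrite -nm_gt0 hw.
  have cc : c%:c != 0 by rewrite rc_eq0 gt_eqF.
  have : k w ^+ 2 = (c' / c)%:c.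
    rewrite /k expr_div_n exprMn E E' i2 (_ : (c' / c)%:c = c'%:c / c%:c).
      by field; rewrite w0 cc.
    by apply: (mulIf cc); rewrite divfK // -rcM divfK // gt_eqF.
  have : 0 < c' / c by rewrite divr_gt0.
  case: (k w) => a b; move: (c' / c) => d d0 /eqP; rewrite expr2 eq_complex /= => /andP[/eqP h1 /eqP h2].
  have ab : a * b = 0 by lra.
  have [E1|b0] := eqVneq b 0; last first.
    by move/eqP: ab; rewrite mulf_eq0 (negbTE b0) orbF => /eqP a0; move: h1; rewrite a0; nra.
  by split=> //; apply/eqP => a0; move: h1; rewrite a0 E1; lra.
(* A polynomial path from 1 to -1 that avoids 0; divided by its modulus it stays on the circle. *)
pose u t : C := Complex (1 - 2 * t) (t * (1 - t)).
have u0 t : I01 t -> u t != 0.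
  move=> ht; rewrite eq_complex /=; apply/negP => /andP[/eqP h1 /eqP h2].
  have E : t = 1 / 2 by lra.
  by move: h2; rewrite E; lra.
pose v t := u t / (nm (u t))%:c.
have v1 t : I01 t -> nm (v t) = 1.
  by move=> /u0; rewrite -nm_gt0 => h; rewrite /v nmM nmV nm_real gtr0_norm // divff // gt_eqF.
have cu : pcon u.
  move=> t _; apply: (@eq_cAt _ _ _ _ (fun t => 1 - 2%:R * t%:c + i * (t%:c * (1 - t%:c)))).
    by move=> s; apply/eqP; rewrite eq_complex /=; apply/andP; split; apply/eqP; ring.
  have ct : cAt (@dR R) (@I01 R) (fun s => s%:c) t := @cAt_rc _ _ _.
  by apply: cAtD; [apply: cAtB|apply: cAtM]; try apply: cAtM; try apply: cAtB => //; try exact: cAt_cst; exact: ct.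
have cv : pcon v.
  move=> t ht; apply: cAt_div; [|exact: cu|by apply: cAt_nm; exact: cu].
  by rewrite rc_eq0 gt_eqF // nm_gt0 u0.
have ck : pcon (fun t => k (v t)).
  move=> t ht.
  have cf' (s : C) : (s = 1 \/ s = -1) -> cAt (@dR R) (@I01 R) (fun t => f (s * v t)) t.
    move=> hs; have ns : nm s = 1 by case: hs => ->; rewrite ?nmN nm1.
    apply: (@cAt_comp _ _ _ _ (fun w => nm w = 1) (fun t => s * v t)).
    - by move=> q hq; rewrite nmM ns v1 // mulr1.
    - by apply: cAtM; [exact: cAt_cst|exact: cv].
    - by apply: cf; rewrite nmM ns v1 // mulr1.
  have c1 := cf' 1 (or_introl erefl); have c2 := cf' (-1) (or_intror erefl).
  apply: cAt_div; first by rewrite mulf_neq0 // f0 // v1.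
    by apply: eq_cAt c2 => s; rewrite mulN1r.
  by apply: cAtM; [exact: cAt_cst|apply: eq_cAt c1 => s; rewrite mul1r].
have sgn t : I01 t -> exists2 r, 0 < r & forall s, I01 s -> `|s - t| < r ->
    (0 < Re (k (v s)) <-> 0 < Re (k (v t))).
  move=> ht; have [_ h] := kR _ (v1 t ht); have h' : 0 < `|Re (k (v t))| by rewrite normr_gt0.
  have [r r0 H] := ck t ht _ h'; exists r => // s hs hst.
  have := le_lt_trans (le_Re_nm _) (H s hs hst); rewrite ReB.
  by rewrite ltr_norml; have [a|a] := ltP 0 (Re (k (v t))); [rewrite ger0_norm ?(ltW a)|rewrite ler0_norm] => // /andP[]; split; lra.
have v0E : v 0 = 1.
  by rewrite /v (_ : u 0 = 1) ?nm1 ?divr1 //; apply/eqP; rewrite eq_complex /=; apply/andP; split; apply/eqP; ring.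
have v1E : v 1 = -1.
  by rewrite /v (_ : u 1 = -1) ?nmN ?nm1 ?divr1 //; apply/eqP; rewrite eq_complex /=; apply/andP; split; apply/eqP; ring.
have prod : k 1 * k (-1) = -1.
  have a1 : f 1 != 0 by rewrite f0 // nm1.
  have a2 : f (-1) != 0 by rewrite f0 // nmN nm1.
  rewrite /k opprK (_ : _ * _ = (i ^+ 2)^-1); first by rewrite i2 invrN invr1.
  by field; rewrite a1 a2 i0.
have [i1 r1] := kR 1 (nm1 _); have [i1' r1'] : Im (k (-1)) = 0 /\ Re (k (-1)) != 0 by apply: kR; rewrite nmN nm1.
have pR : Re (k 1) * Re (k (-1)) = -1.
  by move: prod i1 i1'; case: (k 1) => a b; case: (k (-1)) => a' b' /= /eqP; rewrite eq_complex /= => /andP[/eqP h _] b0 b0'; move: h; rewrite b0 b0' mul0r subr0.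
have L1 := @locconst _ (fun t => 0 < Re (k (v t))) sgn.
have L2 := @locconst _ (fun t => ~ 0 < Re (k (v t))).
have [a|a] := ltP 0 (Re (k 1)).
  by have := L1; rewrite v0E => /(_ a 1 I01_1); rewrite v1E; move: a pR; clear; nra.
have : ~ 0 < Re (k (v 1)).
  apply: L2; [|by rewrite v0E; apply/negP; rewrite -leNgt|exact: I01_1].
  by move=> t /sgn [r r0 H]; exists r => // s hs h; rewrite (H s hs h).
rewrite v1E => /negP; rewrite -leNgt => b.
move: a b pR; clear; nra.
Qed.
End Plane.

(** * A set separating p from q carries no square root of (w - p)(w - q) *)

Section Plane.
Variable R : realType.
Notation C := R[i].
Notation Re := (@complex.Re R).
Notation Im := (@complex.Im R).
Notation "x %:c" := (real_complex R x) (at level 1, format "x %:c").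
Implicit Types (x y z w : C) (t s : R).

Lemma tietze_R (K : C -> Prop) (f : C -> R) (M : R) : closedK K ->
  (forall w, K w -> `|f w| <= M) -> con K (fun w => (f w)%:c) ->
  exists2 g : C -> R, con (@full R) (fun w => (g w)%:c) & forall w, K w -> g w = f w.
Proof.
move=> cK bf cf.
pose A : set (R * R) := fun p => K (Complex p.1 p.2).
pose f' : R * R -> R := fun p => f (Complex p.1 p.2).
have nmlt (p q : R * R) (r : R) : ball p (r / 2) q -> nm (Complex q.1 q.2 - Complex p.1 p.2) < r.
  case: p q => p1 p2 [q1 q2]; rewrite /ball => -[h1 h2].
  apply: le_lt_trans (nm_le _) _; rewrite /= distrC [`|q2 - _|]distrC /=; move: h1 h2; rewrite /ball /=; lra.
have clA : closed A.
  move=> p clp; apply: contrapT => nA; have [r r0 H] := cK _ nA.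
  have [|q [Aq bq]] := clp (ball p (r / 2)); first by apply: nbhsx_ballx; lra.
  by apply: (H (Complex q.1 q.2)) Aq; apply: nmlt.
have cA : {within A, continuous (f' : _ -> R^o)}%classic.
  apply/subspace_continuousP => p Ap; apply/cvgrPdist_lt => e e0.
  have [r r0 H] := cf _ Ap e e0.
  change (nbhs p (fun q => A q -> `|f' p - f' q| < e)); apply/nbhs_ballP.
  exists (r / 2) => /=; first lra.
  move=> q bq Aq; have := H _ Aq (nmlt _ _ _ bq).
  by rewrite -rcB nm_real distrC.
(* The bound has to be positive, hence [|M| + 1] instead of M. *)
have [||g [gf cg _]] := @continuous_bounded_extension _ _ (@pseudometric_normal R (R * R)%type) A clA f' (`|M| + 1) _ cA.
- by rewrite ltr_wpDl.
- by move=> p Ap; apply: le_trans (bf _ Ap) _; have := ler_norm M; lra.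
have [g1 [gf1 cg1]] : exists g1 : R * R -> R, (forall p, A p -> g1 p = f' p) /\
    forall p e, 0 < e -> exists2 r : R, 0 < r & forall q, ball p r q -> `|g1 p - g1 q| < e.
  exists g; split=> [p Ap|p e e0]; first by rewrite -gf ?inE.
  by have /cvgrPdist_lt /(_ e e0) /nbhs_ballP[r /= r0 H] := cg p; exists r.
exists (fun w => g1 (Re w, Im w)).
  move=> w _ e e0; have [r r0 H] := cg1 (Re w, Im w) e e0; exists r => // v _ hv.
  rewrite -rcB nm_real distrC; apply: H; split; rewrite /ball /= distrC.
    by rewrite -ReB; apply: le_lt_trans (le_Re_nm _) hv.
  by rewrite -ImB; apply: le_lt_trans (le_Im_nm _) hv.
by move=> w Kw; rewrite gf1; [rewrite /f'; case: (w)|rewrite /A /=; case: (w) Kw].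
Qed.

Lemma tietze_C (K : C -> Prop) (f : C -> C) (M : R) : closedK K ->
  (forall w, K w -> nm (f w) <= M) -> con K f ->
  exists2 g : C -> C, con (@full R) g & forall w, K w -> g w = f w.
Proof.
move=> cK bf cf.
have [|w Kw|g1 cg1 E1] := @tietze_R K (fun w => Re (f w)) M cK.
- by move=> w Kw; apply: le_trans (le_Re_nm _) (bf _ Kw).
- exact/cAt_Re/cf.
have [|w Kw|g2 cg2 E2] := @tietze_R K (fun w => Im (f w)) M cK.
- by move=> w Kw; apply: le_trans (le_Im_nm _) (bf _ Kw).
- exact/cAt_Im/cf.
exists (fun w => (g1 w)%:c + 'i%C * (g2 w)%:c).
  by move=> w _; apply: cAtD; [exact: cg1|apply: cAtM; [exact: cAt_cst|exact: cg2]].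
by move=> w Kw; rewrite E1 // E2 // -complexE.
Qed.

(** The boundary of the open set U is contained in K, where f and g agree. *)
Lemma con_pw (U K : C -> Prop) (f g : C -> C) :
  (forall w, U w -> exists2 r, 0 < r & forall v, nm (v - w) < r -> U v) ->
  (forall w, ~ U w -> ~ K w -> exists2 r, 0 < r & forall v, nm (v - w) < r -> ~ U v) ->
  con (@full R) f -> con (@full R) g -> (forall w, K w -> f w = g w) ->
  con (@full R) (fun w => if `[< U w >] then f w else g w).
Proof.
move=> oU oV cf cg fg w _.
have [Uw|nU] := pselect (U w).
  have [r r0 H] := oU w Uw; apply: (@cAt_ext _ _ _ _ f _ _ r) => //; last exact: cf.
    by rewrite asboolT.
  by move=> v _ hv; rewrite asboolT //; apply: H.
have [Kw|nK] := pselect (K w); last first.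
  have [r r0 H] := oV w nU nK; apply: (@cAt_ext _ _ _ _ g _ _ r) => //; last exact: cg.
    by rewrite asboolF.
  by move=> v _ hv; rewrite asboolF //; apply: H.
move=> e e0; have [r r0 H] := cf w I e e0; have [r' r'0 H'] := cg w I e e0.
exists (Num.min r r'); first by rewrite lt_min r0.
move=> v _; rewrite lt_min => /andP[h h'].
rewrite [`[< U w >]]asboolF //; case: asboolP => _; last exact: H'.
by rewrite -fg //; apply: H.
Qed.

Lemma nm_sqc x : (nm (x ^+ 2))%:c = x * x^*%C.
Proof.
rewrite expr2 nmM -expr2 nm_sq; case: x => a b.
by apply/eqP; rewrite eq_complex /=; apply/andP; split; apply/eqP; ring.
Qed.

Definition d2 (p q : C * C) : R := Num.max (nm (p.1 - q.1)) (nm (p.2 - q.2)).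

(* The double cover [s ^ 2 = w], trivialised over [K] by [s], is pushed into the real line bundle
   spanned by [(T, d)] in [C x R], where [T] extends [s] and [d] is nonzero wherever [T] vanishes;
   following it along the rays from 0 gives a square root of [w] on a large circle. *)
Lemma no_sqrt_around (K U : C -> Prop) (s : C -> C) (L : R) :
  closedK K -> (forall w, K w \/ U w -> nm w < L) -> U 0 -> (forall w, U w -> ~ K w) ->
  (forall w, U w -> exists2 r, 0 < r & forall v, nm (v - w) < r -> U v) ->
  (forall w, ~ U w -> ~ K w -> exists2 r, 0 < r & forall v, nm (v - w) < r -> ~ U v) ->
  con K s -> (forall w, K w -> s w ^+ 2 = w) -> False.
Proof.
move=> cK bL U0 UK oU oV cs s2.
have L0 : 0 < L by have := bL 0 (or_intror U0); rewrite nm0.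
have [m m0 Hm] := cK 0 (UK _ U0).
have mK w : K w -> m <= nm w.
  by move=> Kw; rewrite leNgt; apply/negP => h; apply: (Hm w) Kw; rewrite subr0.
have [w Kw|T cT TE] := @tietze_C K s (L + 1) cK _ cs.
  have h := bL w (or_introl Kw); have : nm (s w) ^+ 2 < L by rewrite expr2 -nmM -expr2 s2.
  by have := nm_ge0 (s w); nra.
(* On K, [nm (T w) ^+ 2 = nm w >= m] makes [xr w] nonpositive, so that [dr w], twice its positive
   part, vanishes. Where T vanishes, [dr w] is 2. *)
pose xr w : R := 1 - m^-1 * (nm (T w) * nm (T w)).
pose dr w : R := xr w + `|xr w|.
have cxr : con (@full R) (fun w => (xr w)%:c).
  move=> w _; apply: (@eq_cAt _ _ _ _ (fun w => 1 - (m^-1)%:c * ((nm (T w))%:c * (nm (T w))%:c))).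
    by move=> v; rewrite /xr rcB !rcM.
  have cn := cAt_nm (cT w I).
  by apply: cAtB; [exact: cAt_cst|apply: cAtM; [exact: cAt_cst|exact: cAtM]].
have cdr : con (@full R) (fun w => (dr w)%:c).
  move=> w _; apply: (@eq_cAt _ _ _ _ (fun w => (xr w)%:c + (nm (xr w)%:c)%:c)).
    by move=> v; rewrite /dr rcD nm_real.
  by apply: cAtD; [exact: cxr|apply: cAt_nm; exact: cxr].
have drK w : K w -> dr w = 0.
  move=> Kw; rewrite /dr ler0_norm ?subrr // /xr TE // -nmM -expr2 s2 // subr_le0.
  by rewrite mulrC ler_pdivlMr // mul1r mK.
have drT w : T w = 0 -> dr w != 0.
  by move=> E; rewrite /dr /xr E nm0 mulr0 mulr0 subr0 normr1 gt_eqF //; lra.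
(* A generator (t, d) of the line over w is determined at best up to sign, but its products t ^ 2, t
   d and d ^ 2 are not affected by the sign. They are continuous on the whole plane: outside U the
   generator is (sqrt w, 0), and on K both descriptions agree. *)
pose A w : C := if `[< U w >] then T w ^+ 2 else w.
pose B w : C := if `[< U w >] then T w * (dr w)%:c else 0.
pose D w : C := if `[< U w >] then (dr w)%:c ^+ 2 else 0.
have cA : con (@full R) A.
  apply: (con_pw oU oV) => [w _|w _|w Kw]; last by rewrite TE // s2.
    by apply: cAtM; exact: cT.
  exact: cAt_id.
have cB : con (@full R) B.
  apply: (con_pw oU oV) => [w _|w _|w Kw]; last by rewrite drK // mulr0.
    by apply: cAtM; [exact: cT|exact: cdr].
  exact: cAt_cst.
have cD : con (@full R) D.
  apply: (con_pw oU oV) => [w _|w _|w Kw]; last by rewrite drK // expr0n.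
    by apply: cAtM; exact: cdr.
  exact: cAt_cst.
have frame w : exists (t0 : C) (d0 : R), [/\ t0 ^+ 2 = A w, t0 * d0%:c = B w, d0%:c ^+ 2 = D w &
    (t0 != 0) || (d0 != 0)].
  rewrite /A /B /D; case: asboolP => [Uw|nU].
    exists (T w), (dr w); split=> //; case: eqP => //= E; exact: drT.
  exists (sqrtc w), 0; rewrite mulr0 expr0n sqr_sqrtc; split=> //.
  by rewrite eqxx orbF; apply: sq_neq0; rewrite sqr_sqrtc; apply/eqP => E; rewrite E in nU.
(* Twice the square of the inner product of the generators over w and w', expressed by the products
   only ([qE]); positivity means that the two lines are not orthogonal. *)
pose q w w' : R := Re (A w * (A w')^*%C) + nm (A w) * nm (A w') + 4 * Re (B w * (B w')^*%C)
  + 2 * Re (D w * (D w')^*%C).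
have qE (t1 : C) (d1 : R) (t0 : C) (d0 : R) w w' : t1 ^+ 2 = A w -> t1 * d1%:c = B w -> d1%:c ^+ 2 = D w ->
    t0 ^+ 2 = A w' -> t0 * d0%:c = B w' -> d0%:c ^+ 2 = D w' ->
    q w w' = 2 * (Re (t1 * t0^*%C) + d1 * d0) ^+ 2.
  rewrite /q => <- <- <- <- <- <-.
  rewrite !expr2 !nmM -!expr2 !nm_sq; case: t1 => a b; case: t0 => c d /=; ring.
have cq p : cAt d2 (fun=> True) (fun p => (q p.1 p.2)%:c) p.
  have c1 f : con (@full R) f -> cAt d2 (fun=> True) (fun p => f p.1) p.
    move=> cf; apply: (@cAt_pre _ _ _ d2 (@dC R) _ (@full R) (fun p => p.1)) => //; last exact: cf.
    by move=> r r0; exists r => // u _; rewrite /d2 gt_max => /andP[].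
  have c2 f : con (@full R) f -> cAt d2 (fun=> True) (fun p => f p.2) p.
    move=> cf; apply: (@cAt_pre _ _ _ d2 (@dC R) _ (@full R) (fun p => p.2)) => //; last exact: cf.
    by move=> r r0; exists r => // u _; rewrite /d2 gt_max => /andP[].
  pose F f (p : C * C) := (Re (f p.1 * (f p.2)^*%C))%:c.
  have cF f : con (@full R) f -> cAt d2 (fun=> True) (F f) p.
    by move=> cf; apply: cAt_Re; apply: cAtM; [exact: c1|apply: cAt_conj; exact: c2].
  apply: (@eq_cAt _ _ _ _ (fun p => F A p + (nm (A p.1))%:c * (nm (A p.2))%:c + 4%:c * F B p + 2%:c * F D p)).
    by move=> u; rewrite /q /F -!rcM -!rcD.
  apply: cAtD; [apply: cAtD; [apply: cAtD|]|].
  - exact: cF.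
  - by apply: cAtM; apply: cAt_nm; [exact: c1|exact: c2].
  - by apply: cAtM; [exact: cAt_cst|exact: cF].
  - by apply: cAtM; [exact: cAt_cst|exact: cF].
have [z|r r0 Hr] := @uniC _ L (fun w w' => 0 < q w w').
  have [t0 [d0 [h1 h2 h3 h4]]] := frame z.
  have qz : 0 < q z z.
    rewrite (qE _ _ _ _ _ _ h1 h2 h3 h1 h2 h3) pmulr_rgt0 // exprn_gt0 //.
    have -> : Re (t0 * t0^*%C) = nm t0 ^+ 2 by rewrite nm_sq; case: (t0) => a b /=; ring.
    case/orP: h4 => h4.
      by rewrite ltr_pwDl // ?exprn_gt0 ?nm_gt0 // -expr2 sqr_ge0.
    by rewrite ltr_wpDl // ?sqr_ge0 // -expr2 lt_neqAle sqr_ge0 eq_sym sqrf_eq0 h4.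
  have [r r0 H] := cq (z, z) _ qz; exists r => // w w' h h'.
  have := H (w, w') I; rewrite /d2 gt_max h h' => /(_ isT).
  by rewrite -rcB nm_real ltr_norml; lra.
have [n hn] := archN (divr_gt0 r0 L0).
have n0 : 0 < n.+1%:R :> R by rewrite ltr0n.
pose c (j : nat) : R := j%:R / n.+1%:R.
pose S1 w := nm w = 1.
pose z (k : nat) w := w * (L * c k)%:c.
(* Along each ray, (tau, del) is a nonzero real multiple of a generator of the line over the k-th
   point, and it depends continuously on the direction w. *)
have Pk k : (k <= n.+1)%N -> exists tau del : C -> C, [/\ con S1 tau, con S1 del &
    forall w, S1 w -> exists (t0 : C) (d0 l : R), [/\ l != 0, t0 ^+ 2 = A (z k w), t0 * d0%:c = B (z k w),
      d0%:c ^+ 2 = D (z k w) & tau w = l%:c * t0 /\ del w = l%:c * d0%:c]].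
  elim: k => [|k IH] kn.
    have [t0 [d0 [h1 h2 h3 h4]]] := frame 0.
    exists (fun=> t0), (fun=> d0%:c); split; try by move=> w _; exact: cAt_cst.
    move=> w _; exists t0, d0, 1; rewrite /z /c mul0r mulr0 mulr0; split=> //.
    by rewrite !mul1r.
  have [tau [del [ct cd H]]] := IH (ltnW kn).
  have cz f : con (@full R) f -> con S1 (fun w => f (z k.+1 w)).
    move=> cf w _; apply: (@cAt_comp _ _ _ _ (@full R) (z k.+1)) => //; last exact: cf.
    by apply: cAtM; [exact: cAt_id|exact: cAt_cst].
  pose hf : C := (2^-1)%:c.
  (* The generator of the next line times its inner product with (tau, del), that is, an
     unnormalised orthogonal projection, written with A, B and D alone. It is nonzero because the
     points are close enough for [q] to be positive. *)
  exists (fun w => hf * (A (z k.+1 w) * (tau w)^*%C + (nm (A (z k.+1 w)))%:c * tau w) + B (z k.+1 w) * del w),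
    (fun w => hf * (B (z k.+1 w) * (tau w)^*%C + (B (z k.+1 w))^*%C * tau w) + D (z k.+1 w) * del w).
  split=> w S1w.
  - have cAw := cz _ cA w S1w; have cBw := cz _ cB w S1w; have ctw := ct w S1w; have cdw := cd w S1w.
    apply: cAtD; last exact: cAtM.
    apply: cAtM; [exact: cAt_cst|apply: cAtD; apply: cAtM => //]; first exact: cAt_conj.
    exact: cAt_nm.
  - have cDw := cz _ cD w S1w; have cBw := cz _ cB w S1w; have ctw := ct w S1w; have cdw := cd w S1w.
    apply: cAtD; last exact: cAtM.
    apply: cAtM; [exact: cAt_cst|apply: cAtD; apply: cAtM => //]; exact: cAt_conj.
  have [t0 [d0 [l [l0 a0 b0 e0 [E1 E2]]]]] := H w S1w.
  have [t1 [d1 [a1 b1 e1 _]]] := frame (z k.+1 w).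
  pose mu := Re (t1 * t0^*%C) + d1 * d0.
  have mu0 : mu != 0.
    have : 0 < q (z k.+1 w) (z k w).
      apply: Hr; rewrite /z.
        rewrite nmM S1w mul1r nm_real ger0_norm; last by rewrite mulr_ge0 ?(ltW L0) // divr_ge0.
        by rewrite ger_pMr // ler_pdivrMr // mul1r ler_nat.
      rewrite -mulrBr nmM S1w mul1r -rcB nm_real -mulrBr -mulrBl -natr1 addrAC subrr add0r mul1r.
      by rewrite ger0_norm ?mulr_ge0 ?(ltW L0) ?invr_ge0 // mulrC -ltr_pdivlMr.
    rewrite (qE _ _ _ _ _ _ a1 b1 e1 a0 b0 e0) -/mu; apply: contraTneq => ->.
    by rewrite expr0n mulr0 ltxx.
  exists t1, d1, (l * mu); split=> //; first exact: mulf_neq0.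
  rewrite E1 E2 -a1 -b1 -e1 nm_sqc /hf /mu; split.
    move: (l) (d1) (d0) (t1) (t0) => l' x1 x0 [a b] [a' b'].
    by apply/eqP; rewrite !expr2 eq_complex /=; apply/andP; split; apply/eqP; field.
  move: (l) (d1) (d0) (t1) (t0) => l' x1 x0 [a b] [a' b'].
  by apply/eqP; rewrite !expr2 eq_complex /=; apply/andP; split; apply/eqP; field.
have [tau [del [ct _ H]]] := Pk _ (leqnn _).
apply: (no_sqrt_circle ct) => w S1w.
have [t0 [d0 [l [l0 a0 _ _ [E1 _]]]]] := H w S1w.
have zE : z n.+1 w = w * L%:c by rewrite /z /c divff ?mulr1 // gt_eqF.
have nU : ~ U (z n.+1 w).
  move=> Uz; have := bL _ (or_intror Uz); rewrite zE nmM S1w mul1r nm_real ger0_norm ?ltxx //; exact: ltW.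
exists (l ^+ 2 * L); first by rewrite mulr_gt0 // lt_neqAle eq_sym sqrf_eq0 l0 sqr_ge0.
rewrite E1 exprMn a0 /A asboolF // zE rcM rcX; ring.
Qed.

Lemma sep_not_sqrt (K : C -> Prop) p q (s : C -> C) : closedK K -> bddK K -> ~ K p -> ~ K q ->
  con K s -> (forall w, K w -> s w ^+ 2 = (w - p) * (w - q)) ->
  joined (fun w => ~ K w) p q.
Proof.
move=> cK [M0 bM0] nKp nKq cs s2; apply: contrapT => nJ.
pose M := `|M0|.
have M_ge0 : 0 <= M by rewrite /M normr_ge0.
have bM w : K w -> nm w <= M by move=> /bM0 h; apply: le_trans h (ler_norm _).
pose O w := ~ K w; pose U0 := joined O p.
have pq : p - q != 0.
  by rewrite subr_eq0; apply/eqP => E; apply: nJ; rewrite E; apply: joined_refl.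
pose c := (p - q)^-1.
have cpq : c * (p - q) = 1 by rewrite mulVf.
pose f w := q + (w + c)^-1.
pose P : C := Complex (2 * M + 2) 0.
have nP : 2 * M + 1 < nm P.
  by apply: lt_le_trans (le_trans (ler_norm _) (le_Re_nm _)); rewrite /=; lra.
have farO x y : 2 * M + 1 < nm x -> 2 * M + 1 < nm y -> joined O x y.
  move=> hx hy; apply: joined_sub (joined_far M_ge0 hx hy) => w hw /bM; lra.
have U0O w : U0 w -> O w by move/joinedr.
have U0_open w : U0 w -> exists2 r, 0 < r & forall v, nm (v - w) < r -> U0 v.
  move=> hw; have [r r0 H] := cK w (U0O _ hw); exists r => // v hv.
  apply: (joined_trans hw); apply: (joined_ball H) => //; by rewrite subrr nm0.
have U0_coopen w : ~ U0 w -> O w -> exists2 r, 0 < r & forall v, nm (v - w) < r -> ~ U0 v.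
  move=> hw Ow; have [r r0 H] := cK w Ow; exists r => // v hv hU; apply: hw.
  apply: (joined_trans hU); apply: (joined_ball H) => //; by rewrite subrr nm0.
have fcont w : w + c != 0 -> cAt (@dC R) (@full R) f w.
  move=> wc; apply: cAtD; first exact: cAt_cst.
  by apply: cAtV => //; apply: cAtD; [exact: cAt_id|exact: cAt_cst].
have wc_near w : w + c != 0 -> exists2 r, 0 < r & forall v, nm (v - w) < r -> v + c != 0.
  move=> wc; have cc : cAt (@dC R) (@full R) (fun v => v + c) w.
    by apply: cAtD; [exact: cAt_id|exact: cAt_cst].
  by have [r r0 H] := cAt_near0 cc wc; exists r => // v hv; apply: H.
have far_near : exists2 r, 0 < r & forall v, nm (v + c) < r -> v + c != 0 -> 2 * M + 1 < nm (f v).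
  have d0 : 0 < 2 * M + 1 + nm q by have := nm_ge0 q; lra.
  exists (2 * M + 1 + nm q)^-1; first by rewrite invr_gt0.
  move=> v hv vc; have := nmD (f v) (- q); rewrite nmN (_ : f v - q = (v + c)^-1); last by rewrite /f; ring.
  have n0 : 0 < nm (v + c) by rewrite nm_gt0.
  have : 2 * M + 1 + nm q < nm (v + c)^-1 by rewrite nmV -ltf_pV2 ?posrE ?invr_gt0 // invrK.
  lra.
pose K' w := w + c != 0 /\ K (f w).
pose U' w := (w + c != 0 /\ U0 (f w)) \/ (w + c = 0 /\ U0 P).
have [rq rq0 Hq] := cK q nKq.
have near_q z : nm (z - q) < rq -> O z /\ ~ U0 z.
  move=> hz; split; first exact: Hq.
  move=> hU; apply: nJ; apply: (joined_trans hU); apply: (joined_ball Hq) => //.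
  by rewrite subrr nm0.
have bdw w : w + c != 0 -> K (f w) \/ U0 (f w) -> nm w < rq^-1 + nm c + 1.
  move=> wc h.
  have h1 : rq <= nm (w + c)^-1.
    rewrite leNgt; apply/negP => h2.
    have [] := near_q (f w); first by rewrite (_ : f w - q = (w + c)^-1) // /f; ring.
    by case: h.
  have n0 : 0 < nm (w + c) by rewrite nm_gt0.
  have : nm (w + c) <= rq^-1.
    by rewrite -[X in X <= _]invrK lef_pV2 ?posrE ?invr_gt0 // -nmV.
  by have := nmD (w + c) (- c); rewrite addrK nmN; lra.
have rqV : 0 < rq^-1 by rewrite invr_gt0.
pose k := sqrtc (- c).
apply: (@no_sqrt_around K' U' (fun w => k * s (f w) * (w + c)) (rq^-1 + nm c + 1)).
- move=> w nK'; have [E|wc] := eqVneq (w + c) 0.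
    have [r r0 H] := far_near; exists r => // v hv [vc Kf].
    have := H v _ vc; rewrite (_ : v + c = (v - w) + (w + c)); last by ring.
    by rewrite E addr0 => /(_ hv); have := bM _ Kf; lra.
  have nKf : ~ K (f w) by move=> h; apply: nK'; split.
  have [e e0 H] := cK _ nKf; have [r r0 H'] := fcont w wc e e0.
  by exists r => // v hv [_ Kf]; apply: (H (f v)) Kf; apply: H'.
- move=> w [[wc Kf]|[[wc Uf]|[E _]]]; [by apply: bdw => //; left|by apply: bdw => //; right|].
  by move/eqP: E; rewrite addr_eq0 => /eqP ->; rewrite nmN; lra.
- left; rewrite add0r /c invr_eq0 pq; split=> //.
  by rewrite /f add0r /c invrK addrC subrK; apply: joined_refl.
- by move=> w [[wc Uf]|[E _]] [wc' Kf]; [exact: (U0O _ Uf)|rewrite E eqxx in wc'].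
- move=> w [[wc Uf]|[E UP]].
    have [e e0 H] := U0_open _ Uf; have [r r0 H'] := fcont w wc e e0.
    have [r' r'0 H''] := wc_near w wc; exists (Num.min r r'); first by rewrite lt_min r0.
    move=> v; rewrite lt_min => /andP[h1 h2]; left; split; first exact: H''.
    by apply: H; apply: H'.
  have [r r0 H] := far_near; exists r => // v hv.
  have [E'|vc] := eqVneq (v + c) 0; first by right.
  left; split=> //; apply: (joined_trans UP); apply: farO => //; apply: H => //.
  rewrite (_ : v + c = (v - w) + (w + c)); last by ring.
    by rewrite E addr0.
- move=> w nU' nK'; have [E|wc] := eqVneq (w + c) 0.
    have nUP : ~ U0 P by move=> h; apply: nU'; right.
    have [r r0 H] := far_near; exists r => // v hv [[vc Uf]|[_ //]]; apply: nUP.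
    apply: (joined_trans Uf); apply: farO => //; apply: H => //.
    rewrite (_ : v + c = (v - w) + (w + c)); last by ring.
    by rewrite E addr0.
  have nUf : ~ U0 (f w) by move=> h; apply: nU'; left.
  have nKf : O (f w) by move=> h; apply: nK'.
  have [e e0 H] := U0_coopen _ nUf nKf; have [r r0 H'] := fcont w wc e e0.
  have [r' r'0 H''] := wc_near w wc; exists (Num.min r r'); first by rewrite lt_min r0.
  move=> v; rewrite lt_min => /andP[h1 h2] [[_ Uf]|[E _]].
    by apply: (H (f v)) Uf; apply: H'.
  by have := H'' v h2; rewrite E eqxx.
- move=> w [wc Kf]; apply: cAtM; last by apply: cAtD; [exact: cAt_id|exact: cAt_cst].
  apply: cAtM; first exact: cAt_cst.
  apply: (@cAt_comp _ _ _ _ K f) => [v [] //||]; last exact: cs.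
  by apply: (cAt_sub _ (fcont w wc)).
- move=> w [wc Kf]; rewrite !exprMn s2 // sqr_sqrtc /f.
  have E : p = q + c^-1 by rewrite /c invrK addrC subrK.
  have c0 : c != 0 by rewrite /c invr_eq0.
  by rewrite E; field; rewrite c0 wc.
Qed.
End Plane.

(** * Joining points off a union of arcs *)

Section Plane.
Variable R : realType.
Notation C := R[i].
Notation Re := (@complex.Re R).
Notation Im := (@complex.Im R).
Notation "x %:c" := (real_complex R x) (at level 1, format "x %:c").
Implicit Types (x y z w : C) (t s : R).

Lemma sub0 h (a b : R) : sub h a b 0 = h a. Proof. by rewrite /sub mul0r addr0. Qed.
Lemma sub1 h (a b : R) : sub h a b 1 = h b.
Proof. by rewrite /sub mul1r (addrC a) subrK. Qed.

(** * Pasting functions along finitely many arcs *)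

Lemma fin_min (I : finType) (Q : I -> R -> Prop) :
  (forall i (r s : R), Q i r -> s <= r -> 0 < s -> Q i s) ->
  (forall i, exists2 r, 0 < r & Q i r) -> exists2 r, 0 < r & forall i, Q i r.
Proof.
move=> mono H.
suff [r r0 h] : exists2 r : R, 0 < r & forall i, i \in enum I -> Q i r.
  by exists r => // i; apply: h; rewrite mem_enum.
elim: (enum I) => [|i s [r r0 IH]]; first by exists 1.
have [r' r'0 h] := H i; exists (Num.min r r'); first by rewrite lt_min r0.
have m0 : 0 < Num.min r r' by rewrite lt_min r0.
move=> j; rewrite inE => /orP[/eqP ->|/IH h']; [apply: mono h _ m0|apply: mono h' _ m0].
  by rewrite ge_min lexx orbT.
by rewrite ge_min lexx.
Qed.

Definition img (h : R -> C) w := exists2 t, I01 t & w = h t.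
Definition inj01 (h : R -> C) := forall t s, I01 t -> I01 s -> h t = h s -> t = s.

Lemma off_img h z : off h z <-> ~ img h z.
Proof.
split=> [oh [t ht E]|n t ht]; first by have := oh t ht; rewrite E eqxx.
by apply/eqP => E; apply: n; exists t.
Qed.

Lemma off_near h z : pcon h -> off h z ->
  exists2 r, 0 < r & forall w, nm (w - z) < r -> off h w.
Proof.
move=> ch oh; have [r r0 H] := off_dist ch oh; exists r => // w hw t ht.
by apply/eqP => E; have := H t ht; rewrite E; lra.
Qed.

Lemma closed_img h : pcon h -> closedK (img h).
Proof.
move=> ch z /off_img oh; have [r r0 H] := off_near ch oh; exists r => // w hw.
by apply/off_img; apply: H.
Qed.

Lemma bdd_img h : pcon h -> bddK (img h).
Proof.
move=> ch.
pose P (A : R -> Prop) := exists M, forall t, A t -> I01 t -> nm (h t) <= M.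
suff [M H] : P (fun s => 0 <= s <= 1) by exists M => z [t ht ->]; apply: H.
apply: CIR.
- by exists 0.
- move=> A B [M HM] [N HN]; exists (Num.max M N) => t [At|Bt] ht; rewrite le_max.
    by rewrite HM.
  by rewrite HN // orbT.
- by move=> A B AB [M HM]; exists M => t /AB; apply: HM.
- move=> t ht; have [r r0 H] := ch t ht 1 ltr01; exists r => //; exists (nm (h t) + 1) => s [_ hs] hs'.
  by have := H s hs' hs; have := nmD (h s - h t) (h t); rewrite subrK; lra.
Qed.

(** Compactness again: the inverse of an injective path is continuous. *)
Lemma inj_dist h (t0 e : R) : pcon h -> inj01 h -> I01 t0 -> 0 < e ->
  exists2 m, 0 < m & forall t, I01 t -> nm (h t - h t0) < m -> `|t - t0| < e.
Proof.
move=> ch ih ht0 e0.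
pose P (A : R -> Prop) := exists2 m, 0 < m &
  forall t, A t -> I01 t -> e <= `|t - t0| -> m <= nm (h t - h t0).
suff [m m0 H] : P (fun s => 0 <= s <= 1).
  exists m => // t ht; apply: contraTT; rewrite -!leNgt; exact: H.
apply: CIR.
- by exists 1.
- move=> A B [r r0 hr] [s s0 hs]; exists (Num.min r s); first by rewrite lt_min r0.
  by move=> u [Au|Bu] hu hu'; rewrite ge_min; apply/orP; [left; exact: hr|right; exact: hs].
- by move=> A B AB [r r0 hr]; exists r => // s /AB; exact: hr.
- move=> t ht; have [E|tt0] := eqVneq t t0.
    exists e => //; exists 1 => // s [_]; rewrite E ltNge => /negP hs _ hs'; by case: hs.
  have d0 : 0 < nm (h t - h t0).
    by rewrite nm_gt0 subr_eq0; apply: contraNneq tt0 => /ih -> //.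
  have [|r r0 H] := ch t ht (nm (h t - h t0) / 2); first lra.
  exists r => //; exists (nm (h t - h t0) / 2); first lra.
  move=> s [_ hs] hs' _; have := H s hs' hs; have := nm_tri (h s) (h t) (h t0).
  by rewrite (nmB (h t) (h s)); lra.
Qed.

Lemma arc_fun h (f : R -> C) : pcon h -> inj01 h -> pcon f ->
  exists2 F : C -> C, con (img h) F & forall t, I01 t -> F (h t) = f t.
Proof.
move=> ch ih cf.
pose F w := f (xget 0 (fun t => I01 t /\ h t = w)).
have FE t : I01 t -> F (h t) = f t.
  move=> ht; rewrite /F; congr f.
  have [hs E] : (fun s => I01 s /\ h s = h t) (xget 0 (fun s => I01 s /\ h s = h t)).
    by apply: (@xgetPex _ 0 (fun s => I01 s /\ h s = h t)); exists t.
  exact: ih.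
exists F => // w [t ht ->] e e0; have [r r0 H] := cf t ht e e0.
have [m m0 Hm] := inj_dist ch ih ht r0; exists m => // v [s hs ->] hv.
by rewrite !FE //; apply: H => //; apply: Hm.
Qed.

Lemma con_union (I : finType) (K : I -> C -> Prop) (f : C -> C) :
  (forall i, closedK (K i)) -> (forall i, con (K i) f) -> con (fun w => exists i, K i w) f.
Proof.
move=> cK cf w _ e e0.
have [|i|r r0 H] := @fin_min I (fun i r => forall v, K i v -> nm (v - w) < r -> nm (f v - f w) < e).
- by move=> i r s H sr _ v Kv h; apply: H => //; apply: lt_le_trans h sr.
- have [Kw|nK] := pselect (K i w); first exact: cf.
  have [r r0 H] := cK i w nK; exists r => // v Kv hv; by case: (H v hv).
- by exists r => // v [i Kv]; apply: (H i).
Qed.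

Lemma closed_union (I : finType) (K : I -> C -> Prop) : (forall i, closedK (K i)) ->
  closedK (fun w => exists i, K i w).
Proof.
move=> cK w nK.
have [|i|r r0 H] := @fin_min I (fun i r => forall v, nm (v - w) < r -> ~ K i v).
- by move=> i r s H sr _ v h; apply: H => //; apply: lt_le_trans h sr.
- by apply: cK => Kw; apply: nK; exists i.
- by exists r => // v hv [i hi]; apply: (H i v).
Qed.

Lemma bdd_union (I : finType) (K : I -> C -> Prop) : (forall i, bddK (K i)) ->
  bddK (fun w => exists i, K i w).
Proof.
move=> bK; have [M HM] := choice bK.
exists (\sum_i `|M i|) => z [i /HM h]; apply: le_trans h _; apply: le_trans (ler_norm _) _.
by rewrite (bigD1 i) //= lerDl sumr_ge0.
Qed.

Lemma closed_or (K K' : C -> Prop) : closedK K -> closedK K' -> closedK (fun w => K w \/ K' w).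
Proof.
move=> cK cK' w nK; have [|r r0 H] := cK w; first by move=> h; apply: nK; left.
have [|r' r'0 H'] := cK' w; first by move=> h; apply: nK; right.
exists (Num.min r r'); first by rewrite lt_min r0.
by move=> v; rewrite lt_min => /andP[h h'] [Kv|Kv]; [apply: H Kv|apply: H' Kv].
Qed.

Lemma bdd_or (K K' : C -> Prop) : bddK K -> bddK K' -> bddK (fun w => K w \/ K' w).
Proof.
move=> [M H] [M' H']; exists (Num.max M M') => w [/H h|/H' h]; rewrite le_max h ?orbT //.
Qed.

(* Square roots of [(w - p) * (w - q)] on [K0] and on the arcs [h i] agree at the ends of the arcs,
   so they paste together. *)
Lemma joined_glue (I : finType) (K0 : C -> Prop) (h : I -> R -> C) (f : C -> C) p q :
  closedK K0 -> bddK K0 -> (forall i, pcon (h i)) -> (forall i, inj01 (h i)) ->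
  ~ K0 p -> ~ K0 q -> (forall i, off (h i) p) -> (forall i, off (h i) q) ->
  con K0 f -> (forall w, K0 w -> f w ^+ 2 = (w - p) * (w - q)) ->
  (forall i, K0 (h i 0)) -> (forall i, K0 (h i 1)) ->
  (forall i t, I01 t -> K0 (h i t) -> t = 0 \/ t = 1) ->
  (forall i j t s, I01 t -> I01 s -> h i t = h j s -> i = j \/ K0 (h i t)) ->
  (forall i, f (h i 0) * rho (h i) p * rho (h i) q = f (h i 1)) ->
  joined (fun w => ~ (K0 w \/ exists i, img (h i) w)) p q.
Proof.
move=> cK bK ch ih nKp nKq op oq cf f2 K0h K1h Kh dis Hrho.
have FP i : exists F : C -> C, [/\ con (img (h i)) F, F (h i 0) = f (h i 0), F (h i 1) = f (h i 1) &
    forall w, img (h i) w -> F w ^+ 2 = (w - p) * (w - q)].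
  have [sp [csp sp2] Ep] := rhoP (ch i) (op i).
  have [sq [csq sq2] Eq] := rhoP (ch i) (oq i).
  have nz z t : off (h i) z -> I01 t -> h i t - z != 0 by move=> o ht; rewrite subr_eq0 o.
  have p0 t : I01 t -> sp t != 0 by move=> ht; apply: sq_neq0; rewrite sp2 // nz.
  have q0 t : I01 t -> sq t != 0 by move=> ht; apply: sq_neq0; rewrite sq2 // nz.
  (* The root at the start of the arc is transported along it; the last hypothesis says that it
     arrives as the root prescribed at the end. *)
  have [|F cF FE] := @arc_fun (h i) (fun t => f (h i 0) * (sp t * sq t) / (sp 0 * sq 0)) (ch i) (ih i).
    move=> t ht; apply: cAtM; last exact: cAt_cst.
    apply: cAtM; first exact: cAt_cst.
    by apply: cAtM; [exact: csp|exact: csq].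
  have [I0 I1] := (@I01_0 R, @I01_1 R).
  exists F; split=> //.
  - by rewrite FE // mulfK // mulf_neq0 ?p0 ?q0.
  - rewrite FE // -Hrho Ep Eq; field; by rewrite p0 // q0.
  - move=> w [t ht ->]; rewrite FE // !exprMn exprVn exprMn f2 // !sp2 // !sq2 //.
    by field; rewrite !nz.
have [F HF] := choice FP.
pose s w := if `[< K0 w >] then f w else
  if [pick i | `[< img (h i) w >]] is Some i then F i w else 0.
have sK w : K0 w -> s w = f w by move=> Kw; rewrite /s asboolT.
have sF i w : img (h i) w -> s w = F i w.
  move=> hw; have [t ht E] := hw; have [_ F0 F1 _] := HF i.
  have [Kw|nK] := pselect (K0 w).
    by rewrite sK // E; move: Kw; rewrite E => /(Kh i t ht) [->|->].
  rewrite /s asboolF //; case: pickP => [j /asboolP [t' ht' E']|/(_ i) /asboolP //].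
  have [->//|] := dis i j t t' ht ht' (etrans (esym E) E').
  by rewrite -E.
pose Ks (o : option I) := if o is Some i then img (h i) else K0.
have Kse w : (K0 w \/ exists i, img (h i) w) <-> exists o, Ks o w.
  split=> [[Kw|[i hi]]|[[i|] hi]]; [by exists None|by exists (Some i)|by right; exists i|by left].
apply: (@joined_sub _ (fun w => ~ exists o, Ks o w)) => [w nw /Kse //|].
have cKs o : closedK (Ks o) by case: o => [i|//]; apply: closed_img.
apply: (@sep_not_sqrt _ _ _ _ s).
- exact: closed_union.
- by apply: bdd_union => -[i|//]; apply: bdd_img.
- by move=> [[i|//] /= hi]; have /off_img := op i.
- by move=> [[i|//] /= hi]; have /off_img := oq i.
- apply: con_union => // -[i|] w /= hw.
    have [cF _ _ _] := HF i; apply: (@cAt_ext _ _ _ _ (F i) _ _ 1) => //; last exact: cF.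
      by rewrite (sF i).
    by move=> v hv _; rewrite (sF i).
  apply: (@cAt_ext _ _ _ _ f _ _ 1) => //; last exact: cf.
    by rewrite sK.
  by move=> v hv _; rewrite sK.
- move=> w [[i|] /= hw]; last by rewrite sK // f2.
  by rewrite (sF i) //; have [_ _ _] := HF i; apply.
Qed.

(* The branch of sqrt ((a - z) / (a - x)) near 1 *)
Definition br a x z := psqrt ((a - z) / (a - x)).

Lemma br_Re a x z : nm (z - x) < nm (a - x) -> 0 < Re ((a - z) / (a - x)).
Proof.
move=> hz; have n0 : 0 < nm (a - x) by apply: le_lt_trans hz; exact: nm_ge0.
have ax : a - x != 0 by rewrite -nm_gt0.
apply: Re_near1; rewrite (_ : _ - 1 = (x - z) / (a - x)); last by field.
by rewrite nmM nmV ltr_pdivrMr // mul1r nmB.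
Qed.

Lemma br_sq a x z : nm (z - x) < nm (a - x) -> br a x z ^+ 2 = (a - z) / (a - x).
Proof. by move=> hz; rewrite psqrtE // br_Re. Qed.

Lemma br_neq0 a x z : nm (z - x) < nm (a - x) -> br a x z != 0.
Proof. by move=> hz; rewrite psqrt_neq0 // br_Re. Qed.

Lemma br_cont a x z : nm (z - x) < nm (a - x) -> cAt (@dC R) (@full R) (br a x) z.
Proof.
move=> hz; have n0 : 0 < nm (a - x) by apply: le_lt_trans hz; exact: nm_ge0.
apply: cAt_psqrt; first exact: br_Re.
apply: cAt_div; [by rewrite -nm_gt0| |exact: cAt_cst].
by apply: cAtB; [exact: cAt_cst|exact: cAt_id].
Qed.

Lemma frac_I01 (a b : R) : 0 <= a -> a <= b -> 0 < b -> I01 (a / b).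
Proof.
by move=> a0 ab b0; rewrite /I01 divr_ge0 ?(ltW b0) //= ler_pdivrMr // mul1r.
Qed.

Lemma rho_cat3 g (a b : R) z : 0 < a -> a < b -> b < 1 -> pcon g -> off g z ->
  rho g z = rho (sub g 0 a) z * rho (sub g a b) z * rho (sub g b 1) z.
Proof.
move=> a0 ab b1 cg og.
have ha : I01 a by apply/andP; split; lra.
rewrite (@rho_cat _ g a) // -mulrA; congr (_ * _).
have a1 : 0 < 1 - a by lra.
have cg1 : pcon (sub g a 1) by apply: pcon_sub => //; exact: I01_1.
have og1 : off (sub g a 1) z by apply: off_sub => //; exact: I01_1.
have hs : I01 ((b - a) / (1 - a)).
  by apply: frac_I01 => //; lra.
have n1 : 1 - a != 0 by rewrite gt_eqF.
rewrite (@rho_cat _ _ _ _ hs cg1 og1); congr (rho _ _ * rho _ _); apply/funext => t; rewrite /sub.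
  by congr g; field.
by congr g; field.
Qed.

(* If the transport along [h] extended continuously across [h], the transport along a short piece
   [A2] of [h] would extend to a square root of [(d - z) / (c - z)] off its two ends [c] and [d];
   a small circle about [c] excludes this. *)
Lemma two_sides h (t0 r : R) (c : C -> C) : pcon h -> inj01 h -> 0 < t0 < 1 -> 0 < r ->
  (forall z, nm (z - h t0) < r -> cAt (@dC R) (@full R) c z) ->
  (forall z, nm (z - h t0) < r -> c z ^+ 2 = (h 1 - z) / (h 0 - z)) ->
  exists z, [/\ nm (z - h t0) < r, off h z & rho h z != c z].
Proof.
move=> ch ih /andP[t0p t01] r0 cc c2; apply: contrapT => nex.
have Hc z : nm (z - h t0) < r -> off h z -> rho h z = c z.
  by move=> hz oz; apply/eqP/negP => /negP hn; apply: nex; exists z.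
have ht0 : I01 t0 by apply/andP; split; lra.
have [r1 r10 Hr1] := ch t0 ht0 r r0.
(* Only the start a of the middle piece has to lie in the disc, since the small circle is drawn
   about a; its other end b is outside that circle. *)
pose t1 := Num.max (t0 / 2) (t0 - r1 / 2).
have t1l : t0 / 2 <= t1 by rewrite le_max lexx.
have t1b : t0 - r1 / 2 <= t1 by rewrite le_max lexx orbT.
have t1u : t1 < t0 by rewrite gt_max; apply/andP; split; lra.
pose t2 := (t0 + 1) / 2.
have h1 : I01 t1 by apply/andP; split; lra.
have h2 : I01 t2 by apply/andP; rewrite /t2; split; lra.
have t12 : t1 < t2 by rewrite /t2; lra.
pose a := h t1; pose b := h t2.
have ha : nm (a - h t0) < r by apply: Hr1 => //; rewrite /dR ltr_norml; apply/andP; split; lra.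
have ab : 0 < nm (b - a).
  by rewrite nm_gt0 subr_eq0; apply/eqP => /(ih _ _ h2 h1); lra.
pose e := Num.min (r - nm (a - h t0)) (nm (b - a)) / 2.
have m0 : 0 < Num.min (r - nm (a - h t0)) (nm (b - a)) by rewrite lt_min ab andbT; lra.
have e0 : 0 < e by rewrite /e; lra.
have e1 : e < r - nm (a - h t0).
  by apply: lt_le_trans (_ : Num.min (r - nm (a - h t0)) (nm (b - a)) <= _); [rewrite /e; lra|rewrite ge_min lexx].
have e2 : e < nm (b - a).
  by apply: lt_le_trans (_ : Num.min (r - nm (a - h t0)) (nm (b - a)) <= _); [rewrite /e; lra|rewrite ge_min lexx orbT].
have [I0 I1] := (@I01_0 R, @I01_1 R).
pose A1 := sub h 0 t1; pose A2 := sub h t1 t2; pose A3 := sub h t2 1.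
have [c1 cA2 c3] : [/\ pcon A1, pcon A2 & pcon A3] by split; apply: pcon_sub.
have t1p : 0 < t1 by lra.
have t21 : t2 < 1 by rewrite /t2; lra.
have cat z : off h z -> rho h z = rho A1 z * rho A2 z * rho A3 z by exact: rho_cat3.
have offh z : off A1 z -> off A2 z -> off A3 z -> off h z.
  move=> o1 o2 o3 t /andP[tp tl]; have [hl|hg] := leP t t1.
    have := o1 (t / t1) (frac_I01 tp hl t1p).
    by rewrite /A1 /sub subr0 add0r divfK ?(gt_eqF t1p).
  have [hl'|hg'] := leP t t2.
    have d0 : 0 < t2 - t1 by lra.
    have := o2 ((t - t1) / (t2 - t1)); rewrite /A2 /sub divfK ?(gt_eqF d0) // (addrC t1) subrK => H.
    by apply: H; apply: frac_I01; lra.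
  have d0 : 0 < 1 - t2 by lra.
  have := o3 ((t - t2) / (1 - t2)); rewrite /A3 /sub divfK ?(gt_eqF d0) // (addrC t2) subrK => H.
  by apply: H; apply: frac_I01; lra.
have off13 z : z != a -> z != b -> ~ off A2 z -> off A1 z /\ off A3 z.
  move=> za zb /off_img/contrapT [s hs E].
  have hs' : I01 (t1 + s * (t2 - t1)) by apply: I01_sub.
  have [s0 s1] := andP hs.
  have b1 : 0 <= s * (t2 - t1) by rewrite mulr_ge0 // subr_ge0 ltW.
  have b2 : s * (t2 - t1) <= t2 - t1 by rewrite ler_piMl // subr_ge0 ltW.
  split=> u hu; apply/eqP => E'; have [u0 u1] := andP hu.
    have hu' : I01 (0 + u * (t1 - 0)) by apply: I01_sub.
    have /(ih _ _ hu' hs') Eu : h (0 + u * (t1 - 0)) = h (t1 + s * (t2 - t1)) by rewrite -[LHS]/(A1 u) E' E.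
    have b3 : u * t1 <= t1 by rewrite ler_piMl // ltW.
    rewrite subr0 add0r in Eu; have b4 : u * t1 = t1 by lra.
    by case/eqP: za; rewrite -E' /A1 /sub subr0 add0r b4.
  have hu' : I01 (t2 + u * (1 - t2)) by apply: I01_sub.
  have /(ih _ _ hu' hs') Eu : h (t2 + u * (1 - t2)) = h (t1 + s * (t2 - t1)) by rewrite -[LHS]/(A3 u) E' E.
  have b3 : 0 <= u * (1 - t2) by rewrite mulr_ge0 // subr_ge0 ltW.
  have b4 : u * (1 - t2) = 0 by lra.
  by case/eqP: zb; rewrite -E' /A3 /sub b4 addr0.
(* On the piece A2 itself, the value is the one that A2 would contribute if the whole transport were
   c. Off A1 and A3 in the disc both formulas agree, by [Hc] and [cat], so Q is continuous across
   A2. *)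
pose Q z := if `[< off A2 z >] then rho A2 z else c z / (rho A1 z * rho A3 z).
have QE z : nm (z - h t0) < r -> off A1 z -> off A3 z -> Q z = c z / (rho A1 z * rho A3 z).
  move=> hz o1 o3; rewrite /Q; case: asboolP => // o2.
  rewrite -Hc //; last exact: offh.
  rewrite cat; last exact: offh.
  by field; rewrite !rho_neq0.
have zin w : nm w = 1 -> [/\ nm (a + e%:c * w - h t0) < r, a + e%:c * w != a & a + e%:c * w != b].
  move=> nw; have ne : nm (e%:c * w) = e by rewrite nmM nw mulr1 nm_real gtr0_norm.
  split.
  - rewrite (_ : _ - h t0 = e%:c * w + (a - h t0)); last by ring.
    by have := nmD (e%:c * w) (a - h t0); rewrite ne; lra.
  - by rewrite -subr_eq0 addrC addKr -nm_gt0 ne.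
  - by apply/eqP => E; move: e2; rewrite -E addrC addKr ne ltxx.
have cQ w : nm w = 1 -> cAt (@dC R) (@full R) Q (a + e%:c * w).
  move=> nw; have [z1 z2 z3] := zin w nw; set z := a + _ in z1 z2 z3 *.
  have [ho2|no2] := pselect (off A2 z).
    have [d d0 Hd] := off_near cA2 ho2.
    apply: (@cAt_ext _ _ _ _ (rho A2) _ _ d) => //; last exact: rho_cont.
      by rewrite /Q asboolT.
    by move=> v _ hv; rewrite /Q asboolT //; apply: Hd.
  have [ho1 ho3] := off13 z z2 z3 no2.
  have [d d0 Hd] := off_near c1 ho1; have [d' d'0 Hd'] := off_near c3 ho3.
  apply: (@cAt_ext _ _ _ _ (fun z => c z / (rho A1 z * rho A3 z)) _ _ (Num.min (r - nm (z - h t0)) (Num.min d d'))).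
  - by rewrite !lt_min d0 d'0 !andbT; lra.
  - by rewrite QE.
  - move=> v _; rewrite !lt_min => /and3P[k1 k2 k3]; rewrite QE //; [|exact: Hd|exact: Hd'].
    by have := nm_tri z v (h t0); move: k1; rewrite /dC; lra.
  - apply: cAt_div; [by rewrite mulf_neq0 // rho_neq0|exact: cc|].
    by apply: cAtM; apply: rho_cont.
have Q2 w : nm w = 1 -> Q (a + e%:c * w) ^+ 2 = (b - (a + e%:c * w)) / (a - (a + e%:c * w)).
  move=> nw; have [z1 z2 z3] := zin w nw; set z := a + _ in z1 z2 z3 *.
  have A20 : A2 0 = a by rewrite /A2 sub0.
  have A21 : A2 1 = b by rewrite /A2 sub1.
  have [ho2|no2] := pselect (off A2 z); first by rewrite /Q asboolT // rho_sq // A20 A21.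
  have [ho1 ho3] := off13 z z2 z3 no2.
  rewrite QE // expr_div_n exprMn c2 // !rho_sq // /A1 /A3 !sub0 !sub1 -/a -/b.
  have n1 : h 1 - z != 0 by rewrite subr_eq0; have := ho3 1 I1; rewrite /A3 sub1.
  have n0 : h 0 - z != 0 by rewrite subr_eq0; have := ho1 0 I0; rewrite /A1 sub0.
  have na : a - z != 0 by rewrite subr_eq0 eq_sym.
  have nb : b - z != 0 by rewrite subr_eq0 eq_sym.
  by field; rewrite n0 n1 na nb.
have ba : b - a != 0 by rewrite -nm_gt0.
have brw w : nm w = 1 -> nm (a + e%:c * w - a) < nm (b - a).
  by move=> nw; rewrite addrC addKr nmM nw mulr1 nm_real gtr0_norm.
pose k := sqrtc (- (b - a)^-1).
(* On the circle the square of Q is (b - z) / (a - z), with a - z = - e w. The factor [br] removes b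
   - z, and the square of the whole is w / e. *)
apply: (@no_sqrt_circle _ (fun w => w * Q (a + e%:c * w) * k / br b a (a + e%:c * w))).
  move=> w nw.
  have cz K : cAt (@dC R) K (fun w => a + e%:c * w) w.
    by apply: cAtD; [exact: cAt_cst|apply: cAtM; [exact: cAt_cst|exact: cAt_id]].
  apply: cAt_div; first by apply: br_neq0; apply: brw.
    apply: cAtM; last exact: cAt_cst.
    apply: cAtM; first exact: cAt_id.
    by apply: (@cAt_comp _ _ _ _ (@full R) (fun w => a + e%:c * w)) => //; apply: cQ.
  apply: (@cAt_comp _ _ _ _ (@full R) (fun w => a + e%:c * w)) => //; apply: br_cont; exact: brw.
move=> w nw; exists e^-1; first by rewrite invr_gt0.
rewrite expr_div_n 2!exprMn Q2 // br_sq; last exact: brw.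
rewrite sqr_sqrtc.
have w0 : w != 0 by rewrite -nm_gt0 nw.
have ec : e%:c != 0 by rewrite rc_eq0 gt_eqF.
have nb : b - (a + e%:c * w) != 0 by have [_ _ z3] := zin w nw; rewrite subr_eq0 eq_sym.
have -> : (e^-1)%:c = (e%:c)^-1.
  by apply: (mulIf ec); rewrite mulVf // -rcM mulVf // gt_eqF.
have E : a - (a + e%:c * w) = - (e%:c * w) by ring.
by rewrite E; field; rewrite ba w0 ec nb.
Qed.

(** Only the point off the arc given by [two_sides] matters here; the branch c is an arbitrary
    continuous root of the required square near [h t0]. *)
Lemma arc_nowhere_dense h (t0 r : R) : pcon h -> inj01 h -> 0 < t0 < 1 -> 0 < r ->
  exists2 z, nm (z - h t0) < r & off h z.
Proof.
move=> ch ih /andP[a0 a1] r0.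
have ht : I01 t0 by apply/andP; split; lra.
have n0 : 0 < nm (h 0 - h t0) by rewrite nm_gt0 subr_eq0; apply/eqP => /(ih _ _ (@I01_0 R) ht); lra.
have n1 : 0 < nm (h 1 - h t0) by rewrite nm_gt0 subr_eq0; apply/eqP => /(ih _ _ (@I01_1 R) ht); lra.
pose x := h t0.
pose k := sqrtc ((h 1 - x) / (h 0 - x)).
have [||z|z|z] := @two_sides h t0 (Num.min r (Num.min (nm (h 0 - x)) (nm (h 1 - x))))
  (fun z => k * (br (h 1) x z / br (h 0) x z)) ch ih.
- by apply/andP.
- by rewrite !lt_min r0 n0 n1.
- rewrite !lt_min => /and3P[h1 h2 h3]; apply: cAtM; first exact: cAt_cst.
  by apply: cAt_div; [exact: br_neq0|exact: br_cont|exact: br_cont].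
- rewrite !lt_min => /and3P[h1 h2 h3].
  have e0 : h 0 - x != 0 by rewrite -nm_gt0.
  have e1 : h 1 - x != 0 by rewrite -nm_gt0.
  have e2 : h 0 - z != 0.
    by rewrite subr_eq0; apply: contraTneq h2 => ->; rewrite ltxx.
  by rewrite exprMn sqr_sqrtc expr_div_n !br_sq //; field; rewrite e0 e1 e2.
- by rewrite !lt_min => -[/and3P[h1 _ _] oz _]; exists z.
Qed.
End Plane.

(** * Faces of a plane graph *)

Section Plane.
Variable R : realType.
Notation C := R[i].
Notation Re := (@complex.Re R).
Notation Im := (@complex.Im R).
Notation "x %:c" := (real_complex R x) (at level 1, format "x %:c").
Implicit Types (x y z w : C) (t s : R).

(** The plane picture of a sphere graph. Edges are parametrised, once for each orientation, and the
    two parametrisations are only required to have the same image. *)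
Record pgraph (V : finType) := PGraph {
  pg :> sgraph V;
  pp : V -> C;
  gam : V -> V -> R -> C;
  pp_inj : injective pp;
  gam_con : forall u v, pg u v -> pcon (gam u v);
  gam_inj : forall u v, pg u v -> inj01 (gam u v);
  gam0 : forall u v, pg u v -> gam u v 0 = pp u;
  gam1 : forall u v, pg u v -> gam u v 1 = pp v;
  gam_sym : forall u v t, pg u v -> I01 t -> img (gam v u) (gam u v t);
  gam_pt : forall (u v : V) t (w : V), pg u v -> I01 t -> gam u v t = pp w -> w = u \/ w = v;
  gam_cross : forall (u v x y : V) t s, pg u v -> pg x y -> [set u; v] != [set x; y] ->
    I01 t -> I01 s -> gam u v t = gam x y s -> exists w : V, gam u v t = pp w
}.

Section Faces.
Variables (V : finType) (G : pgraph V).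
Implicit Types (a b c : V).
Notation p := (pp G).
Notation γ := (gam G).

Lemma adjC u v : G u v = G v u. Proof. exact: adj_sym. Qed.
Lemma adj_neq u v : G u v -> u != v.
Proof. by move=> uv; apply/eqP => E; rewrite E adj_irr in uv. Qed.

(** All the vertices are included, whichever edges are selected by E. *)
Definition Gs (E : V -> V -> bool) z := (exists v, z = p v) \/
  exists uv : V * V, [/\ G uv.1 uv.2, E uv.1 uv.2 & img (γ uv.1 uv.2) z].
Definition Gset := Gs (fun _ _ => true).
Definition free z := ~ Gset z.
(* [x] is in the closure of the face that contains [z] *)
Definition touch z x := forall e, 0 < e -> exists2 z', joined free z z' & nm (z' - x) < e.

Lemma closed_pt x : closedK (fun w => w = x).
Proof.
move=> z zx; exists (nm (x - z)); first by rewrite nm_gt0 subr_eq0; apply/eqP => E; apply: zx.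
by move=> w hw E; rewrite E ltxx in hw.
Qed.

Lemma closed_Gs E : closedK (Gs E).
Proof.
apply: closed_or; first by apply: closed_union => v; apply: closed_pt.
have [hE|nE] := pselect True; last by case: nE.
apply: (@closed_union _ _ (fun uv w => [/\ G uv.1 uv.2, E uv.1 uv.2 & img (γ uv.1 uv.2) w])) => -[u v] /= w nw.
have [uv|nuv] := boolP (G u v && E u v); last by exists 1 => // w' _ [h1 h2]; rewrite h1 h2 in nuv.
case/andP: uv => uv euv.
have [|r r0 H] := @closed_img _ _ (gam_con uv) w; first by move=> h; apply: nw.
by exists r => // w' /H h [_ _].
Qed.

Lemma bdd_Gs E : bddK (Gs E).
Proof.
apply: bdd_or; first by apply: bdd_union => v; exists (nm (p v)) => z ->.
apply: (@bdd_union _ _ (fun uv w => [/\ G uv.1 uv.2, E uv.1 uv.2 & img (γ uv.1 uv.2) w])) => -[u v] /=.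
have [uv|nuv] := boolP (G u v && E u v); last by exists 0 => w [h1 h2]; rewrite h1 h2 in nuv.
case/andP: uv => uv _; have [M HM] := bdd_img (gam_con uv).
by exists M => w [_ _ /HM].
Qed.

Lemma free_ball z : free z -> exists2 r, 0 < r & forall w, nm (w - z) < r -> free w.
Proof. exact: closed_Gs. Qed.

Lemma G_pt v : Gset (p v). Proof. by left; exists v. Qed.

Lemma G_edge u v w : G u v -> img (γ u v) w -> Gset w.
Proof. by move=> uv hw; right; exists (u, v). Qed.

Lemma img_sym u v w : G u v -> img (γ u v) w -> img (γ v u) w.
Proof. by move=> uv [t ht ->]; apply: gam_sym. Qed.

Lemma edge_inner a b t : G a b -> 0 < t < 1 ->
  ~ Gs (fun u v => [set u; v] != [set a; b]) (γ a b t).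
Proof.
move=> ab /andP[t0 t1].
have ht : I01 t by apply/andP; split; lra.
have npt (w : V) : γ a b t = p w -> False.
  move=> E; have [Ew|Ew] := gam_pt ab ht E; move: E; rewrite Ew.
    by rewrite -(gam0 ab) => /(gam_inj ab ht (@I01_0 R)); lra.
  by rewrite -(gam1 ab) => /(gam_inj ab ht (@I01_1 R)); lra.
move=> [[w /npt //]|[[u v] /= [uv ne [s hs E]]]].
by have [|w /npt] := @gam_cross _ G a b u v t s ab uv _ ht hs E; rewrite // eq_sym.
Qed.

Lemma Gset_split a b w : G a b -> Gset w ->
  Gs (fun u v => [set u; v] != [set a; b]) w \/ img (γ a b) w.
Proof.
move=> ab [[v ->]|[[u v] /= [uv _ hw]]]; first by left; left; exists v.
have [E|ne] := eqVneq [set u; v] [set a; b]; last by left; right; exists (u, v).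
right; have hu : u \in [set a; b] by rewrite -E !inE eqxx.
have hv : v \in [set a; b] by rewrite -E !inE eqxx orbT.
have nuv := adj_neq uv; rewrite !inE in hu hv.
case/orP: hu => /eqP Eu; case/orP: hv => /eqP Ev; rewrite Eu Ev ?eqxx // in nuv uv hw *.
by apply: img_sym.
Qed.

Lemma touch_trans z z' x : joined free z z' -> touch z' x -> touch z x.
Proof.
move=> zz' t e e0; have [w hw hx] := t e e0; exists w => //; exact: joined_trans hw.
Qed.

(** If no point of the drawing on the segment touched the face of z, then lying in this face would
    be locally constant along the segment, and y would be in the face. *)
Lemma leave_seg z y : free z -> ~ joined free z y ->
  exists t, [/\ I01 t, Gset (lerp z y t) & touch z (lerp z y t)].
Proof.
move=> fz nj; apply: contrapT => nex; apply: nj.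
have := @locconst _ (fun t => joined free z (lerp z y t)) _ _ 1 (@I01_1 R).
rewrite lerp0 lerp1; apply; last exact: joined_refl.
move=> t ht; have ct := @cAt_lerp _ (@I01 R) z y t.
have [Gt|fr] := pselect (Gset (lerp z y t)); last first.
  have [r r0 H] := free_ball fr; have [s s0 Hs] := ct r r0; exists s => // t' ht' htt'.
  have j : joined free (lerp z y t') (lerp z y t).
    by apply: (joined_ball H); [exact: Hs|rewrite subrr nm0].
  by split=> h; apply: joined_trans h _ => //; exact: joined_sym.
have /existsNP[e] : ~ touch z (lerp z y t) by move=> h; apply: nex; exists t.
move=> /not_implyP[e0 ne].
have [s s0 Hs] := ct e e0; exists s => // t' ht' htt'; split=> h; exfalso; last first.
  by have := joinedr h.
by apply: ne; exists (lerp z y t') => //; apply: Hs.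
Qed.

Lemma leave (H : C -> Prop) z y : free z -> ~ joined free z y -> joined (fun w => ~ H w) z y ->
  exists x, [/\ Gset x, ~ H x & touch z x].
Proof.
move=> fz nj zy; apply: contrapT => nex.
have : joined free z z -> joined free z y.
  apply: (joined_ind _ zy) => u v uv zu; apply: contrapT => nzv; apply: nex.
  have nuv : ~ joined free u v by move=> h; apply: nzv; apply: joined_trans h.
  have [t [ht Gt tt]] := leave_seg (joinedr zu) nuv.
  exists (lerp u v t); split=> //; [exact: uv|exact: touch_trans tt].
by move=> h; apply/nj/h/joined_refl.
Qed.

(* The branch of sqrt ((w - z) * (w - z')) that is close to [w - x] for [z] and [z'] close to [x] *)
Definition fsq x z z' w := (w - x) * (br w x z * br w x z').

Lemma fsq_sq x z z' w : nm (z - x) < nm (w - x) -> nm (z' - x) < nm (w - x) ->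
  fsq x z z' w ^+ 2 = (w - z) * (w - z').
Proof.
move=> h h'; rewrite /fsq 2!exprMn !br_sq //.
have n0 : w - x != 0 by rewrite -nm_gt0; apply: le_lt_trans h; exact: nm_ge0.
by field.
Qed.

Lemma fsq_con K x z z' w : nm (z - x) < nm (w - x) -> nm (z' - x) < nm (w - x) ->
  cAt (@dC R) K (fsq x z z') w.
Proof.
move=> h h'.
have n0 : w - x != 0 by rewrite -nm_gt0; apply: le_lt_trans h; exact: nm_ge0.
have cid' y : cAt (@dC R) K (fun w => w - y) w by apply: cAtB; [exact: cAt_id|exact: cAt_cst].
by apply: cAtM => //; apply: cAtM; apply: cAt_psqrt; try exact: br_Re; apply: cAt_div.
Qed.

(** Away from a middle piece h of the edge, the drawing K0 keeps a distance from [x = γ a b t0], so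
    [fsq x z1 q] is a root on K0 for z1 and q near x. By [joined_glue], z1 and q are in the same
    face as soon as transport along h matches this root at both ends of h. Of the two possible
    values of [rho h q], [two_sides] realises the right one arbitrarily close to any given nearby
    point of the edge. *)
Lemma edge_loc a b z (t0 : R) : G a b -> 0 < t0 < 1 -> touch z (γ a b t0) ->
  exists2 r, 0 < r & forall t, I01 t -> `|t - t0| < r -> touch z (γ a b t).
Proof.
move=> ab t01 tz; have [t0p t0l] := andP t01.
pose g := γ a b; have cg : pcon g := gam_con ab; have ig : inj01 g := gam_inj ab.
pose t1 := t0 / 2; pose t2 := (t0 + 1) / 2.
have [I0 I1] := (@I01_0 R, @I01_1 R).
have h0 : I01 t0 by apply/andP; split; lra.
have h1 : I01 t1 by apply/andP; rewrite /t1; split; lra.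
have h2 : I01 t2 by apply/andP; rewrite /t2; split; lra.
have t12 : 0 < t2 - t1 by rewrite /t1 /t2; lra.
pose h := sub g t1 t2.
have ch : pcon h by apply: pcon_sub.
have subE (s : R) : I01 s -> I01 (t1 + s * (t2 - t1)) by move=> hs; apply: I01_sub.
have ih : inj01 h.
  by move=> s s' hs hs' /(ig _ _ (subE _ hs) (subE _ hs')) /addrI /mulIf; apply; rewrite gt_eqF.
pose E0 u v := [set u; v] != [set a; b].
pose K0 w := Gs E0 w \/ (img (sub g 0 t1) w \/ img (sub g t2 1) w).
have inK s : I01 s -> s <= t1 \/ t2 <= s -> K0 (g s).
  move=> /andP[s0 s1] [hs|hs]; right; [left|right].
    have t1p : 0 < t1 by rewrite /t1; lra.
    by exists (s / t1); [exact: frac_I01|rewrite /sub subr0 add0r divfK ?gt_eqF].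
  have d0 : 0 < 1 - t2 by rewrite /t2; lra.
  exists ((s - t2) / (1 - t2)); first by apply: frac_I01; lra.
  by rewrite /sub divfK ?gt_eqF // (addrC t2) subrK.
have Kin s : I01 s -> t1 < s -> s < t2 -> ~ K0 (g s).
  move=> hs s1 s2 [Gw|[[u hu E]|[u hu E]]].
  - by apply: (edge_inner ab _ Gw); case/andP: h1 => ? ?; case/andP: h2 => ? ?; apply/andP; split; lra.
  - have := ig _ _ hs (I01_sub I0 h1 hu) E; rewrite subr0 add0r.
    have [u0 u1] := andP hu; have : u * t1 <= t1 by rewrite ler_piMl //; rewrite /t1; lra.
    lra.
  - have := ig _ _ hs (I01_sub h2 I1 hu) E.
    have [u0 u1] := andP hu; have : 0 <= u * (1 - t2) by rewrite mulr_ge0 // subr_ge0; rewrite /t2; lra.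
    lra.
have cK : closedK K0.
  apply: closed_or; first exact: closed_Gs.
  by apply: closed_or; apply: closed_img; apply: pcon_sub.
have bK : bddK K0.
  apply: bdd_or; first exact: bdd_Gs.
  by apply: bdd_or; apply: bdd_img; apply: pcon_sub.
pose x := g t0.
have [d d0 Hd] : exists2 d, 0 < d & forall w, nm (w - x) < d -> ~ K0 w.
  by apply: cK; apply: Kin => //; rewrite /t1 /t2; lra.
have Kd w : K0 w -> d <= nm (w - x) by move=> Kw; rewrite leNgt; apply/negP => /Hd.
have [r r0 Hr] := cg t0 h0 d d0.
pose r2 := Num.min r (Num.min (t0 - t1) (t2 - t0)).
have r20 : 0 < r2 by rewrite !lt_min r0 /t1 /t2; apply/andP; split=> //; apply/andP; split; lra.
exists r2 => // t ht; rewrite !lt_min !ltr_norml => /and3P[htr /andP[k1 k2] /andP[k3 k4]].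
have t1t : t1 < t by lra.
have tt2 : t < t2 by lra.
have nx' : nm (g t - x) < d by apply: Hr => //; rewrite /dR ltr_norml.
have [z1 zz1 hz1] := tz d d0.
have fz1 := joinedr zz1.
pose s' := (t - t1) / (t2 - t1).
have hs' : h s' = g t by rewrite /h /sub divfK ?gt_eqF // (addrC t1) subrK.
have s'I : 0 < s' < 1.
  by apply/andP; split; [apply: divr_gt0|rewrite ltr_pdivrMr // mul1r]; lra.
have offh w : free w -> off h w.
  move=> fw; apply/off_img => -[s hs E]; apply: fw; rewrite E; apply: (G_edge ab).
  by exists (t1 + s * (t2 - t1)) => //; apply: subE.
have x10 : K0 (h 0) by rewrite /h sub0; apply: inK => //; left.
have x21 : K0 (h 1) by rewrite /h sub1; apply: inK => //; right.
have e1 : nm (z1 - x) < nm (h 0 - x) by apply: lt_le_trans (Kd _ x10).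
have e2 : nm (z1 - x) < nm (h 1 - x) by apply: lt_le_trans (Kd _ x21).
move=> e e0; pose r' := Num.min e (d - nm (g t - x)).
have r'0 : 0 < r' by rewrite lt_min e0 subr_gt0.
(* The opposite of the matching value of [rho h q]: a point q with [rho h q != cc q] is on the side
   of z1. *)
pose cc q := - (fsq x z1 q (h 1) / (fsq x z1 q (h 0) * rho h z1)).
have inball q : nm (q - h s') < r' -> nm (q - x) < d.
  by rewrite lt_min hs' => /andP[_ hq]; have := nm_tri (g t) q x; lra.
have rz1 : rho h z1 != 0 by apply: rho_neq0 => //; apply: offh.
have hx0 : h 0 - x != 0 by rewrite -nm_gt0; apply: le_lt_trans e1; exact: nm_ge0.
have hx1 : h 1 - x != 0 by rewrite -nm_gt0; apply: le_lt_trans e2; exact: nm_ge0.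
have fn0 q : nm (q - x) < d -> fsq x z1 q (h 0) != 0.
  move=> hq; have hq' : nm (q - x) < nm (h 0 - x) by apply: lt_le_trans (Kd _ x10).
  by rewrite mulf_neq0 // mulf_neq0 // br_neq0.
have [q hq|q hq|q [hq oq rq]] := @two_sides _ h s' r' cc ch ih s'I r'0.
- have {}hq := inball _ hq.
  have hq0 : nm (q - x) < nm (h 0 - x) by apply: lt_le_trans (Kd _ x10).
  have hq1 : nm (q - x) < nm (h 1 - x) by apply: lt_le_trans (Kd _ x21).
  apply: cAtN; apply: cAt_div; first by rewrite mulf_neq0 // fn0.
    by do 2!(apply: cAtM; first exact: cAt_cst); apply: br_cont.
  apply: cAtM; last exact: cAt_cst.
  by do 2!(apply: cAtM; first exact: cAt_cst); apply: br_cont.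
- have {}hq := inball _ hq.
  have hq0 : nm (q - x) < nm (h 0 - x) by apply: lt_le_trans (Kd _ x10).
  have hq1 : nm (q - x) < nm (h 1 - x) by apply: lt_le_trans (Kd _ x21).
  rewrite /cc sqrrN expr_div_n [(_ * rho h z1) ^+ 2]exprMn !fsq_sq // rho_sq //; last exact: offh.
  have n1 w y : nm (w - x) < nm (y - x) -> y - w != 0.
    by move=> hw; rewrite subr_eq0; apply: contraTneq hw => ->; rewrite ltxx.
  by field; rewrite !n1.
have {}hqx := inball _ hq.
have fq : free q.
  move=> Gq; have [Gw|[s hs E]] := Gset_split ab Gq; first by apply: (Hd q) => //; left.
  have [k5|k5] := leP s t1; first by apply: (Hd q) => //; rewrite E; apply: inK => //; left.
  have [k6|k6] := leP t2 s; first by apply: (Hd q) => //; rewrite E; apply: inK => //; right.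
  have : off h (g s) by rewrite -[g s]/(γ a b s) -E.
  move=> /(_ ((s - t1) / (t2 - t1))); rewrite /h /sub divfK ?(gt_eqF t12) // (addrC t1) subrK eqxx.
  by have K : I01 ((s - t1) / (t2 - t1)) by [apply: frac_I01; lra]; move=> /(_ K).
exists q; last by move: hq; rewrite hs' lt_min => /andP[].
apply: joined_trans zz1 _.
have hq0 : nm (q - x) < nm (h 0 - x) by apply: lt_le_trans (Kd _ x10).
have hq1 : nm (q - x) < nm (h 1 - x) by apply: lt_le_trans (Kd _ x21).
apply: (@joined_sub _ (fun w => ~ (K0 w \/ exists i : unit, img h w))).
  move=> w nw Gw; apply: nw; have [Gw'|[s hs E]] := Gset_split ab Gw; first by left; left.
  have [k5|k5] := leP s t1; first by left; rewrite E; apply: inK => //; left.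
  have [k6|k6] := leP t2 s; first by left; rewrite E; apply: inK => //; right.
  right; exists tt; exists ((s - t1) / (t2 - t1)); first by apply: frac_I01; lra.
  by rewrite /h /sub divfK ?(gt_eqF t12) // (addrC t1) subrK.
apply: (@joined_glue _ _ K0 (fun=> h) (fsq x z1 q)) => //.
- exact: Hd.
- exact: Hd.
- by move=> _; apply: offh.
- by move=> w Kw; apply: fsq_con; apply: lt_le_trans (Kd _ Kw).
- by move=> w Kw; apply: fsq_sq; apply: lt_le_trans (Kd _ Kw).
- move=> _ s hs Kh; have [s0 s1] := andP hs.
  have [->|n0] := eqVneq s 0; first by left.
  have [->|n1] := eqVneq s 1; first by right.
  exfalso; apply: (Kin (t1 + s * (t2 - t1))) Kh; first exact: subE.
    by rewrite ltrDl mulr_gt0 // lt_neqAle eq_sym n0.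
  by rewrite -ltrBrDl gtr_pMl // lt_neqAle n1.
- by move=> [] [] *; left.
move=> _; have n2 : fsq x z1 q (h 0) != 0 by apply: fn0.
have /sqr_sign[E|->] : rho h q ^+ 2 = cc q ^+ 2; last 1 first.
- by rewrite /cc opprK; field; rewrite n2 rz1.
- rewrite /cc sqrrN expr_div_n [(_ * rho h z1) ^+ 2]exprMn !fsq_sq // !rho_sq //; last exact: offh.
  have n1 w y : nm (w - x) < nm (y - x) -> y - w != 0.
    by move=> hw; rewrite subr_eq0; apply: contraTneq hw => ->; rewrite ltxx.
  by field; rewrite !n1.
by rewrite E eqxx in rq.
Qed.

(** In the interior of the edge the set of touched points is open by [edge_loc] and closed by
    definition; the ends are limits of interior points. *)
Lemma touch_edge a b z (t0 t : R) : G a b -> 0 < t0 < 1 -> touch z (γ a b t0) -> I01 t ->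
  touch z (γ a b t).
Proof.
move=> ab t01 tz; have cg := gam_con ab.
have [t0p t0l] := andP t01.
have h0 : I01 t0 by apply/andP; split; lra.
have inner s : 0 < s < 1 -> touch z (γ a b s).
  move=> /andP[s0 s1].
  have hs : I01 s by apply/andP; split; lra.
  have := @locconst _ (fun u : R => touch z (sub (γ a b) t0 s u)) _ _ 1 (@I01_1 R).
  rewrite sub0 sub1; apply=> // u hu.
  have hv : 0 < t0 + u * (s - t0) < 1.
    rewrite (_ : t0 + u * (s - t0) = (1 - u) * t0 + u * s); last by ring.
    case/andP: hu => u0 u1; have [->|un] := eqVneq u 0; first by rewrite subr0 mul1r mul0r addr0 t0p.
    have up : 0 < u by rewrite lt_neqAle eq_sym un.
    have e1 : 0 < u * s by rewrite mulr_gt0.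
    have e2 : u * s < u * 1 by rewrite ltr_pM2l.
    have e3 : 0 <= (1 - u) * t0 by rewrite mulr_ge0 ?subr_ge0 // ltW.
    have e4 : (1 - u) * t0 <= (1 - u) * 1 by rewrite ler_wpM2l ?subr_ge0 // ltW.
    by apply/andP; split; lra.
  set v := t0 + u * (s - t0) in hv.
  have hvI : I01 v by apply/andP; case/andP: hv => ? ?; split; lra.
  have step r : 0 < r -> exists2 r', 0 < r' & forall u' : R, I01 u' -> `|u' - u| < r' ->
      I01 (t0 + u' * (s - t0)) /\ `|t0 + u' * (s - t0) - v| < r.
    move=> r0; exists r => // u' hu' huu; split; first exact: I01_sub.
    rewrite (_ : _ - v = (u' - u) * (s - t0)); last by rewrite /v; ring.
    rewrite normrM; apply: le_lt_trans huu; rewrite ler_piMr // ler_norml.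
    by apply/andP; split; lra.
  have [tv|ntv] := pselect (touch z (γ a b v)).
    have [r r0 H] := edge_loc ab hv tv; have [r' r'0 H'] := step r r0.
    by exists r' => // u' hu' /(H' _ hu')[h1 h2]; split=> _ //; apply: H.
  have /existsNP[e /not_implyP[e0 ne]] := ntv.
  have e20 : 0 < e / 2 by lra.
  have [r r0 H] := cg v hvI (e / 2) e20; have [r' r'0 H'] := step r r0.
  exists r' => // u' hu' /(H' _ hu')[h1 h2]; split=> // tu; exfalso; apply: ne.
  have [w hw hwd] := tu _ e20; exists w => //.
  have := nm_tri (sub (γ a b) t0 s u') w (γ a b v); have := H _ h1 h2.
  by rewrite /sub in hwd *; lra.
have clos s s' : I01 s -> (forall r, 0 < r -> exists2 u, 0 < u < 1 & `|u - s| < r) -> touch z (γ a b s).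
  move=> hs H e e0; have e20 : 0 < e / 2 by lra.
  have [r r0 Hr] := cg s hs _ e20; have [u hu hus] := H r r0.
  have [w hw hwd] := inner u hu _ e20; exists w => //.
  have uI : I01 u by apply/andP; case/andP: hu => ? ?; split; lra.
  by have := nm_tri (γ a b u) w (γ a b s); have := Hr u uI hus; lra.
move=> ht; case/andP: (ht) => k0 k1.
apply: (clos t 0) => // r r0; have m0 : 0 < Num.min r 1 by rewrite lt_min r0 ltr01.
have m1 : Num.min r 1 <= 1 by rewrite ge_min lexx orbT.
have mr : Num.min r 1 <= r by rewrite ge_min lexx.
set m := Num.min r 1 in m0 m1 mr.
have [k|k] := ltP t (1 / 2).
  exists (t + m / 4); first by apply/andP; split; lra.
  by rewrite (addrC t) addrK ger0_norm; lra.
exists (t - m / 4); first by apply/andP; split; lra.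
by rewrite addrAC subrr sub0r normrN ger0_norm; lra.
Qed.

Lemma touch_edge_pts a b z t0 : G a b -> 0 < t0 < 1 -> touch z (γ a b t0) ->
  touch z (p a) /\ touch z (p b).
Proof.
move=> ab h0 tz; rewrite -(gam0 ab) -(gam1 ab).
by split; apply: touch_edge tz _ => //; [exact: I01_0|exact: I01_1].
Qed.

(** A touched point off H is a vertex outside S or lies on an edge with an end outside S, and a face
    that touches an inner point of an edge touches both its ends. *)
Lemma touch_out (S : pred V) (H : C -> Prop) z x :
  (forall v, S v -> H (p v)) ->
  (forall u v w, S u -> S v -> G u v -> img (γ u v) w -> H w) ->
  Gset x -> ~ H x -> touch z x -> exists2 v, ~~ S v & touch z (p v).
Proof.
move=> HS HE Gx nH tx.
case: Gx => [[v E]|[[u v] /= [uv _ hx]]].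
  by exists v; rewrite -?E //; apply/negP => Sv; apply: nH; rewrite E; apply: HS.
have [t ht E] := hx; case/andP: (ht) => t0 t1.
have [E0|n0] := eqVneq t 0.
  rewrite E E0 (gam0 uv) in tx nH; exists u => //.
  by apply/negP => Su; apply: nH; apply: HS.
have [E1|n1] := eqVneq t 1.
  rewrite E E1 (gam1 uv) in tx nH; exists v => //.
  by apply/negP => Su; apply: nH; apply: HS.
have tt : 0 < t < 1 by rewrite !lt_neqAle eq_sym n0 t0 n1 t1.
have [tu tv] : touch z (p u) /\ touch z (p v).
  by apply: (touch_edge_pts uv tt); rewrite -E.
have [Su|nSu] := boolP (S u); last by exists u.
have [Sv|nSv] := boolP (S v); last by exists v.
by case: nH; apply: HE hx.
Qed.

(** Near an inner point of an edge there is nothing else of the drawing. A walk from w towards that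
    point therefore leaves the face of w at an inner point of this edge. *)
Lemma near_edge a b (t0 : R) : G a b -> 0 < t0 < 1 -> exists2 r, 0 < r & forall w,
  nm (w - γ a b t0) < r ->
  ~ Gs (fun u v => [set u; v] != [set a; b]) w /\
  (off (γ a b) w -> [/\ free w, touch w (p a) & touch w (p b)]).
Proof.
move=> ab t01; have [r r0 H] := closed_Gs (edge_inner ab t01).
exists r => // w hw; split; first exact: H.
move=> ow; have fw : free w.
  by move=> Gw; have [/(H _ hw) //|] := Gset_split ab Gw; apply/off_img.
have nj : ~ joined free w (γ a b t0).
  case/andP: (t01) => t0p t0l.
  by move/joinedr; apply; apply: (G_edge ab); exists t0 => //; apply/andP; split; lra.
have [t [ht Gt tt]] := leave_seg fw nj.
have hb : nm (lerp w (γ a b t0) t - γ a b t0) < r by apply: lerp_ball => //; rewrite subrr nm0.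
have [/(H _ hb) //|[s hs E]] := Gset_split ab Gt.
have [s0 s1] := andP hs; rewrite E in hb tt.
have nv v : γ a b s = p v -> False by move=> Ev; apply: (H _ hb); left; exists v.
have ss : 0 < s < 1.
  rewrite !lt_neqAle eq_sym s0 s1 !andbT; apply/andP; split; apply/eqP => Es.
    by apply: (nv a); rewrite Es gam0.
  by apply: (nv b); rewrite Es gam1.
by have [ta tb] := touch_edge_pts ab ss tt.
Qed.
End Faces.
End Plane.

(** * Triangles in a plane graph *)

Section Plane.
Variable R : realType.
Notation C := R[i].
Notation Re := (@complex.Re R).
Notation Im := (@complex.Im R).
Notation "x %:c" := (real_complex R x) (at level 1, format "x %:c").
Implicit Types (x y z w : C) (t s : R).

Lemma con_disc (I : finType) (x : I -> C) (f : C -> C) : con (fun w => exists i, w = x i) f.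
Proof.
apply: con_union => i; first exact: closed_pt.
by move=> w -> e e0; exists 1 => // v -> _; rewrite subrr nm0.
Qed.

(** Each point of the polygon is itself reached from x inside O, by the initial part of the
    polygon. *)
Lemma joined_along (O O' : C -> Prop) x y : (forall w, joined O x w -> O' w) -> joined O x y -> joined O' x y.
Proof.
move=> H [n [v [h1 h2 h3]]]; exists n, v; split=> // i hi t ht; apply: H.
have js k : (k <= i)%N -> joined O x (v k).
  elim: k => [|k IH] ki; first by rewrite h1; apply: joined_refl; rewrite -h1; have := h3 0%N (leq0n n) 0 (@I01_0 R); rewrite lerp0.
  apply: joined_trans (IH (ltnW ki)) _; apply: joined_seg; apply: h3; exact: leq_trans (ltnW ki) hi.
apply: joined_trans (js i (leqnn _)) _.
have lE s : lerp (v i) (lerp (v i) (v i.+1) t) s = lerp (v i) (v i.+1) (s * t).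
  by rewrite /lerp rcM; ring.
apply: joined_seg => s hs; rewrite lE; apply: h3 => //.
by case/andP: hs => ? ?; case/andP: ht => ? ?; apply/andP; split; [exact: mulr_ge0|exact: mulr_ile1].
Qed.

Section Faces.
Variables (V : finType) (G : pgraph R V).
Implicit Types (a b c : V).
Notation p := (pp G).
Notation γ := (gam G).

Lemma set_neq (u v x y : V) : u != x -> u != y -> [set u; v] != [set x; y].
Proof. by move=> ux uy; apply/eqP => /setP /(_ u); rewrite !inE eqxx (negbTE ux) (negbTE uy). Qed.

Lemma edge_meet (u v x y : V) t s : G u v -> G x y -> [set u; v] != [set x; y] -> I01 t -> I01 s ->
  γ u v t = γ x y s -> γ u v t = p u \/ γ u v t = p v.
Proof.
move=> uv xy ne ht hs E; have [w Ew] := gam_cross uv xy ne ht hs E.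
by have [Eu|Eu] := gam_pt uv ht Ew; rewrite Ew Eu; [left|right].
Qed.

Lemma pt_off (u v w : V) : G u v -> w != u -> w != v -> off (γ u v) (p w).
Proof.
move=> uv wu wv t ht; apply/eqP => E; have [Ew|Ew] := gam_pt uv ht E.
  by rewrite Ew eqxx in wu.
by rewrite Ew eqxx in wv.
Qed.

(** An arc does not separate: with K0 reduced to its two ends, the root at [p b] can be defined as
    the one transported from [p a]. *)
Lemma arc_join a b z z' : G a b -> off (γ a b) z -> off (γ a b) z' ->
  joined (fun w => ~ img (γ a b) w) z z'.
Proof.
move=> ab oz oz'; have cg := gam_con ab.
pose x (i : bool) := if i then p a else p b.
have ba : (p b == p a) = false by rewrite (inj_eq (@pp_inj _ _ G)) eq_sym (negbTE (adj_neq ab)).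
have [I0 I1] := (@I01_0 R, @I01_1 R).
have za : p a - z != 0 by rewrite subr_eq0 -(gam0 ab) oz.
have za' : p a - z' != 0 by rewrite subr_eq0 -(gam0 ab) oz'.
pose k := sqrtc ((p a - z) * (p a - z')).
pose f w := if w == p a then k else k * rho (γ a b) z * rho (γ a b) z'.
have K0 : exists i, γ a b 0 = x i by exists true; rewrite gam0.
have K1 : exists i, γ a b 1 = x i by exists false; rewrite gam1.
have nK w : off (γ a b) w -> ~ exists i, w = x i.
  by move=> ow [[] E]; [have := ow 0 I0|have := ow 1 I1]; rewrite ?gam0 ?gam1 // E eqxx.
apply: (@joined_sub _ (fun w => ~ ((exists i, w = x i) \/ exists i : unit, img (γ a b) w))).
  by move=> w nw hw; apply: nw; right; exists tt.
apply: (@joined_glue _ _ _ (fun=> γ a b) f) => //.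
- by apply: closed_union => i; apply: closed_pt.
- by apply: bdd_union => i; exists (nm (x i)) => w ->.
- by move=> _; apply: gam_inj.
- exact: nK.
- exact: nK.
- exact: con_disc.
- move=> w [[] ->]; rewrite /f /x /=; first by rewrite eqxx sqr_sqrtc.
  by rewrite ba !exprMn sqr_sqrtc !rho_sq // gam0 // gam1 //; field; rewrite za za'.
- move=> _ t ht [[] E]; [left|right]; apply: (gam_inj ab) => //; rewrite E.
    by rewrite gam0.
  by rewrite gam1.
- by move=> [] []; left.
- by move=> _; rewrite gam0 // gam1 // /f eqxx ba.
Qed.

Lemma pt_join x z z' : z != x -> z' != x -> joined (fun w => w != x) z z'.
Proof.
move=> zx zx'; pose k := sqrtc ((x - z) * (x - z')).
apply: (@joined_sub _ (fun w => ~ ((exists i : unit, w = x) \/ exists i : void, img (fun=> 0) w))).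
  by move=> w nw; apply/eqP => E; apply: nw; left; exists tt.
apply: (@joined_glue _ _ _ (fun=> fun=> 0) (fun=> k)) => //.
- by apply: (@closed_union _ unit (fun _ w => w = x)) => i; apply: closed_pt.
- by apply: (@bdd_union _ unit (fun _ w => w = x)) => i; exists (nm x) => w ->.
- by move=> [_ E]; rewrite E eqxx in zx.
- by move=> [_ E]; rewrite E eqxx in zx'.
- exact: (@con_disc unit (fun=> x)).
- by move=> w [_ ->]; rewrite sqr_sqrtc.
Qed.

(** * The two sides of a triangle *)

Definition tri a b c := [&& G a b, G b c & G c a].
Definition Tset a b c w := [\/ img (γ a b) w, img (γ b c) w | img (γ c a) w].
(** The half winding of the closed curve formed by the three edges: off the triangle it is a sign,
    the parity of the winding number about z. *)
Definition Wt a b c z := rho (γ a b) z * rho (γ b c) z * rho (γ c a) z.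

Lemma tri_neq a b c : tri a b c -> [/\ a != b, b != c & c != a].
Proof. by case/and3P=> ab bc ca; split; [exact: adj_neq ab|exact: adj_neq bc|exact: adj_neq ca]. Qed.

Lemma not_Tset a b c w : ~ Tset a b c w <-> [/\ off (γ a b) w, off (γ b c) w & off (γ c a) w].
Proof.
split=> [n|[h1 h2 h3]].
  by split; apply/off_img => h; apply: n; [apply: Or31|apply: Or32|apply: Or33].
by case; apply/off_img.
Qed.

Lemma closed_Tset a b c : tri a b c -> closedK (Tset a b c).
Proof.
case/and3P=> ab bc ca.
have := closed_or (closed_img (gam_con ab)) (closed_or (closed_img (gam_con bc)) (closed_img (gam_con ca))).
move=> H z nz; have [|r r0 Hr] := H z.
  by case=> [h|[h|h]]; apply: nz; [apply: Or31|apply: Or32|apply: Or33].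
exists r => // w hw [h|h|h]; apply: (Hr w hw); [by left|by right; left|by right; right].
Qed.

Lemma Wt_sq a b c z : tri a b c -> ~ Tset a b c z -> Wt a b c z ^+ 2 = 1.
Proof.
move=> /and3P[ab bc ca] /not_Tset[h1 h2 h3].
have [I0 _] := (@I01_0 R, @I01_1 R).
rewrite /Wt 2!exprMn !rho_sq ?gam0 ?gam1 //; try exact: gam_con.
have n1 : p a - z != 0 by rewrite subr_eq0 -(gam0 ab) h1.
have n2 : p b - z != 0 by rewrite subr_eq0 -(gam0 bc) h2.
have n3 : p c - z != 0 by rewrite subr_eq0 -(gam0 ca) h3.
by field; rewrite n1 n2 n3.
Qed.

Lemma Wt_or a b c z z' z'' : tri a b c -> ~ Tset a b c z -> ~ Tset a b c z' -> ~ Tset a b c z'' ->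
  Wt a b c z != Wt a b c z' -> Wt a b c z'' = Wt a b c z \/ Wt a b c z'' = Wt a b c z'.
Proof.
move=> T h h' h'' ne.
have E : Wt a b c z' = - Wt a b c z.
  have /sqr_sign[e|//] : Wt a b c z' ^+ 2 = Wt a b c z ^+ 2 by rewrite !Wt_sq.
  by rewrite e eqxx in ne.
have /sqr_sign[->|->] : Wt a b c z'' ^+ 2 = Wt a b c z ^+ 2 by rewrite !Wt_sq.
  by left.
by right.
Qed.

Lemma Wt_cont a b c z : tri a b c -> ~ Tset a b c z -> cAt (@dC R) (@full R) (Wt a b c) z.
Proof.
move=> /and3P[ab bc ca] /not_Tset[h1 h2 h3].
by apply: cAtM; [apply: cAtM|]; apply: rho_cont => //; apply: gam_con.
Qed.

Lemma Wt_path a b c (g : R -> C) : tri a b c -> pcon g -> (forall t, I01 t -> ~ Tset a b c (g t)) ->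
  forall t, I01 t -> Wt a b c (g t) = Wt a b c (g 0).
Proof.
move=> T cg og; apply: (@pm1_const _ (fun t => Wt a b c (g t))) => t ht.
  by apply: (@cAt_comp _ _ _ _ (@full R) g) => //; [exact: cg|apply: Wt_cont => //; exact: og].
by rewrite Wt_sq //; exact: og.
Qed.

Lemma joined_Wt a b c z z' : tri a b c -> joined (fun w => ~ Tset a b c w) z z' ->
  Wt a b c z = Wt a b c z'.
Proof.
move=> T zz'; pose D w := Wt a b c z = Wt a b c w.
suff : D z -> D z' by apply.
apply: (joined_ind _ zz') => u v uv E; rewrite /D E.
have := @Wt_path a b c (lerp u v) T _ uv 1 (@I01_1 R).
by rewrite lerp0 lerp1 => ->// t _; apply: cAt_lerp.
Qed.

(** The root is chosen at [p a] and transported to [p b] and [p c]. The one condition left, along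
    the edge back to a, is that the full turn multiplies by 1, and the full turn multiplies by
    [Wt a b c z * Wt a b c z']. *)
Lemma tri_join a b c z z' : tri a b c -> ~ Tset a b c z -> ~ Tset a b c z' ->
  Wt a b c z = Wt a b c z' -> joined (fun w => ~ Tset a b c w) z z'.
Proof.
move=> T nz nz' WE; have [ab bc ca] := and3P T; have [nab nbc nca] := tri_neq T.
have [oz1 oz2 oz3] := (not_Tset a b c z).1 nz.
have [oz1' oz2' oz3'] := (not_Tset a b c z').1 nz'.
have [I0 I1] := (@I01_0 R, @I01_1 R).
pose x (i : option bool) := if i is Some i then (if i then p b else p c) else p a.
pose h (i : option bool) := if i is Some i then (if i then γ b c else γ c a) else γ a b.
have ba : (p b == p a) = false by rewrite (inj_eq (@pp_inj _ _ G)) eq_sym (negbTE nab).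
have eca : (p c == p a) = false by rewrite (inj_eq (@pp_inj _ _ G)) (negbTE nca).
have ecb : (p c == p b) = false by rewrite (inj_eq (@pp_inj _ _ G)) eq_sym (negbTE nbc).
have za : p a - z != 0 by rewrite subr_eq0 -(gam0 ab) oz1.
have za' : p a - z' != 0 by rewrite subr_eq0 -(gam0 ab) oz1'.
have zb : p b - z != 0 by rewrite subr_eq0 -(gam0 bc) oz2.
have zb' : p b - z' != 0 by rewrite subr_eq0 -(gam0 bc) oz2'.
pose k := sqrtc ((p a - z) * (p a - z')).
pose f w := if w == p a then k else if w == p b then k * rho (γ a b) z * rho (γ a b) z' else
  k * rho (γ a b) z * rho (γ a b) z' * rho (γ b c) z * rho (γ b c) z'.
have ch i : pcon (h i) by case: i => [[]|]; exact: gam_con.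
have nK w : ~ Tset a b c w -> ~ exists i, w = x i.
  move=> /not_Tset[h1 h2 h3] [[[]|] E].
  - by have := h2 0 I0; rewrite gam0 // E eqxx.
  - by have := h3 0 I0; rewrite gam0 // E eqxx.
  - by have := h1 0 I0; rewrite gam0 // E eqxx.
have oh w i : ~ Tset a b c w -> off (h i) w by move=> /not_Tset[h1 h2 h3]; case: i => [[]|].
apply: (@joined_sub _ (fun w => ~ ((exists i, w = x i) \/ exists i, img (h i) w))).
  move=> w nw hw; apply: nw; right.
  by case: hw => hw; [exists None|exists (Some true)|exists (Some false)].
apply: (@joined_glue _ _ _ h f) => //.
- by apply: closed_union => i; apply: closed_pt.
- by apply: bdd_union => i; exists (nm (x i)) => w ->.
- by case=> [[]|]; exact: gam_inj.
- exact: nK.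
- exact: nK.
- by move=> i; apply: oh.
- by move=> i; apply: oh.
- exact: con_disc.
- move=> w [[[]|] ->]; rewrite /f /x /=.
  + by rewrite ba eqxx !exprMn sqr_sqrtc !rho_sq // ?gam0 ?gam1 //; [field; rewrite za za'|exact: gam_con..].
  + rewrite eca ecb 4!exprMn sqr_sqrtc !rho_sq // ?gam0 ?gam1 //; try exact: gam_con.
    by field; rewrite za za' zb zb'.
  + by rewrite eqxx sqr_sqrtc.
- by case=> [[]|] /=; rewrite gam0 //; [exists (Some true)|exists (Some false)|exists None].
- by case=> [[]|] /=; rewrite gam1 //; [exists (Some false)|exists None|exists (Some true)].
- have key u v t i : G u v -> I01 t -> γ u v t = x i -> t = 0 \/ t = 1.
    move=> uv ht E; have [w Ew] : exists w : V, x i = p w by case: (i) => [[]|]; [exists b|exists c|exists a].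
    rewrite Ew in E; have [Eu|Eu] := gam_pt uv ht E; rewrite Eu in E; [left|right].
      by apply: (gam_inj uv) => //; rewrite gam0.
    by apply: (gam_inj uv) => //; rewrite gam1.
  by case=> [[]|] t ht [j hj]; apply: key hj.
- have s1 : [set a; b] != [set b; c] by apply: set_neq => //; rewrite eq_sym.
  have s2 : [set a; b] != [set c; a] by rewrite finset.setUC; apply: set_neq; rewrite 1?eq_sym // eq_sym.
  have s3 : [set b; c] != [set c; a] by apply: set_neq => //; rewrite eq_sym.
  have xa : exists i, p a = x i by exists None.
  have xb : exists i, p b = x i by exists (Some true).
  have xc : exists i, p c = x i by exists (Some false).
  have s1' := s1; have s2' := s2; have s3' := s3; rewrite eq_sym in s1'; rewrite eq_sym in s2'; rewrite eq_sym in s3'.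
  by case=> [[]|] [[]|] t s ht hs /= E; try (by left); right;
    first [ have [->|->] := edge_meet bc ca s3 ht hs E | have [->|->] := edge_meet bc ab s1' ht hs E
          | have [->|->] := edge_meet ca bc s3' ht hs E | have [->|->] := edge_meet ca ab s2' ht hs E
          | have [->|->] := edge_meet ab bc s1 ht hs E | have [->|->] := edge_meet ab ca s2 ht hs E ].
have W2 : Wt a b c z * Wt a b c z' = 1 by rewrite -WE -expr2 Wt_sq.
case=> [[]|] /=; rewrite gam0 // gam1 // /f ?eqxx ?ba ?eca ?ecb ?eqxx //.
by rewrite -[RHS]mulr1 -W2 /Wt; ring.
Qed.

(** If the sign were constant near the point, transport along ab would extend across ab as a
    constant divided by the transport along the other two edges; this is what [two_sides]
    forbids. *)
Lemma tri_near a b c (t0 r : R) : tri a b c -> 0 < t0 < 1 -> 0 < r -> exists z z',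
  [/\ nm (z - γ a b t0) < r, nm (z' - γ a b t0) < r, ~ Tset a b c z, ~ Tset a b c z' &
      Wt a b c z != Wt a b c z'].
Proof.
move=> T t01 r0; have [ab bc ca] := and3P T; have [nab nbc nca] := tri_neq T.
have [r' r'0 H] := near_edge ab t01.
pose r2 := Num.min r r'; have r20 : 0 < r2 by rewrite lt_min r0.
have cg := gam_con ab; have ig := gam_inj ab.
have other w : nm (w - γ a b t0) < r2 -> off (γ b c) w /\ off (γ c a) w.
  rewrite lt_min => /andP[_ /H[ng _]]; split; apply/off_img => hw; apply: ng; right.
    by exists (b, c); split=> //=; rewrite eq_sym; apply: set_neq => //; rewrite eq_sym.
  by exists (c, a); split=> //=; apply: set_neq; rewrite // eq_sym.
have [z0 hz0 oz0] := arc_nowhere_dense cg ig t01 r20.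
have nT w : nm (w - γ a b t0) < r2 -> off (γ a b) w -> ~ Tset a b c w.
  by move=> hw ow; apply/not_Tset; have [] := other w hw.
pose k := Wt a b c z0.
have cb := gam_con bc; have cc := gam_con ca.
have rn w : nm (w - γ a b t0) < r2 -> rho (γ b c) w * rho (γ c a) w != 0.
  by move=> hw; have [h1 h2] := other w hw; rewrite mulf_neq0 // rho_neq0.
have [w hw|w hw|z [hz oz ne]] := @two_sides _ (γ a b) t0 r2 (fun w => k / (rho (γ b c) w * rho (γ c a) w)) cg ig t01 r20.
- have [h1 h2] := other w hw; apply: cAt_div; [exact: rn|exact: cAt_cst|].
  by apply: cAtM; apply: rho_cont.
- have [h1 h2] := other w hw; rewrite expr_div_n (Wt_sq T (nT _ hz0 oz0)) exprMn.
  rewrite !rho_sq // !gam0 // !gam1 //.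
  have n1 : p b - w != 0 by rewrite subr_eq0 -(gam0 bc) h1 //; exact: I01_0.
  have n2 : p c - w != 0 by rewrite subr_eq0 -(gam0 ca) h2 //; exact: I01_0.
  have n3 : p a - w != 0 by rewrite subr_eq0 -(gam1 ca) h2 //; exact: I01_1.
  by field; rewrite n1 n2 n3.
exists z, z0; split; [| |exact: nT|exact: nT|].
- by move: hz; rewrite lt_min => /andP[].
- by move: hz0; rewrite lt_min => /andP[].
apply: contraNneq ne => E; apply/eqP; apply: (canRL (mulfK (rn _ hz))).
by rewrite mulrA; exact: E.
Qed.

Lemma edge_free a b : G a b -> exists z, [/\ free G z, touch G z (p a) & touch G z (p b)].
Proof.
move=> ab; have t01 : 0 < (1 / 2 : R) < 1 by apply/andP; split; lra.
have [r r0 H] := near_edge ab t01.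
have [z hz oz] := arc_nowhere_dense (gam_con ab) (gam_inj ab) t01 r0.
by exists z; have [_] := H z hz; apply.
Qed.

(** The points z and z' are near the middle of ab, on opposite sides for abc. For another triangle
    abd, the transports along the two edges at d and along those at c have the same square, so their
    quotient is constant on the segment from z to z'. Hence the sign of abd changes because that of
    abc does. *)
Lemma edge_sides a b c : tri a b c -> exists z z',
  [/\ free G z, free G z', touch G z (p a) /\ touch G z (p b), touch G z' (p a) /\ touch G z' (p b) &
   forall d, tri a b d -> Wt a b d z != Wt a b d z'].
Proof.
move=> T; have t01 : 0 < (1 / 2 : R) < 1 by apply/andP; split; lra.
have [ab bc ca] := and3P T.
have [r r0 H] := near_edge ab t01.
have [z [z' [hz hz' nTz nTz' ne]]] := tri_near T t01 r0.
have [oz _ _] := (not_Tset _ _ _ _).1 nTz; have [oz' _ _] := (not_Tset _ _ _ _).1 nTz'.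
have [_ /(_ oz)[fz ta tb]] := H z hz; have [_ /(_ oz')[fz' ta' tb']] := H z' hz'.
exists z, z'; split=> // d Td.
have other e w : tri a b e -> nm (w - γ a b (1 / 2)) < r -> off (γ b e) w /\ off (γ e a) w.
  move=> Te /H[ng _]; have [_ be ea] := and3P Te; have [nab nbe nea] := tri_neq Te.
  split; apply/off_img => hw; apply: ng; right.
    by exists (b, e); split=> //=; rewrite eq_sym; apply: set_neq => //; rewrite eq_sym.
  by exists (e, a); split=> //=; apply: set_neq; rewrite // eq_sym.
pose F e w := rho (γ b e) w * rho (γ e a) w.
have FE e w : Wt a b e w = rho (γ a b) w * F e w by rewrite /Wt mulrA.
have F0 e w : tri a b e -> nm (w - γ a b (1 / 2)) < r -> F e w != 0.
  move=> Te hw; have [h1 h2] := other e w Te hw; have [_ be ea] := and3P Te.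
  by rewrite mulf_neq0 // rho_neq0 //; exact: gam_con.
have F2 e w : tri a b e -> nm (w - γ a b (1 / 2)) < r -> F e w ^+ 2 = (p a - w) / (p b - w).
  move=> Te hw; have [h1 h2] := other e w Te hw; have [_ be ea] := and3P Te.
  rewrite exprMn !rho_sq //; try exact: gam_con.
  rewrite !gam0 // !gam1 //.
  have n1 : p b - w != 0 by rewrite subr_eq0 -(gam0 be) h1 //; exact: I01_0.
  have n2 : p e - w != 0 by rewrite subr_eq0 -(gam0 ea) h2 //; exact: I01_0.
  by field; rewrite n1 n2.
have Fc e w : tri a b e -> nm (w - γ a b (1 / 2)) < r -> cAt (@dC R) (@full R) (F e) w.
  move=> Te hw; have [h1 h2] := other e w Te hw; have [_ be ea] := and3P Te.
  by apply: cAtM; apply: rho_cont => //; exact: gam_con.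
have inb t : I01 t -> nm (lerp z z' t - γ a b (1 / 2)) < r by move=> ht; apply: lerp_ball.
have := @pm1_const _ (fun t => F d (lerp z z' t) / F c (lerp z z' t)).
move=> /(_ _ _ 1 (@I01_1 R)); rewrite lerp0 lerp1 => K.
have {}K : F d z' / F c z' = F d z / F c z.
  apply: K => t ht.
    have cl := @cAt_lerp _ (@I01 R) z z' t.
    apply: cAt_div; [by apply: F0 => //; apply: inb| |]; apply: (@cAt_comp _ _ _ _ (@full R) (lerp z z')) => //;
      by apply: Fc => //; apply: inb.
  rewrite expr_div_n !F2 ?divff //; try exact: inb.
  by rewrite -(F2 c) ?expf_neq0 ?F0 //; exact: inb.
rewrite !FE; apply: contraNneq ne => E; rewrite !FE.
have k0 : F d z / F c z != 0 by rewrite mulf_neq0 ?invr_eq0 ?F0.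
have Fz := F0 c z T hz; have Fz' := F0 c z' T hz'.
have e1 : rho (γ a b) z * F c z * (F d z / F c z) = rho (γ a b) z * F d z by field.
have e2 : rho (γ a b) z' * F c z' * (F d z' / F c z') = rho (γ a b) z' * F d z' by field.
by apply/eqP; apply: (mulIf k0); rewrite e1 -K e2.
Qed.
End Faces.
End Plane.

(** * Arcs extracted from infinite polygons *)

Section Plane.
Variable R : realType.
Notation C := R[i].
Notation Re := (@complex.Re R).
Notation Im := (@complex.Im R).
Notation "x %:c" := (real_complex R x) (at level 1, format "x %:c").
Implicit Types (x y z w : C) (t s : R).

Definition cl (t : R) : R := if t <= 0 then 0 else if 1 <= t then 1 else t.

Lemma cl_cases t : [\/ t <= 0 /\ cl t = 0, 1 <= t /\ cl t = 1 | 0 <= t <= 1 /\ cl t = t].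
Proof.
rewrite /cl; case: (leP t 0) => [h|/ltW h]; first by apply: Or31.
case: (leP 1 t) => [h'|/ltW h']; first by apply: Or32.
by apply: Or33; rewrite h h'.
Qed.

Lemma cl_I t : I01 (cl t).
Proof.
by rewrite /I01; have [[_ ->]|[_ ->]|[h ->]] := cl_cases t; rewrite ?h // ?lexx ?ler01.
Qed.

Lemma cl_mono t s : t <= s -> 0 <= cl s - cl t <= s - t.
Proof.
move=> ts; have := cl_cases t; have := cl_cases s.
case=> [[a ->]|[a ->]|[/andP[a a'] ->]] [[b ->]|[b ->]|[/andP[b b'] ->]]; apply/andP; split; lra.
Qed.

Lemma cl_lip t s : `|cl t - cl s| <= `|t - s|.
Proof.
wlog ts : t s / t <= s.
  by move=> H; have [h|/ltW h] := leP t s; [exact: H|rewrite distrC [X in _ <= X]distrC; exact: H].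
have /andP[h1 h2] := cl_mono ts.
by rewrite distrC [X in _ <= X]distrC !ger0_norm ?subr_ge0 //; lra.
Qed.

Lemma cl_id t : I01 t -> cl t = t.
Proof.
move=> /andP[h0 h1]; rewrite /cl; case: leP => [a|_]; first by lra.
by case: leP => // a; lra.
Qed.

Lemma cl_le0 t : t <= 0 -> cl t = 0. Proof. by rewrite /cl => ->. Qed.
Lemma cl_ge1 t : 1 <= t -> cl t = 1.
Proof. by move=> h; rewrite /cl h; case: leP => // h'; lra. Qed.

(** Concatenation written as a sum of clamped paths, so that continuity needs no case distinction;
    [f 1 = g 0] makes the second term vanish on the first half. *)
Definition cat (f g : R -> C) (t : R) : C := f (cl (2 * t)) + (g (cl (2 * t - 1)) - f 1).

Lemma catl f g t : f 1 = g 0 -> t <= 1 / 2 -> cat f g t = f (cl (2 * t)).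
Proof. by move=> E h; rewrite /cat (@cl_le0 (2 * t - 1)) ?E ?subrr ?addr0 //; lra. Qed.

Lemma catr f g t : 1 / 2 <= t -> cat f g t = g (cl (2 * t - 1)).
Proof. by move=> h; rewrite /cat (@cl_ge1 (2 * t)); [rewrite addrC subrK|lra]. Qed.

Lemma pcon_lip (f : R -> C) (a b : R) : pcon f ->
  forall K t, cAt (@dR R) K (fun t => f (cl (a * t - b))) t.
Proof.
move=> cf K t; apply: (@cAt_pre _ _ _ (@dR R) (@dR R) _ (@I01 R) (fun t => cl (a * t - b))).
- by move=> s _; apply: cl_I.
- move=> r r0; have a0 : 0 < `|a| + 1 by rewrite ltr_wpDl.
  exists (r / (`|a| + 1)); first exact: divr_gt0.
  move=> s _; rewrite /dR ltr_pdivlMr // => h; apply: le_lt_trans (cl_lip _ _) _.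
  rewrite (_ : _ - _ = a * (s - t)); last by ring.
  rewrite normrM; apply: le_lt_trans h; rewrite mulrC ler_wpM2l // lerDl //.
- by apply: cf; apply: cl_I.
Qed.

Lemma pcon_cat f g : pcon f -> pcon g -> pcon (cat f g).
Proof.
move=> cf cg t ht; apply: cAtD.
  by apply: (@eq_cAt _ _ _ _ (fun t => f (cl (2 * t - 0)))) => [s|]; [rewrite subr0|exact: pcon_lip].
by apply: cAtB; [exact: pcon_lip|exact: cAt_cst].
Qed.

Lemma cat0 f g : f 1 = g 0 -> cat f g 0 = f 0.
Proof. by move=> E; rewrite catl ?mulr0 ?cl_le0 //; lra. Qed.

Lemma cat1 f g : cat f g 1 = g 1.
Proof. by rewrite catr ?cl_ge1 //; lra. Qed.

Lemma inj_cat f g : f 1 = g 0 -> inj01 f -> inj01 g ->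
  (forall t s, I01 t -> I01 s -> f t = g s -> s = 0) -> inj01 (cat f g).
Proof.
move=> E jf jg fg t s ht hs.
have [t0 t1] := andP ht; have [s0 s1] := andP hs.
have lE u : 0 <= u -> u <= 1 / 2 -> cl (2 * u) = 2 * u by move=> *; apply: cl_id; apply/andP; split; lra.
have rE u : 1 / 2 <= u -> u <= 1 -> cl (2 * u - 1) = 2 * u - 1 by move=> *; apply: cl_id; apply/andP; split; lra.
have [a|/ltW a] := leP t (1 / 2); have [b|/ltW b] := leP s (1 / 2).
- by rewrite !catl // => /(jf _ _ (cl_I _) (cl_I _)); rewrite !lE //; lra.
- rewrite catl // catr // => F; have S0 := fg _ _ (cl_I _) (cl_I _) F.
  move: (F); rewrite S0 -E => /(jf _ _ (cl_I _) (@I01_1 R)).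
  by move: S0; rewrite lE // rE //; lra.
- rewrite catr // catl // => /esym F; have S0 := fg _ _ (cl_I _) (cl_I _) F.
  move: (F); rewrite S0 -E => /(jf _ _ (cl_I _) (@I01_1 R)).
  by move: S0; rewrite lE // rE //; lra.
- by rewrite !catr // => /(jg _ _ (cl_I _) (cl_I _)); rewrite !rE //; lra.
Qed.

Lemma last_time (D : R -> Prop) : (exists t, I01 t /\ D t) ->
  (forall t, I01 t -> ~ D t -> exists2 r, 0 < r & forall s, I01 s -> `|s - t| < r -> ~ D s) ->
  exists t, [/\ I01 t, D t & forall s, I01 s -> D s -> s <= t].
Proof.
move=> [t0 [ht0 Dt0]] cD.
pose A : set R := fun t => I01 t /\ D t.
have ubA : ubound A 1 by move=> t [/andP[]].
have hA : has_sup A by split; [exists t0|exists 1].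
have le_sup s : I01 s -> D s -> s <= sup A by move=> hs Ds; apply: ub_le_sup => //; exists 1.
have hs : I01 (sup A).
  apply/andP; split; last by apply: ge_sup => //; exists t0.
  by apply: le_trans (le_sup _ ht0 Dt0); case/andP: ht0.
exists (sup A); split=> //; apply: contrapT => nD.
have [r r0 H] := cD _ hs nD.
have [s [hs' Ds] hlt] := sup_adherent r0 hA.
have := le_sup _ hs' Ds => hle.
by apply: (H s hs') Ds; rewrite ltr_norml; apply/andP; split; lra.
Qed.

Lemma lerp_inj x y t s : x != y -> lerp x y t = lerp x y s -> t = s.
Proof.
move=> xy /addrI; have yx : y - x != 0 by rewrite subr_eq0 eq_sym.
by move/(mulIf yx)/complexI.
Qed.

Lemma pcon_lerp x y : pcon (lerp x y).
Proof. by move=> t _; apply: cAt_lerp. Qed.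

(* Loop erasure: from the current point, follow the current segment of the polygon to the last
   point of it that the polygon visits, and continue from that last visit. *)
Lemma ray (W : nat -> C) x :
  (forall i t, I01 t -> lerp (W i) (W i.+1) t != x) ->
  (forall e, 0 < e -> exists N, forall i t, (N <= i)%N -> I01 t -> nm (lerp (W i) (W i.+1) t - x) < e) ->
  exists g, [/\ pcon g, inj01 g, g 0 = W 0%N, g 1 = x &
    forall t, 0 <= t < 1 -> exists i s, I01 s /\ g t = lerp (W i) (W i.+1) s].
Proof.
(* A time on the polygon is a segment number with a parameter in that segment, and times are ordered
   lexicographically by [before]. *)
move=> Wx Wcv; pose L (q : nat * R) := lerp (W q.1) (W q.1.+1) q.2.
have L0 i : L (i, 0) = W i by rewrite /L lerp0.
have L1 i : L (i, 1) = W i.+1 by rewrite /L lerp1.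
pose before (q' q : nat * R) := (q'.1 < q.1)%N \/ (q'.1 = q.1 /\ q'.2 <= q.2).
(* The polygon converges to x, which is off the closed set S, so only finitely many segments meet S;
   [last_time] is applied in the last of these. *)
have last (S : C -> Prop) q0 : closedK S -> ~ S x -> I01 q0.2 -> S (L q0) -> exists q,
    [/\ I01 q.2, S (L q) & forall q', I01 q'.2 -> S (L q') -> before q' q].
  move=> cS nS hq0 Sq0; have [r r0 Hr] := cS x nS; have [N HN] := Wcv r r0.
  pose P := fun j => `[< exists t, I01 t /\ S (L (j, t)) >].
  have exP : exists j, P j by exists q0.1; apply/asboolP; exists q0.2; move: Sq0; rewrite /L.
  have ubP j : P j -> (j <= N)%N.
    move=> /asboolP[t [ht St]]; rewrite leqNgt; apply/negP => /ltnW Nj.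
    by apply: (Hr (L (j, t))) St; apply: HN.
  have [j /asboolP Pj maxj] := ex_maxnP exP ubP.
  have [|s [hs Ss maxs]] := @last_time (fun t => S (L (j, t))) Pj.
    move=> t ht nSt; have [e e0 He] := cS _ nSt.
    have [d d0 Hd] := @cAt_lerp _ (@I01 R) (W j) (W j.+1) t e e0.
    by exists d => // s hs hst; apply: He; apply: Hd.
  exists (j, s); split=> // -[j' s'] /= hs' Ss'.
  have jj : (j' <= j)%N by apply: maxj; apply/asboolP; exists s'.
  rewrite leq_eqVlt in jj; case/orP: jj => [/eqP E|]; last by left.
  by right; split=> //; apply: maxs => //; rewrite -E.
pose Sg (q : nat * R) := img (lerp (L q) (W q.1.+1)).
have SgE q t : lerp (L q) (W q.1.+1) t = L (q.1, q.2 + t * (1 - q.2)).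
  by rewrite /L /lerp /= rcD rcM rcB; ring.
have SgI (q : nat * R) t : I01 q.2 -> I01 t -> I01 (q.2 + t * (1 - q.2)).
  by move=> hq ht; apply: I01_sub => //; exact: I01_1.
have nxtP q : exists q', I01 q.2 -> [/\ I01 q'.2, Sg q (L q') &
    forall q'', I01 q''.2 -> Sg q (L q'') -> before q'' q'].
  have [hq|nq] := pselect (I01 q.2); last by exists q => /nq.
  have [|||q' Hq'] := last (Sg q) q _ _ hq.
  - by apply: closed_img; apply: pcon_lerp.
  - move=> [t ht E]; have := Wx q.1 _ (SgI _ _ hq ht); rewrite E.
    by rewrite SgE /L eqxx.
  - by exists 0; [exact: I01_0|rewrite lerp0].
  - by exists q'.
have [nxt Hn] := choice nxtP.
have [q0 [hq0 Sq0 Mq0]] : exists q, [/\ I01 q.2, L q = W 0%N &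
    forall q', I01 q'.2 -> L q' = W 0%N -> before q' q].
  apply: (last (fun w => w = W 0%N) (0%N, 0)).
  - exact: closed_pt.
  - by move=> E; have := Wx 0%N 0 (@I01_0 R); rewrite lerp0 E eqxx.
  - exact: I01_0.
  - by rewrite L0.
pose st k := iter k nxt q0; pose X k := L (st k).
have stI k : I01 (st k).2 by elim: k => //= k IH; have [] := Hn _ IH.
have stS k : Sg (st k) (X k.+1) by have [] := Hn _ (stI k).
have stM k q : I01 q.2 -> Sg (st k) (L q) -> before q (st k.+1).
  by have [_ _] := Hn _ (stI k); apply.
(* The end of the current segment is also the start of the following one, so the last visit to the
   segment has a larger number. *)
have st_lt k : ((st k).1 < (st k.+1).1)%N.
  have B : before ((st k).1.+1, 0) (st k.+1).
    apply: stM; first exact: I01_0.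
    by rewrite L0; exists 1; [exact: I01_1|rewrite lerp1].
  by case: B => [/= h|[/= E _]]; [exact: ltn_trans (ltnSn _) h|rewrite -E].
have st_mono k l : (k <= l)%N -> ((st k).1 <= (st l).1)%N.
  elim: l => [|l IH]; first by rewrite leqn0 => /eqP ->.
  rewrite leq_eqVlt ltnS => /orP[/eqP -> //|/IH h]; exact: leq_trans h (ltnW (st_lt l)).
have st_ltn k l : (k < l)%N -> ((st k).1 < (st l).1)%N.
  by move=> kl; apply: leq_trans (st_lt k) _; apply: st_mono.
have st_ge k : (k <= (st k).1)%N by elim: k => // k IH; apply: leq_ltn_trans IH (st_lt k).
have Xlast k q : I01 q.2 -> L q = X k -> before q (st k).
  case: k => [|k] hq E; first by apply: Mq0 => //; rewrite E.
  by apply: stM => //; rewrite E.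
have X0 : X 0%N = W 0%N by [].
have Xneq k : X k != X k.+1.
  apply/eqP => E; have := Xlast k (st k.+1) (stI _) (esym E).
  have := st_lt k; rewrite /before => h [h'|[h' _]].
    by rewrite ltnNge ltnW in h'.
  by rewrite h' ltnn in h.
have piece k t : I01 t -> exists s, [/\ I01 s, (st k).2 <= s, lerp (X k) (X k.+1) t = L ((st k).1, s) &
    Sg (st k) (lerp (X k) (X k.+1) t)].
  move=> ht; have [u hu E] := stS k.
  have hut : I01 (t * u).
    by case/andP: ht => ? ?; case/andP: hu => ? ?; apply/andP; split; [exact: mulr_ge0|exact: mulr_ile1].
  have EE : lerp (X k) (X k.+1) t = lerp (X k) (W (st k).1.+1) (t * u) by rewrite E -[L (st k)]/(X k) /lerp rcM; ring.
  exists ((st k).2 + t * u * (1 - (st k).2)); split; first exact: SgI.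
  - by rewrite lerDl mulr_ge0 ?subr_ge0; [|case/andP: hut|case/andP: (stI k)].
  - by rewrite EE SgE.
  - by rewrite EE; exists (t * u).
(* A common point with a later piece is a visit to the segment followed by piece k, hence not later
   than [st k.+1]; this forces l = k.+1 and the point is [X k.+1]. *)
have cross k l t s : (k < l)%N -> I01 t -> I01 s -> lerp (X k) (X k.+1) t = lerp (X l) (X l.+1) s -> t = 1.
  move=> kl ht hs E; have [u [hu hul Eu _]] := piece l s hs; have [_ [_ _ _ Sk]] := piece k t ht.
  have B : before ((st l).1, u) (st k.+1) by apply: stM => //; rewrite -Eu -E.
  have jl := st_mono _ _ kl.
  case: B => /= [h|[h1 h2]]; first by rewrite ltnNge jl in h.
  have El : l = k.+1.
    apply/eqP; rewrite eqn_leq kl andbT leqNgt; apply/negP => /st_ltn; by rewrite h1 ltnn.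
  rewrite El in hul Eu E; have Eus : u = (st k.+1).2 by lra.
  rewrite Eus -surjective_pairing in Eu.
  by apply: (lerp_inj (Xneq k)); rewrite lerp1 E Eu.
(* The first n pieces run through during [0, n], again as one sum of clamped terms. *)
pose P (n : nat) (t : R) : C := X 0%N + \sum_(k < n) (cl (t - k%:R))%:c * (X k.+1 - X k).
have Pcont n t K : cAt (@dR R) K (P n) t.
  apply: cAtD; first exact: cAt_cst.
  elim: n => [|n IH]; first by apply: eq_cAt (cAt_cst _ _ 0 t) => s; rewrite big_ord0.
  apply: (@eq_cAt _ _ _ _ (fun t => \sum_(k < n) (cl (t - k%:R))%:c * (X k.+1 - X k) + (cl (t - n%:R))%:c * (X n.+1 - X n))).
    by move=> s; rewrite big_ord_recr.
  apply: cAtD => //; apply: cAtM; last exact: cAt_cst.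
  move=> e e0; exists e => // s _ hs; rewrite -rcB nm_real; apply: le_lt_trans (cl_lip _ _) _.
  by rewrite (_ : _ - _ = s - t) //; ring.
have Pstep n t : t <= n%:R -> P n.+1 t = P n t.
  by move=> h; rewrite /P big_ord_recr /= cl_le0 ?mul0r ?addr0 // subr_le0.
have Pstab n m t : (n <= m)%N -> t <= n%:R -> P m t = P n t.
  move=> + h; elim: m => [|m IH]; first by rewrite leqn0 => /eqP ->.
  rewrite leq_eqVlt => /orP[/eqP -> //|nm']; rewrite -IH // Pstep //; apply: le_trans h _.
  by rewrite ler_nat.
have PX n t : n%:R <= t -> P n t = X n.
  elim: n => [|n IH] h; first by rewrite /P big_ord0 addr0.
  have h' : n%:R + 1 <= t by rewrite natr1.
  have := IH _; rewrite /P big_ord_recr /= addrA => ->; last lra.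
  by rewrite cl_ge1; [rewrite mul1r addrC subrK|lra].
have Pval n t : n%:R <= t -> t <= n.+1%:R -> P n.+1 t = lerp (X n) (X n.+1) (t - n%:R).
  move=> h1 h2; rewrite /P big_ord_recr /= addrA -[X 0%N + _]/(P n t) PX // cl_id //.
  by rewrite -natr1 in h2; apply/andP; split; lra.
(* This stretches [0, 1) to the half-line, on which piece k occupies [k, k + 1]; [fl t] is the
   number of the current piece. *)
pose tau (t : R) := t / (1 - t).
pose fl (t : R) := Num.truncn (tau t).
have tau_ge0 t : 0 <= t -> t < 1 -> 0 <= tau t by move=> h0 h1; rewrite divr_ge0 // subr_ge0 ltW.
have flP t : 0 <= t -> t < 1 -> (fl t)%:R <= tau t /\ tau t < (fl t).+1%:R.
  by move=> h0 h1; have := truncn_itv (tau_ge0 _ h0 h1) => /andP[].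
pose g t := if t < 1 then P (fl t).+1 (tau t) else x.
have gP t : 0 <= t -> t < 1 -> exists k s, [/\ k = fl t, 0 <= s, s < 1, s = tau t - k%:R & g t = lerp (X k) (X k.+1) s].
  move=> h0 h1; have [f1 f2] := flP _ h0 h1; exists (fl t), (tau t - (fl t)%:R); split=> //; first lra.
    by rewrite -natr1 in f2; lra.
  by rewrite /g h1 Pval // ltW.
exists g; split.
- move=> t /andP[t0 t1].
  have [tl|tg] := ltP t 1; last first.
    have E : t = 1 by lra.
    rewrite E => e e0; have [N HN] := Wcv e e0.
    (* A time s < 1 that is this close to 1 has [tau s >= N], so the path is on a piece, and by
       [st_ge] on a segment, whose number is at least N. *)
    exists (N%:R + 1)^-1; first by rewrite invr_gt0 ltr_wpDl.
    move=> s hs hd; have g1 : g 1 = x by rewrite /g ltxx.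
    rewrite g1; have [s0 s1] := andP hs.
    have [sl|sg] := ltP s 1; last first.
      have Es : s = 1 by lra.
      by rewrite Es g1 subrr nm0.
    have [k [u [Ek u0 u1 Eu ->]]] := gP s s0 sl.
    have hu : I01 u by apply/andP; split; lra.
    have [v [hv _ -> _]] := piece k u hu.
    apply: HN => //; apply: leq_trans (st_ge k).
    have Np : 0 < N%:R + 1 :> R by rewrite ltr_wpDl.
    have sp : 0 < 1 - s by lra.
    have : N%:R <= tau s.
      rewrite ler_pdivlMr //; move: hd; rewrite /dR distrC ger0_norm ?subr_ge0 // => hd.
      have : (1 - s) * (N%:R + 1) < 1 by rewrite -ltr_pdivlMr // div1r.
      by nra.
    by rewrite Ek -truncn_ge_nat // tau_ge0.
  have [f1 f2] := flP _ t0 tl.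
  pose n := (fl t).+1.
  have ctau : forall r, 0 < r -> exists2 s, 0 < s & forall q, I01 q -> dR q t < s -> q < 1 /\ dR (tau q) (tau t) < r.
    move=> r r0; have d0 : 0 < 1 - t by lra.
    pose m := Num.min ((1 - t) / 2) (r * (1 - t) ^+ 2 / 2).
    have m1 : m <= (1 - t) / 2 by rewrite ge_min lexx.
    have m2 : m <= r * (1 - t) ^+ 2 / 2 by rewrite ge_min lexx orbT.
    exists m; first by rewrite lt_min; apply/andP; split; [lra|rewrite divr_gt0 // mulr_gt0 // exprn_gt0].
    move=> q _; rewrite /dR => hd.
    have hq : (1 - t) / 2 < 1 - q by have := ler_norm (q - t); lra.
    have q1 : 0 < 1 - q by lra.
    split; first lra.
    rewrite (_ : _ - _ = (q - t) / ((1 - q) * (1 - t))); last by rewrite /tau; field; rewrite !gt_eqF.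
    rewrite normrM normfV [`|_ * (1 - t)|]ger0_norm ?mulr_ge0 ?ltW // ltr_pdivrMr ?mulr_gt0 //.
    apply: lt_le_trans hd (le_trans m2 _).
    rewrite (_ : r * (1 - t) ^+ 2 / 2 = r * ((1 - t) / 2 * (1 - t))); last by field.
    by rewrite ler_wpM2l ?(ltW r0) // ler_wpM2r ?(ltW d0) // ltW.
  move=> e e0; have [r r0 Hr] := Pcont n.+1 (tau t) (fun=> True) e e0.
  have rr : 0 < Num.min r 1 by rewrite lt_min r0 ltr01.
  have [s s0 Hs] := ctau _ rr; exists s => // q hq hd.
  have [q1 hq2] := Hs q hq hd; have [q0' _] := andP hq.
  move: hq2; rewrite lt_min => /andP[k1 k2].
  have [gq1 gq2] := flP _ q0' q1.
  rewrite /g q1 tl -(@Pstab (fl t).+1 n.+1 (tau t)) ?(ltW f2) //.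
  have tq : tau q <= n.+1%:R.
    have := ler_norm (tau q - tau t); move: k2; rewrite /dR => k2.
    by rewrite -natr1; move: f2; rewrite -/n; lra.
  have fq : ((fl q).+1 <= n.+2)%N.
    rewrite ltnS -(ler_nat R); lra.
  rewrite -(@Pstab (fl q).+1 n.+2 (tau q)) ?(ltW gq2) // (@Pstab n.+1 n.+2) //.
  exact: Hr.
- have xg t : 0 <= t -> t < 1 -> g t != x.
    move=> h0 h1; have [k [u [_ u0 u1 _ ->]]] := gP t h0 h1.
    have hu : I01 u by apply/andP; split; lra.
    by have [v [hv _ -> _]] := piece k u hu; apply: Wx.
  have tau_inj t s : t < 1 -> s < 1 -> tau t = tau s -> t = s.
    move=> h1 h2 /eqP; have n1 : 1 - t != 0 by rewrite gt_eqF // subr_gt0.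
    have n2 : 1 - s != 0 by rewrite gt_eqF // subr_gt0.
    by rewrite /tau eqr_div // => /eqP E; lra.
  have main t s : 0 <= t -> t < 1 -> 0 <= s -> s < 1 -> (fl t <= fl s)%N -> g t = g s -> t = s.
    move=> a0 a1 b0 b1; have [k [u [Ek u0 u1 Eu Et]]] := gP t a0 a1.
    have [l [v [El v0 v1 Ev Es]]] := gP s b0 b1.
    rewrite -Ek -El leq_eqVlt Et Es => /orP[/eqP E|kl] F.
      rewrite -E in Ev F; apply: tau_inj => //.
      by have := lerp_inj (Xneq k) F; lra.
    have hu : I01 u by apply/andP; split; lra.
    have hv : I01 v by apply/andP; split; lra.
    by have := cross k l u v kl hu hv F; lra.
  move=> t s /andP[t0 t1] /andP[s0 s1].
  have [a|a] := ltP t 1; have [b|b] := ltP s 1.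
  + have [h|/ltnW h] := leqP (fl t) (fl s); first exact: main.
    by move=> E; apply/esym; apply: main.
  + have Es : s = 1 by lra.
    rewrite Es; by rewrite [g 1]/g ltxx => E; have := xg t t0 a; rewrite E eqxx.
  + have Et : t = 1 by lra.
    rewrite Et; by rewrite [g 1]/g ltxx => E; have := xg s s0 b; rewrite -E eqxx.
  + by move=> _; lra.
- have [k [u [Ek u0 u1 Eu ->]]] := gP 0 (lexx _) ltr01.
  have t0 : tau 0 = 0 by rewrite /tau mul0r.
  have k0 : k = 0%N by rewrite Ek /fl t0 truncn0.
  by rewrite Eu k0 t0 subr0 lerp0.
- by rewrite /g ltxx.
- move=> t /andP[h0 h1]; have [k [u [_ u0 u1 _ ->]]] := gP t h0 h1.
  have hu : I01 u by apply/andP; split; lra.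
  by have [v [hv _ -> _]] := piece k u hu; exists (st k).1, v.
Qed.
End Plane.

(** * Vertices are accessible from the faces that touch them *)

Section Plane.
Variable R : realType.
Notation C := R[i].
Notation Re := (@complex.Re R).
Notation Im := (@complex.Im R).
Notation "x %:c" := (real_complex R x) (at level 1, format "x %:c").
Implicit Types (x y z w : C) (t s : R).

Lemma joined_in_ball (O : C -> Prop) x (e : R) z w : (forall w, O w -> nm (w - x) != e) ->
  joined O z w -> nm (z - x) < e -> nm (w - x) < e.
Proof.
move=> Oe zw; apply: (@joined_ind _ O (fun w => nm (w - x) < e) _ _ _ zw) => u v uv hu.
pose D t := nm (lerp u v t - x) < e.
suff : D 1 by rewrite /D lerp1.
apply: (@locconst _ D) (@I01_1 R); last by rewrite /D lerp0.
move=> t ht; have := Oe _ (uv t ht); have := nm_ge0 (lerp u v t - x).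
set m := nm (lerp u v t - x) => m0 me.
have r0 : 0 < `|m - e| by rewrite normr_gt0 subr_eq0.
have [r r1 Hr] := @cAt_lerp _ (@I01 R) u v t _ r0.
exists r => // s hs hst; rewrite /D -/m; have {Hr} := Hr s hs hst.
have h1 := nm_tri (lerp u v t) (lerp u v s) x.
have h2 := nm_tri (lerp u v s) (lerp u v t) x.
rewrite -/m in h1 *; rewrite -/m in h2 *; rewrite [nm (lerp u v t - _)]nmB in h2.
have [hm|hm|/eqP E] := ltgtP m e; last by rewrite E in me.
  have -> : `|m - e| = e - m by rewrite distrC gtr0_norm // subr_gt0.
  by move=> h3; split=> // _; lra.
have -> : `|m - e| = m - e by rewrite gtr0_norm // subr_gt0.
by move=> h3; split=> // h4; lra.
Qed.

Section Faces.
Variables (V : finType) (G : pgraph R V).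
Implicit Types (a b c : V).
Notation p := (pp G).
Notation γ := (gam G).

Notation free := (free G).
Notation touch := (touch G).

(* Near a vertex, the side of each incident edge on which a point lies is recorded by the sign of
   a square root; two free points with the same signs are joined near the vertex. *)
Lemma vert_loc (u : V) (e : R) : 0 < e -> exists (d : R) (col : C -> {ffun V -> bool}), 0 < d /\
  forall z z', nm (z - p u) < d -> nm (z' - p u) < d -> free z -> free z' -> col z = col z' ->
    joined (fun w => free w /\ nm (w - p u) < e) z z'.
Proof.
move=> e0; set x := p u; have [I0 I1] := (@I01_0 R, @I01_1 R).
have /choice[τ Hτ] (v : V) : exists τ : R, G v u -> 0 < τ < 1 /\ forall t, τ <= t <= 1 -> nm (γ v u t - x) < e.
  have [vu|nvu] := boolP (G v u); last by exists 0.
  have [r r0 Hr] := gam_con vu I1 e0; rewrite gam1 // in Hr.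
  exists (Num.max (1 / 2) (1 - r / 2)) => _; split; first by rewrite lt_max gt_max; apply/andP; split; [apply/orP; left|apply/andP; split]; lra.
  move=> t; rewrite ge_max => /andP[/andP[h1 h2] h3]; apply: Hr; first by apply/andP; split; lra.
  by rewrite /dR ltr_norml; apply/andP; split; lra.
pose h v := sub (γ v u) (τ v) 1; pose h' v := sub (γ v u) 0 (τ v).
have Iτ v : G v u -> I01 (τ v) by case/Hτ => /andP[h1 h2] _; apply/andP; split; lra.
have ch v : G v u -> pcon (h v) by move=> vu; apply: pcon_sub => //; [exact: Iτ|exact: gam_con].
have ch' v : G v u -> pcon (h' v) by move=> vu; apply: pcon_sub => //; [exact: Iτ|exact: gam_con].
have h1 v : G v u -> h v 1 = x by move=> vu; rewrite /h sub1 gam1.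
have h0 v : h v 0 = γ v u (τ v) by rewrite /h sub0.
have h'1 v : h' v 1 = γ v u (τ v) by rewrite /h' sub1.
have key v (w : V) t : G v u -> I01 t -> 0 < t -> γ v u t = p w -> t = 1.
  move=> vu ht t0 E; have [Ew|Ew] := gam_pt vu ht E; rewrite Ew in E; last first.
    by apply: (gam_inj vu) => //; rewrite gam1.
  have : t = 0 by apply: (gam_inj vu) => //; rewrite gam0.
  by move=> t00; rewrite t00 ltxx in t0.
have set_v (v v' : V) : G v u -> v != v' -> [set v; u] != [set v'; u].
  by move=> vu vv'; apply: set_neq => //; exact: adj_neq vu.
pose E1 w := exists ab : V * V, [/\ G ab.1 ab.2, (u != ab.1) && (u != ab.2) & img (γ ab.1 ab.2) w].
(* The part of the drawing away from x, together with the circle of radius e, which keeps the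
   joining polygon inside the disc. *)
pose K1 w := nm (w - x) = e \/ ((exists v : V, v != u /\ w = p v) \/ (E1 w \/ exists i : {v : V | G v u}, img (h' (val i)) w)).
have cK1 : closedK K1.
  apply: closed_or.
    move=> z nz; exists (`|nm (z - x) - e|); first by rewrite normr_gt0 subr_eq0; apply/eqP.
    move=> w hw E; have ha := nm_tri z w x; have hb := nm_tri w z x; rewrite E in ha hb.
    rewrite [nm (z - w)]nmB in hb; move: hw; rewrite ltNge ler_norml => /negP; apply.
    by apply/andP; split; lra.
  apply: closed_or.
    apply: (@closed_union _ _ (fun (v : V) w => v != u /\ w = p v)) => v w nw.
    have [vu|vu] := boolP (v != u); last by exists 1 => // ? _ [].
    have [|r r0 Hr] := @closed_pt _ (p v) w; first by move=> h2; apply: nw.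
    by exists r => // w' /Hr h2 [].
  apply: closed_or; last by apply: closed_union => -[v vu]; apply/closed_img/ch'.
  apply: (@closed_union _ _ (fun ab w => [/\ G ab.1 ab.2, (u != ab.1) && (u != ab.2) & img (γ ab.1 ab.2) w])) => -[a b] /= w nw.
  have [ab|nab] := boolP (G a b && ((u != a) && (u != b))); last by exists 1 => // w' _ [h2 h3]; rewrite h2 h3 in nab.
  case/andP: ab => ab eab; have [|r r0 Hr] := @closed_img _ _ (gam_con ab) w; first by move=> h2; apply: nw.
  by exists r => // w' /Hr h2 [_ _].
have bK1 : bddK K1.
  apply: bdd_or; first by exists (e + nm x) => w hw; have := nmD (w - x) x; rewrite subrK hw.
  have [M HM] := @bdd_Gs _ _ G (fun _ _ => true).
  apply: bdd_or; first by exists M => w [v [_ ->]]; apply: HM; left; exists v.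
  apply: bdd_or; first by exists M => w [ab [ab1 _ hw]]; apply: HM; right; exists ab.
  by apply: bdd_union => -[v vu]; apply/bdd_img/ch'.
have nK1x : ~ K1 x.
  case=> [|[[v [vu E]]|[[[a b] /= [ab /andP[ua ub] [t ht E]]]|[[v vu] /= [t ht E]]]]].
  - by rewrite subrr nm0 => E; rewrite E ltxx in e0.
  - by rewrite (pp_inj E) eqxx in vu.
  - by have [Eu|Eu] := gam_pt ab ht (esym E); rewrite Eu eqxx in ua ub.
  - have [/andP[t0 t1] _] := Hτ v vu; have [s0 s1] := andP ht.
    have hI : I01 (0 + t * (τ v - 0)) by apply: I01_sub => //; apply: Iτ.
    have := gam_inj vu hI I1; rewrite gam1 // -[γ v u _]/(h' v t) -E => /(_ erefl).
    have : t * τ v <= τ v by rewrite ler_piMl // ltW.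
    by rewrite subr0 add0r; lra.
have [d1 d10 Hd1] := cK1 x nK1x.
have Kd w : K1 w -> d1 <= nm (w - x) by move=> Kw; rewrite leNgt; apply/negP => /Hd1.
(* When v is adjacent to u and z is free and close to x, both sides have the square x - z, so the
   test records a sign. If z and z' agree on it, the product of the two left sides is the root k
   prescribed at x, which is the matching condition along [h v]. *)
pose col z := [ffun v => sqrtc (h v 0 - x) * br (h v 0) x z * rho (h v) z == sqrtc (x - z)].
exists (Num.min d1 e), col; split; first by rewrite lt_min d10 e0.
move=> z z'; rewrite !lt_min => /andP[zd ze] /andP[z'd z'e] fz fz' colE.
have nx w : free w -> w != x by move=> fw; apply/eqP => E; apply: fw; rewrite E; exact: G_pt.
have offh v w : G v u -> free w -> off (h v) w.
  move=> vu fw; apply/off_img => -[s hs E]; apply: fw; rewrite E; apply: (G_edge vu).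
  by exists (τ v + s * (1 - τ v)) => //; apply: I01_sub => //; exact: Iτ.
pose K0 w := w = x \/ K1 w; pose k := sqrtc (x - z) * sqrtc (x - z').
pose f w := if w == x then k else fsq x z z' w.
have sig (v : V) (vu : G v u) : exists i : {v : V | G v u}, val i = v by exists (exist _ v vu).
have subE v t : G v u -> I01 t -> [/\ I01 (τ v + t * (1 - τ v)), 0 < τ v + t * (1 - τ v) & τ v <= τ v + t * (1 - τ v) ].
  move=> vu ht; have [/andP[t0 t1] _] := Hτ v vu; split; first by apply: I01_sub => //; exact: Iτ.
    by have [s0 s1] := andP ht; rewrite ltr_pwDl // mulr_ge0 // subr_ge0 ltW.
  by have [s0 s1] := andP ht; rewrite lerDl mulr_ge0 // subr_ge0 ltW.
have t1E v t : G v u -> τ v + t * (1 - τ v) = 1 -> t = 1.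
  move=> vu E; have [/andP[t0 t1] _] := Hτ v vu; have n0 : 1 - τ v != 0 by rewrite subr_eq0 gt_eqF.
  by apply: (mulIf n0); rewrite mul1r -[in RHS]E; ring.
have meet v v' t s : G v u -> G v' u -> I01 t -> 0 < t -> I01 s -> v != v' -> γ v u t = γ v' u s -> t = 1.
  move=> vu v'u ht t0 hs vv' E; have [w Ew] := gam_cross vu v'u (set_v _ _ vu vv') ht hs E.
  exact: key Ew.
pose I := {v : V | G v u}; pose hh (i : I) := h (val i).
have J : joined (fun w => ~ (K0 w \/ exists i : I, img (hh i) w)) z z'.
  apply: (@joined_glue _ _ K0 hh f).
  - apply: closed_or => //; exact: closed_pt.
  - by apply: bdd_or => //; exists (nm x) => w ->.
  - by case=> v vu; exact: ch.
  - case=> v vu t s ht hs; have [It _ _] := subE v t vu ht; have [Is _ _] := subE v s vu hs.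
    have [/andP[_ t1] _] := Hτ v vu; have n0 : 1 - τ v != 0 by rewrite subr_eq0 gt_eqF.
    by move/(gam_inj vu It Is)/addrI/(mulIf n0).
  - by case=> [E|/Hd1 //]; move: (nx z fz); rewrite E eqxx.
  - by case=> [E|/Hd1 //]; move: (nx z' fz'); rewrite E eqxx.
  - by case=> v vu; apply: offh.
  - by case=> v vu; apply: offh.
  - move=> w [->|Kw].
      apply: (@cAt_ext _ _ _ _ (fun=> k) f x d1) => //; last exact: cAt_cst.
        by rewrite /f eqxx.
      move=> q [->|Kq hq]; first by rewrite /f eqxx.
      by have := Kd q Kq; rewrite leNgt hq.
    have wx : 0 < nm (w - x) by apply: lt_le_trans (Kd w Kw).
    have wx' : w != x by rewrite -subr_eq0 -nm_gt0.
    apply: (@cAt_ext _ _ _ _ (fsq x z z') f w (nm (w - x))) => //; first by rewrite /f (negbTE wx').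
      move=> q _; rewrite /dC /f => hq; case: eqP => // E; rewrite E nmB ltxx in hq.
      by [].
    by apply: fsq_con; apply: lt_le_trans (Kd w Kw).
  - move=> w [->|Kw]; first by rewrite /f eqxx /k exprMn !sqr_sqrtc.
    have wx' : w != x by apply/eqP => E; rewrite E in Kw.
    by rewrite /f (negbTE wx'); apply: fsq_sq; apply: lt_le_trans (Kd w Kw).
  - case=> v vu; right; right; right; right; exists (exist _ v vu); exists 1 => //=.
    by rewrite h'1 /hh h0.
  - by case=> v vu; left; rewrite /hh h1.
  - case=> v vu t ht; rewrite /hh /= => -[E|[E|[[w [wu E]]|[[[a b] /= [ab /andP[ua ub] [s hs E]]]|[[v' v'u] /= [s hs E]]]]]].
    + have [It pt _] := subE v t vu ht; right; apply: (t1E v) => //; exact: key E.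
    + have [_ Hn] := Hτ v vu; have [It _ lt] := subE v t vu ht; have := Hn (τ v + t * (1 - τ v)).
      rewrite lt; have [_ ->] := andP It; rewrite -[γ v u _]/(h v t) E ltxx => /(_ isT) //.
    + have [It pt _] := subE v t vu ht; right; apply: (t1E v) => //; exact: key E.
    + have [It pt _] := subE v t vu ht; right; apply: (t1E v) => //.
      have ne : [set v; u] != [set a; b] by rewrite finset.setUC; apply: set_neq.
      by have [w Ew] := gam_cross vu ab ne It hs E; exact: key Ew.
    + have [It pt le] := subE v t vu ht; have [vv'|vv'] := eqVneq v v'; last first.
        right; apply: (t1E v) => //; apply: (meet v v' _ (0 + s * (τ v' - 0))) => //.
        by apply: I01_sub => //; exact: Iτ.
      left; subst v'; have Is : I01 (0 + s * (τ v - 0)) by apply: I01_sub => //; exact: Iτ.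
      have := gam_inj vu It Is E; rewrite subr0 add0r.
      have [/andP[t0 t1] _] := Hτ v vu; have [s0 s1] := andP hs; have [r0 r1] := andP ht => E2.
      have : s * τ v <= τ v by rewrite ler_piMl // ltW.
      rewrite -E2 => E3; have E4 : t * (1 - τ v) <= 0 by lra.
      apply/eqP; rewrite eq_le r0 andbT leNgt; apply/negP => t00.
      by move: E4; apply/negP; rewrite -ltNge mulr_gt0 // subr_gt0.
  - case=> v vu [v' v'u] t s ht hs /= E; have [It pt _] := subE v t vu ht; have [Is _ _] := subE v' s v'u hs.
    have [vv'|vv'] := eqVneq v v'; first by left; apply: val_inj.
    by right; left; rewrite /hh /= (t1E v t vu (meet _ _ _ _ vu v'u It pt Is vv' E)) h1.
  - case=> v vu; rewrite /hh /=.
    have K1h : K1 (h v 0) by right; right; right; exists (exist _ v vu); exists 1 => //=; rewrite h'1 h0.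
    have hx : h v 0 != x by apply/eqP => E; rewrite E in K1h.
    rewrite h1 // /f eqxx (negbTE hx).
    have hz : nm (z - x) < nm (h v 0 - x) by apply: lt_le_trans (Kd _ K1h).
    have hz' : nm (z' - x) < nm (h v 0 - x) by apply: lt_le_trans (Kd _ K1h).
    have sq (w : C) : free w -> nm (w - x) < nm (h v 0 - x) ->
        (sqrtc (h v 0 - x) * br (h v 0) x w * rho (h v) w) ^+ 2 = sqrtc (x - w) ^+ 2.
      move=> fw hw; rewrite 2!exprMn br_sq // rho_sq //; [|exact: ch|exact: offh].
      rewrite !sqr_sqrtc h1 //.
      have n1 : h v 0 - x != 0 by rewrite subr_eq0.
      have n2 : h v 0 - w != 0 by rewrite subr_eq0; apply: offh.
      by field; rewrite n1 n2.
    have /sqr_sign A := sq z fz hz; have /sqr_sign B := sq z' fz' hz'.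
    have {colE} /ffunP/(_ v) := colE; rewrite !ffunE => cE.
    have P : fsq x z z' (h v 0) * rho (h v) z * rho (h v) z' = (sqrtc (h v 0 - x) * br (h v 0) x z * rho (h v) z) * (sqrtc (h v 0 - x) * br (h v 0) x z' * rho (h v) z').
      rewrite /fsq -[in LHS](sqr_sqrtc (h v 0 - x)); ring.
    rewrite P; case: A cE => [->|A]; first by rewrite eqxx => /esym/eqP ->.
    have n0 (w : C) : free w -> sqrtc (x - w) != 0.
      by move=> fw; apply: sq_neq0; rewrite sqr_sqrtc subr_eq0 eq_sym nx.
    have -> : (sqrtc (h v 0 - x) * br (h v 0) x z * rho (h v) z == sqrtc (x - z)) = false.
      rewrite A; apply/negbTE; rewrite eq_sym -subr_eq0 opprK -mulr2n mulrn_eq0 /=; exact: n0.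
    case: B => [->|->]; first by rewrite eqxx.
    by rewrite A mulrNN.
apply: joined_along J => w zw; split.
  have nw := joinedr zw => Gw; apply: nw.
  have inc v t : G v u -> I01 t -> K0 (γ v u t) \/ exists i : I, img (hh i) (γ v u t).
    move=> vu ht; have [/andP[t0 t1] _] := Hτ v vu; have [s0 s1] := andP ht; have [k1|/ltW k1] := leP t (τ v).
      left; right; right; right; right; exists (exist _ v vu); exists (t / τ v); first exact: frac_I01.
      by rewrite /h' /sub /= subr0 add0r divfK ?gt_eqF.
    right; exists (exist _ v vu); exists ((t - τ v) / (1 - τ v)); first by apply: frac_I01; lra.
    by rewrite /hh /h /sub /= divfK ?subr_eq0 ?(gt_eqF t1) // (addrC (τ v)) subrK.
  case: Gw => [[v ->]|[[a b] /= [ab _ hw]]].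
    by have [->|vu] := eqVneq v u; [left; left|left; right; right; left; exists v].
  have [Ea|ua] := eqVneq u a.
    subst a; have /img_sym := hw; move=> /(_ ab) [t ht ->].
    by apply: inc => //; rewrite adjC.
  have [Eb|ub] := eqVneq u b; first by subst b; case: hw => t ht ->; apply: inc.
  by left; right; right; right; left; exists (a, b); split=> //=; rewrite ua.
apply: joined_in_ball zw ze => w' nw'; apply/eqP => E; apply: nw'; left; right; left.
exact: E.
Qed.

(** The notion of [touch] with an arbitrary set O in place of [free]; in [access] the sets O shrink
    towards the vertex. *)
Definition acc (O : C -> Prop) x z := forall e, 0 < e -> exists2 z', joined O z z' & nm (z' - x) < e.

(** There are finitely many sign patterns, so one of them is taken arbitrarily close to u by points
    joined to z; by [vert_loc] such points near u are joined to each other within distance e of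
    u. *)
Lemma acc_step (O : C -> Prop) (u : V) z (e : R) : (forall w, O w -> free w) -> acc O (p u) z -> 0 < e ->
  exists z', joined O z z' /\ acc (fun w => free w /\ nm (w - p u) < e) (p u) z'.
Proof.
move=> Of az e0; have [d [col [d0 H]]] := vert_loc u e0.
have [k Hk] : exists k, forall r, 0 < r -> exists z', [/\ joined O z z', nm (z' - p u) < r & col z' = k].
  apply: contrapT => nk.
  have [k r s|k|r r0 Hr] := @fin_min _ _ (fun k r => forall z', joined O z z' -> nm (z' - p u) < r -> col z' <> k).
  - by move=> h sr s0 z' zz' hz'; apply: h => //; apply: lt_le_trans sr.
  - apply: contrapT => nr; apply: nk; exists k => r r0; apply: contrapT => nz; apply: nr.
    by exists r => // z' zz' hz' Ek; apply: nz; exists z'.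
  by have [z' zz' hz'] := az r r0; apply: (Hr (col z') z').
have [z' [zz' hz' cz']] := Hk d d0; exists z'; split=> // e' e'0.
have [|z2 [zz2 ]] := Hk (Num.min d e'); first by rewrite lt_min d0.
rewrite lt_min => /andP[h1 h2] cz2; exists z2 => //; apply: H => //; last by rewrite cz2.
  exact/Of/(joinedr zz').
exact/Of/(joinedr zz2).
Qed.

(** Repeating [acc_step] with radii 1 / (m + 1) gives polygons that follow one another in shrinking
    discs. Together they form an infinite polygon that converges to the vertex, and [ray] extracts
    an arc. *)
Lemma access (u : V) z : touch z (p u) -> exists g, [/\ pcon g, inj01 g, g 0 = z, g 1 = p u &
  forall t, 0 <= t < 1 -> free (g t)].
Proof.
(* The first polygon is not confined to a disc, because z may be far from the vertex. *)
move=> tz; pose Ob (n : nat) w := if n is m.+1 then free w /\ nm (w - p u) < m.+1%:R^-1 else free w.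
have Obf n w : Ob n w -> free w by case: n => [|n] //= [].
have /choice[nx Hnx] : forall nz : nat * C, exists z', acc (Ob nz.1) (p u) nz.2 ->
    joined (Ob nz.1) nz.2 z' /\ acc (Ob nz.1.+1) (p u) z'.
  move=> [n y] /=; have [a|na] := pselect (acc (Ob n) (p u) y); last by exists 0.
  have e0 : 0 < n.+1%:R^-1 :> R by rewrite invr_gt0 ltr0n.
  by have [z' hz'] := acc_step (@Obf n) a e0; exists z'.
pose Z := fix Z n := if n is m.+1 then nx (m, Z m) else z.
have aZ n : acc (Ob n) (p u) (Z n).
  by elim: n => [|n IH] //=; have [] := Hnx (n, Z n) IH.
have jZ n : joined (Ob n) (Z n) (Z n.+1) by have [] := Hnx (n, Z n) (aZ n).
have /choice[len /choice[v Hv]] := jZ.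
(* The i-th segment of the concatenation is segment number [(st i).2] of polygon number [(st i).1];
   polygon n has [len n + 1] segments. *)
pose st := fix st i := if i is m.+1 then let q := st m in if (q.2 < len q.1)%N then (q.1, q.2.+1) else (q.1.+1, 0%N) else (0%N, 0%N).
have st_le i : ((st i).2 <= len (st i).1)%N by elim: i => [|i IH] //=; case: ifP.
have st1 i j : (i <= j)%N -> ((st i).1 <= (st j).1)%N.
  move/subnK <-; elim: (j - i)%N => [|k IH] //; rewrite addSn /=.
  by case: ifP => _ //=; apply: leq_trans IH _.
have reach n : exists i, st i = (n, 0%N).
  elim: n => [|n [i Ei]]; first by exists 0%N.
  have h j : (j <= len n)%N -> st (j + i)%N = (n, j).
    by elim: j => [|j IH] hj //; rewrite addSn /= IH ?(ltnW hj) //= hj.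
  by exists (len n + i).+1; rewrite /= h //= ltnn.
pose W i := v (st i).1 (st i).2.
have W1 i : W i.+1 = v (st i).1 (st i).2.+1.
  rewrite /W /=; case: ifP => //= /negbT; rewrite -leqNgt => hl.
  have /eqP E : (st i).2 == len (st i).1 by rewrite eqn_leq hl st_le.
  have [_ e2 _] := Hv (st i).1; have [e1 _ _] := Hv (st i).1.+1; by rewrite e1 E e2.
have seg i t : I01 t -> Ob (st i).1 (lerp (W i) (W i.+1) t).
  by move=> ht; rewrite W1; have [_ _] := Hv (st i).1; apply; first exact: st_le.
have [i t ht|e e0|g [cg ig g0 g1 gs]] := @ray _ W (p u).
- by apply/eqP => E; have /Obf := seg i t ht; apply; rewrite E; exact: G_pt.
- have [n hn] := archN e0; have [N EN] := reach n.+1.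
  exists N => i t /st1; rewrite EN /= => hi ht; have := seg i t ht.
  case: (st i).1 hi => // m; rewrite ltnS => nm' [_ /lt_le_trans]; apply; apply: le_trans (ltW hn).
  by rewrite lef_pV2 ?posrE ?ltr0n // ler_nat.
exists g; split=> //; first by rewrite g0; have [] := Hv 0%N.
by move=> t /gs[i [s [hs ->]]]; exact/Obf/seg.
Qed.

(** Arcs α and β lead from z to the two vertices. At the last time T at which β meets α, the part of
    α from [p u] back to the meeting point continues with the rest of β, without a further
    meeting. *)
Lemma new_arc (u v : V) z : touch z (p u) -> touch z (p v) -> u != v ->
  exists g, [/\ pcon g, inj01 g, g 0 = p u, g 1 = p v & forall t, 0 < t < 1 -> free (g t)].
Proof.
move=> /access[α [ca ia a0 a1 fa]] /access[β [cb ib b0 b1 fb]] uv.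
have [I0 I1] := (@I01_0 R, @I01_1 R).
have [|t ht nt|T [hT [S hS ES] TM]] := @last_time _ (fun t => img α (β t)).
- by exists 0; split=> //; exists 0 => //; rewrite a0 b0.
- have [r r0 Hr] := closed_img ca nt; have [s s0 Hs] := cb t ht r r0.
  by exists s => // t' ht' htt'; apply: Hr; apply: Hs.
have lt1 t : I01 t -> t != 1 -> 0 <= t < 1 by move=> /andP[h0 h1] n1; rewrite h0 lt_neqAle n1.
have npf (w : V) : ~ free (p w) by apply; exact: G_pt.
have S1 : S != 1.
  apply/eqP => E; rewrite E a1 in ES; have [T1|T1] := eqVneq T 1.
    by rewrite T1 b1 in ES; rewrite (pp_inj ES) eqxx in uv.
  by have := fb T (lt1 T hT T1); rewrite ES; apply: npf.
have T1 : T != 1.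
  by apply/eqP => E; rewrite E b1 in ES; have := fa S (lt1 S hS S1); rewrite -ES; apply: npf.
have [S0 Sl] := andP (lt1 S hS S1); have [T0 Tl] := andP (lt1 T hT T1).
pose f := sub α 1 S; pose k := sub β T 1.
have fk : f 1 = k 0 by rewrite /f /k sub1 sub0.
have fE t : I01 t -> I01 (1 + t * (S - 1)) by move=> ht; apply: I01_sub.
have kE t : I01 t -> I01 (T + t * (1 - T)) by move=> ht; apply: I01_sub.
exists (cat f k); split.
- by apply: pcon_cat; apply: pcon_sub.
- apply: inj_cat => //.
  + move=> t s ht hs /(ia _ _ (fE t ht) (fE s hs)) /addrI; apply: mulIf.
    by rewrite subr_eq0.
  + move=> t s ht hs /(ib _ _ (kE t ht) (kE s hs)) /addrI; apply: mulIf.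
    by rewrite subr_eq0 eq_sym.
  move=> t s ht hs E.
  have := TM _ (kE s hs) (ex_intro2 _ _ _ (fE t ht) (esym E)).
  rewrite gerDl => h; have [s0 s1] := andP hs; apply/eqP; rewrite eq_le s0 andbT.
  by rewrite -(pmulr_lle0 s (_ : 0 < 1 - T)) ?subr_gt0 // mulrC.
- by rewrite cat0 // /f sub0.
- by rewrite cat1 /k sub1.
move=> t /andP[t0 t1]; have [h|/ltW h] := leP t (1 / 2).
  rewrite catl // cl_id; last by apply/andP; split; lra.
  apply: fa; have it : I01 (2 * t) by apply/andP; split; lra.
  have /andP[-> _] := fE _ it; rewrite /= gtrDl pmulr_rlt0 ?subr_lt0 //; lra.
have it : I01 (2 * t - 1) by apply/andP; split; lra.
rewrite catr // cl_id //; apply: fb; have /andP[-> _] := kE _ it.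
by rewrite /= -ltrBrDl gtr_pMl ?subr_gt0 //; lra.
Qed.
End Faces.
End Plane.

(** * Faces touching only pairwise adjacent vertices *)

Section Plane.
Variable R : realType.
Notation C := R[i].
Notation Re := (@complex.Re R).
Notation Im := (@complex.Im R).
Notation "x %:c" := (real_complex R x) (at level 1, format "x %:c").
Implicit Types (x y z w : C) (t s : R).

Section Faces.
Variables (V : finType) (G : pgraph R V).
Implicit Types (a b c : V).
Notation p := (pp G).
Notation γ := (gam G).

Notation free := (free G).
Notation touch := (touch G).
Notation Tset := (Tset G).
Notation Wt := (Wt G).
Notation tri := (tri G).

Lemma pt_notT a b c u : tri a b c -> u \notin [set a; b; c] -> ~ Tset a b c (p u).
Proof.
move=> /and3P[ab bc ca]; rewrite !inE !negb_or => /andP[/andP[ua ub] uc].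
by apply/not_Tset; split; apply: pt_off.
Qed.

Lemma tri_in a b c : tri a b c -> [/\ a \in [set a; b; c], b \in [set a; b; c] & c \in [set a; b; c]].
Proof. by move=> _; rewrite !inE !eqxx !orbT. Qed.

Lemma Tset_edge a b c u v w : tri a b c -> u \in [set a; b; c] -> v \in [set a; b; c] -> G u v ->
  img (γ u v) w -> Tset a b c w.
Proof.
move=> /and3P[ab bc ca]; rewrite !inE -!orbA.
case/or3P=> /eqP -> /or3P[] /eqP -> uv; rewrite ?adj_irr // in uv; move=> hw.
- exact: Or31.
- by apply: Or33; apply: img_sym.
- by apply: Or31; apply: img_sym.
- exact: Or32.
- exact: Or33.
- by apply: Or32; apply: img_sym.
Qed.

Lemma Tset_pt a b c v : tri a b c -> v \in [set a; b; c] -> Tset a b c (p v).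
Proof.
move=> T; have [ab bc ca] := and3P T; have [I0 I1] := (@I01_0 R, @I01_1 R).
rewrite !inE -!orbA => /or3P[] /eqP ->.
- by apply: Or31; exists 0 => //; rewrite gam0.
- by apply: Or32; exists 0 => //; rewrite gam0.
- by apply: Or33; exists 0 => //; rewrite gam0.
Qed.

Lemma free_notT a b c z : tri a b c -> free z -> ~ Tset a b c z.
Proof. by move=> /and3P[ab bc ca] fz [] hw; apply: fz; apply: G_edge hw. Qed.

(** An edge starting off the triangle can meet it only at a vertex of the triangle, hence only at
    its own end y, and that is excluded by the last hypothesis. *)
Lemma edge_side a b c (x y : V) s : tri a b c -> G x y -> x \notin [set a; b; c] -> I01 s ->
  ~ Tset a b c (γ x y s) -> Wt a b c (γ x y s) = Wt a b c (p x).
Proof.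
move=> T xy xT hs nT; have [ab bc ca] := and3P T; have [I0 I1] := (@I01_0 R, @I01_1 R).
have hss t : I01 t -> I01 (0 + t * (s - 0)) by move=> ht; apply: I01_sub.
have key (u v : V) t : u \in [set a; b; c] -> v \in [set a; b; c] -> G u v -> I01 t -> img (γ u v) (sub (γ x y) 0 s t) -> False.
  move=> uT vT uv ht [t' ht' E].
  have ne : [set x; y] != [set u; v].
    by apply: set_neq; apply: contraNneq xT => ->.
  have [w Ew] := gam_cross xy uv ne (hss t ht) ht' E.
  have Ew' := Ew; rewrite -[γ x y _]/(sub (γ x y) 0 s t) E in Ew'.
  have wT : w \in [set a; b; c] by have [->|->] := gam_pt uv ht' Ew'.
  have [Ex|Ey] := gam_pt xy (hss t ht) Ew; first by rewrite Ex in wT; rewrite wT in xT.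
  have t1 : 0 + t * (s - 0) = 1 by apply: (gam_inj xy); [exact: hss|exact: I1|rewrite gam1 // Ew Ey].
  have s1 : s = 1.
    have [? ?] := andP hs; have [? ?] := andP ht; have : t * s <= s by rewrite ler_piMl.
    by rewrite subr0 add0r in t1; lra.
  by apply: nT; rewrite s1 gam1 // -Ey; apply: Tset_pt.
have [aT bT cT] := tri_in T.
have := @Wt_path _ _ _ a b c (sub (γ x y) 0 s) T _ _ 1 I1.
rewrite sub1 sub0 (gam0 xy); apply; first by apply: pcon_sub => //; exact: gam_con.
by move=> t ht [] /key; apply.
Qed.

Lemma side_edge a b c (u v : V) : tri a b c -> G u v -> u \notin [set a; b; c] -> v \notin [set a; b; c] ->
  Wt a b c (p u) = Wt a b c (p v).
Proof.
move=> T uv ut vt; have := @edge_side a b c u v 1 T uv ut (@I01_1 R).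
by rewrite gam1 // => ->//; apply: pt_notT.
Qed.

(** The vertices of the second triangle off the first are adjacent to each other, and every edge of
    it that leaves the first has an end among them. *)
Lemma side_T a b c a' b' c' x : tri a b c -> tri a' b' c' -> a' \notin [set a; b; c] ->
  Tset a' b' c' x -> ~ Tset a b c x -> Wt a b c x = Wt a b c (p a').
Proof.
move=> T /and3P[ab bc ca] aT xT nx.
have ac : G a' c' by rewrite adjC.
have es (u v : V) : G u v -> u \notin [set a; b; c] -> img (γ u v) x -> Wt a b c x = Wt a b c (p u).
  by move=> uv uT [s hs E]; rewrite E; apply: edge_side => //; rewrite -E.
case: xT => hx; [exact: es hx| |by apply: (es a' c') => //; apply: img_sym].
have [bT|bT] := boolP (b' \in [set a; b; c]); last by rewrite (es _ _ bc bT hx) (side_edge T ab).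
have [cT|cT] := boolP (c' \in [set a; b; c]); first by case: nx; apply: Tset_edge hx.
have cb : G c' b' by rewrite adjC.
by rewrite (es _ _ cb cT (img_sym bc hx)) (side_edge T ac).
Qed.

Lemma tri_rot a b c : tri a b c -> tri b c a. Proof. by case/and3P=> h1 h2 h3; apply/and3P. Qed.
Lemma Tset_rot a b c w : Tset a b c w -> Tset b c a w.
Proof. by case=> h; [apply: Or33|apply: Or31|apply: Or32]. Qed.
Lemma Wt_rot a b c w : Wt b c a w = Wt a b c w. Proof. by rewrite /Wt; ring. Qed.
Lemma set3_rot a b c : [set b; c; a] = [set a; b; c] :> {set V}.
Proof. by apply/setP => x; rewrite !inE orbC orbA. Qed.

Lemma side_T' a b c a' b' c' (m : V) x : tri a b c -> tri a' b' c' -> m \in [set a'; b'; c'] ->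
  m \notin [set a; b; c] -> Tset a' b' c' x -> ~ Tset a b c x -> Wt a b c x = Wt a b c (p m).
Proof.
move=> T T'; rewrite finset.in_setU in_set2 finset.in_set1 -orbA => /or3P[] /eqP -> mT xT.
- exact: (side_T T T').
- exact: (side_T T (tri_rot T') mT (Tset_rot xT)).
- exact: (side_T T (tri_rot (tri_rot T')) mT (Tset_rot (Tset_rot xT))).
Qed.

(** All of abc off the triangle S = vwt lies on the side of m. The other side of S, which contains
    y, therefore avoids abc; it is connected by [tri_join] and comes arbitrarily close to the middle
    of the edge vw, which is on the side of v with respect to abc. *)
Lemma nested1 (v w t a b c m y : V) : tri v w t -> tri a b c -> v \notin [set a; b; c] ->
  m \in [set a; b; c] -> m \notin [set v; w; t] -> y \notin [set v; w; t] -> y \notin [set a; b; c] ->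
  Wt v w t (p y) != Wt v w t (p m) -> Wt a b c (p y) = Wt a b c (p v).
Proof.
move=> S T vT mT mS yS yT ne; have [vw wt tv] := and3P S.
have t01 : 0 < (1 / 2 : R) < 1 by apply/andP; split; lra.
have ht : I01 (1 / 2 : R) by apply/andP; split; lra.
have nT : ~ Tset a b c (γ v w (1 / 2)).
  have key (x x' : V) : x \in [set a; b; c] -> x' \in [set a; b; c] -> G x x' -> ~ img (γ x x') (γ v w (1 / 2)).
    move=> xT x'T xx' hx; apply: (edge_inner vw t01); right; exists (x, x'); split=> //=.
    by rewrite eq_sym; apply: set_neq; apply: contraNneq vT => ->.
  by have [ab bc ca] := and3P T; have [aT bT cT] := tri_in T; case; apply: key.
have [r r0 Hr] := closed_Tset T nT.
have [z [z' [hz hz' nz nz' zne]]] := tri_near S t01 r0.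
have [z0 [hz0 nz0 E0]] : exists z0, [/\ nm (z0 - γ v w (1 / 2)) < r, ~ Tset v w t z0 & Wt v w t z0 = Wt v w t (p y)].
  by have [E|E] := Wt_or S nz nz' (pt_notT S yS) zne; [exists z|exists z'].
have J := tri_join S nz0 (pt_notT S yS) E0.
have {}J : joined (fun x => ~ Tset a b c x) z0 (p y).
  apply: joined_along J => x zx xT; have nx := joinedr zx.
  by have := side_T' S T mT mS xT nx; rewrite -(joined_Wt S zx) E0 => E; rewrite E eqxx in ne.
rewrite -(joined_Wt T J) -(edge_side T vw vT ht nT); apply: joined_Wt => //.
by apply: (joined_ball Hr) => //; rewrite subrr nm0.
Qed.

Lemma nested (v w t a b c s m y : V) : tri v w t -> tri a b c -> s \in [set v; w; t] -> s \notin [set a; b; c] ->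
  m \in [set a; b; c] -> m \notin [set v; w; t] -> y \notin [set v; w; t] -> y \notin [set a; b; c] ->
  Wt v w t (p y) != Wt v w t (p m) -> Wt a b c (p y) = Wt a b c (p s).
Proof.
move=> S T; rewrite finset.in_setU in_set2 finset.in_set1 -orbA => /or3P[] /eqP -> sT mT mS yS yT ne.
- exact: nested1 ne.
- apply: (@nested1 w t v a b c m y) => //; first exact: tri_rot.
  + by rewrite set3_rot.
  + by rewrite set3_rot.
  + by rewrite !(Wt_rot v w t).
- apply: (@nested1 t v w a b c m y) => //; first exact/tri_rot/tri_rot.
  + by rewrite -set3_rot.
  + by rewrite -set3_rot.
  + by rewrite -!(Wt_rot t v w).
Qed.

Lemma touch_Wt a b c (u : V) z : tri a b c -> u \notin [set a; b; c] -> touch z (p u) ->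
  Wt a b c (p u) = Wt a b c z.
Proof.
move=> T uT tz; have [r r0 Hr] := closed_Tset T (pt_notT T uT); have [z' zz' hz'] := tz r r0.
apply/esym/(joined_Wt T)/(@joined_trans _ _ z').
  by apply: joined_sub zz' => w; apply: free_notT.
by apply: (joined_ball Hr) => //; rewrite subrr nm0.
Qed.

(** The sign may depend on the order of the vertices and on the parametrisations, but being joined
    off the triangle depends only on the point set. *)
Lemma same_side a b c a' b' c' (u v : V) : tri a b c -> tri a' b' c' -> [set a; b; c] = [set a'; b'; c'] ->
  u \notin [set a; b; c] -> v \notin [set a; b; c] ->
  Wt a b c (p u) = Wt a b c (p v) -> Wt a' b' c' (p u) = Wt a' b' c' (p v).
Proof.
move=> T T' E uT vT W; apply: joined_Wt => //.
apply: joined_sub (tri_join T (pt_notT T uT) (pt_notT T vT) W) => w nw.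
have [aT bT cT] := tri_in T'; rewrite -E in aT bT cT; have [ab bc ca] := and3P T'.
by case=> hw; apply: nw; apply: Tset_edge hw.
Qed.

(** As an arc does not separate, z can be joined to a third vertex off the edge ab; the face of z is
    left at a point off this edge. *)
Lemma touch_third a b z : G a b -> (2 < #|V|)%N -> free z ->
  exists2 c : V, c \notin [set a; b] & touch z (p c).
Proof.
move=> ab n3 fz.
have [w wab] := @exists_notin _ [:: a; b] n3.
rewrite !inE negb_or in wab; case/andP: wab => wa wb.
have offz : off (γ a b) z by apply/off_img => hw; apply: fz; apply: G_edge hw.
have [x [Gx nx tx]] : exists x, [/\ Gset G x, ~ img (γ a b) x & touch z x].
  apply: (@leave _ _ G (img (γ a b)) z (p w)) => //.
    by move=> /joinedr; apply; apply: G_pt.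
  by apply: arc_join => //; apply: pt_off.
have [|u v y|c cS tc] := @touch_out _ _ G (fun v => v \in [set a; b]) (img (γ a b)) z x _ _ Gx nx tx; last by exists c.
  move=> v; rewrite !inE => /orP[] /eqP ->; [exists 0; [exact: I01_0|by rewrite gam0]|exists 1; [exact: I01_1|by rewrite gam1]].
rewrite !inE => /orP[] /eqP -> /orP[] /eqP -> uv; rewrite ?adj_irr // in uv.
  by [].
by move=> hy; apply: img_sym.
Qed.

(** The only consequence of maximality that is used about the faces; it is established in
    [planar_pgraph]. *)
Hypothesis CL : forall z u v, touch z (p u) -> touch z (p v) -> u != v -> G u v.

(** If u were isolated, a short segment ending at u would be in one face. As a point does not
    separate the plane, this face touches another vertex too, and [CL] gives an edge. *)
Lemma has_nbr (u : V) : (1 < #|V|)%N -> exists v, G u v.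
Proof.
move=> n2; apply: contrapT => iso.
have nu v : ~~ G u v by apply/negP => h; apply: iso; exists v.
have [w] := @exists_notin _ [:: u] n2; rewrite inE => wu.
pose K1 x := (exists v : V, v != u /\ x = p v) \/ exists ab : V * V, [/\ G ab.1 ab.2 & img (γ ab.1 ab.2) x].
have cK1 : closedK K1.
  apply: closed_or.
    apply: (@closed_union _ _ (fun (v : V) w => v != u /\ w = p v)) => v x nx.
    have [vu|vu] := boolP (v != u); last by exists 1 => // ? _ [].
    have [|r r0 Hr] := @closed_pt _ (p v) x; first by move=> h2; apply: nx.
    by exists r => // w' /Hr h2 [].
  apply: (@closed_union _ _ (fun ab w => [/\ G ab.1 ab.2 & img (γ ab.1 ab.2) w])) => -[a b] /= x nx.
  have [ab|nab] := boolP (G a b); last by exists 1 => // w' _ [].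
  have [|r r0 Hr] := @closed_img _ _ (gam_con ab) x; first by move=> h2; apply: nx.
  by exists r => // w' /Hr h2 [_].
have nK : ~ K1 (p u).
  case=> [[v [vu /pp_inj E]]|[[a b] /= [ab [t ht E]]]]; first by rewrite E eqxx in vu.
  have [Eu|Eu] := gam_pt ab ht (esym E); first by have := nu b; rewrite Eu ab.
  by have := nu a; rewrite Eu adjC ab.
have [r r0 Hr] := cK1 _ nK.
have fr x : nm (x - p u) < r -> x != p u -> free x.
  move=> hx xu [[v E]|[ab [ab1 _ hw]]]; last by apply: (Hr x hx); right; exists ab.
  by apply: (Hr x hx); left; exists v; split=> //; apply: contraNneq xu => <-; rewrite E.
pose pt (s : R) := p u + s%:c.
have fpt s : 0 < s -> s < r -> free (pt s).
  move=> s0 sr; apply: fr; first by rewrite /pt addrC addKr nm_real gtr0_norm.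
  by rewrite /pt -subr_eq0 addrC addKr rc_eq0 gt_eqF.
have r2 : 0 < r / 2 < r by apply/andP; split; lra.
case/andP: r2 => r20 r2r; have fz := fpt _ r20 r2r.
have tz : touch (pt (r / 2)) (p u).
  move=> e e0; pose s := Num.min e r / 2.
  have sp : 0 < Num.min e r by rewrite lt_min e0 r0.
  have sr : Num.min e r <= r by rewrite ge_min lexx orbT.
  have se : Num.min e r <= e by rewrite ge_min lexx.
  exists (pt s); last by rewrite /pt addrC addKr nm_real gtr0_norm /s; lra.
  apply: joined_seg => t /andP[t0 t1].
  have -> : lerp (pt (r / 2)) (pt s) t = pt (r / 2 + t * (s - r / 2)).
    by rewrite /lerp /pt !rcD rcM rcB; ring.
  by apply: fpt; rewrite /s; nra.
have [x [Gx nx tx]] : exists x, [/\ Gset G x, ~ (x = p u) & touch (pt (r / 2)) x].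
  apply: (@leave _ _ G (fun x => x = p u) _ (p w)) => //.
    by move=> /joinedr; apply; apply: G_pt.
  apply: (@joined_sub _ (fun x => x != p u)); first by move=> x /eqP.
  apply: pt_join; last by rewrite (inj_eq (@pp_inj _ _ G)).
  by rewrite /pt -subr_eq0 addrC addKr rc_eq0 gt_eqF.
have [|a b y|c cS tc] := @touch_out _ _ G (fun v => v == u) (fun x => x = p u) _ x _ _ Gx nx tx.
- by move=> v /eqP ->.
- by move=> /eqP -> /eqP ->; rewrite adj_irr.
by have := nu c; rewrite (CL tz tc) // eq_sym.
Qed.

Lemma tri_of_touch a b z c : G a b -> touch z (p a) -> touch z (p b) -> touch z (p c) ->
  c \notin [set a; b] -> tri a b c.
Proof.
move=> ab ta tb tc; rewrite !inE negb_or => /andP[ca cb].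
by apply/and3P; split=> //; [apply: (CL tb tc); rewrite eq_sym|apply: (CL tc ta)].
Qed.

Lemma two_nbrs a b : (3 < #|V|)%N -> G a b -> exists c d : V, [/\ c != d, tri a b c, tri a b d &
  forall w : V, tri a b w -> w != c -> w != d -> Wt a b w (p c) != Wt a b w (p d)].
Proof.
move=> n4 ab; have n3 := ltnW n4.
have [z0 [fz0 ta0 tb0]] := edge_free ab; have [c0 c0ab tc0] := touch_third ab n3 fz0.
have T0 := tri_of_touch ab ta0 tb0 tc0 c0ab.
have [z [z' [fz fz' [za zb] [z'a z'b] Hne]]] := edge_sides T0.
have [c cab tc] := touch_third ab n3 fz; have [d dab td] := touch_third ab n3 fz'.
have Tc := tri_of_touch ab za zb tc cab; have Td := tri_of_touch ab z'a z'b td dab.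
have other x y (e f : V) : e != f -> free x -> free y -> (forall d : V, tri a b d -> Wt a b d x != Wt a b d y) ->
    touch x (p a) -> touch x (p b) -> touch x (p e) -> e \notin [set a; b] ->
    touch y (p a) -> touch y (p b) -> touch y (p f) -> f \notin [set a; b] ->
    exists c d : V, [/\ c != d, tri a b c, tri a b d &
      forall w : V, tri a b w -> w != c -> w != d -> Wt a b w (p c) != Wt a b w (p d)].
  move=> ef fx fy H xa xb xe eab ya yb yf fab; exists e, f; split=> //.
  - exact: tri_of_touch xe _.
  - exact: tri_of_touch yf _.
  move=> w Tw we wf; rewrite (touch_Wt Tw _ xe) 1?(touch_Wt Tw _ yf); first exact: H.
    by rewrite finset.in_setU finset.in_set1 (eq_sym f) (negbTE wf) orbF.
  by rewrite finset.in_setU finset.in_set1 (eq_sym e) (negbTE we) orbF.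
have [cd|cd] := eqVneq c d; last exact: (other z z' c d).
(* If the faces on both sides of ab led to the same vertex c, a fourth vertex w would be on the side
   of one of them with respect to abc. That face touches a vertex outside abc, which replaces c on
   its side. *)
subst d; have [w wabc] : exists w : V, w \notin [set a; b; c].
  by have [w hw] := @exists_notin _ [:: a; b; c] n4; exists w; move: hw; rewrite !inE -!orbA.
have nT y := @free_notT a b c y Tc.
have ex y : free y -> Wt a b c (p w) = Wt a b c y -> exists2 e : V, e \notin [set a; b; c] & touch y (p e).
  move=> fy Ey; have [x [Gx nx tx]] : exists x, [/\ Gset G x, ~ Tset a b c x & touch y x].
    apply: (@leave _ _ G (Tset a b c) y (p w)) => //.
      by move=> /joinedr; apply; apply: G_pt.
    by apply: tri_join => //; [exact: nT|exact: pt_notT].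
  have [v|u v x'|e he te] := @touch_out _ _ G (fun v => v \in [set a; b; c]) (Tset a b c) y x _ _ Gx nx tx.
  - exact: Tset_pt.
  - exact: Tset_edge.
  by exists e.
have split3 e : e \notin [set a; b; c] -> e \notin [set a; b] /\ e != c.
  by rewrite finset.in_setU finset.in_set1 negb_or => /andP[].
have [E|E] := Wt_or Tc (nT _ fz) (nT _ fz') (pt_notT Tc wabc) (Hne c Tc).
  have [e /split3[e1 e2] te] := ex z fz E; exact: (other z z' e c).
have [e /split3[e1 e2] te] := ex z' fz' E; apply: (other z' z e c) => // d Td'.
by rewrite eq_sym Hne.
Qed.

Lemma complete3 : #|V| = 3%N -> forall u v, u != v -> G u v.
Proof.
move=> n3 u v uv; have n2 : (1 < #|V|)%N by rewrite n3.
have n3' : (2 < #|V|)%N by rewrite n3.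
have [a ua] := has_nbr u n2.
have [z [fz tu ta]] := edge_free ua; have [c cua tc] := touch_third ua n3' fz.
have T := tri_of_touch ua tu ta tc cua.
have [nua nac ncu] := tri_neq T.
have : v \in [set u; a; c].
  have -> : [set u; a; c] = [set: V].
    apply/eqP; rewrite eqEcard finset.subsetT cardsT n3 finset.setUC cardsU1 cards2 nua.
    by rewrite in_set2 negb_or ncu eq_sym nac.
  by rewrite finset.in_setT.
rewrite finset.in_setU in_set2 finset.in_set1 eq_sym (negbTE uv) /= => /orP[] /eqP -> //.
by have [_ _] := and3P T; rewrite adjC.
Qed.


Lemma tri_cycle a b c : tri a b c -> [set a; b; c] \in three_cycles G.
Proof. by case/and3P; exact: cycleP. Qed.

Lemma cycle_tri T : T \in three_cycles G -> exists a b c, tri a b c /\ T = [set a; b; c].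
Proof.
move=> cT; have T3 := cycle_card cT; have /card_gt1P[a [b [aT bT ab]]] : (1 < #|T|)%N by rewrite T3.
have [c [E ac bc]] := cycle_third cT aT bT ab; exists a, b, c; split=> //.
by rewrite /tri (cycle_adj cT aT bT ab) bc adjC ac.
Qed.

(** An order of the vertices of T is chosen once for all. A single value has no meaning; only the
    equality of values for two vertices off T has one. *)
Definition side (T : {set V}) (u : V) : bool :=
  if [pick t : V * V * V | tri t.1.1 t.1.2 t.2 && (T == [set t.1.1; t.1.2; t.2])] is Some t
  then Wt t.1.1 t.1.2 t.2 (p u) == 1 else false.

Lemma sideP T : T \in three_cycles G -> exists a b c, [/\ tri a b c, T = [set a; b; c] &
  forall u, side T u = (Wt a b c (p u) == 1)].
Proof.
move=> /cycle_tri[a [b [c [abc E]]]]; rewrite /side; case: pickP => [t /andP[ht /eqP Et]|/(_ (a, b, c))].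
  by exists t.1.1, t.1.2, t.2.
by rewrite /= abc E eqxx.
Qed.

Lemma sideE a b c (u v : V) : tri a b c -> u \notin [set a; b; c] -> v \notin [set a; b; c] ->
  ((Wt a b c (p u) == 1) == (Wt a b c (p v) == 1)) = (Wt a b c (p u) == Wt a b c (p v)).
Proof.
move=> T uT vT; have e1 : 1 = 1 ^+ 2 :> C by rewrite expr1n.
have hu : Wt a b c (p u) ^+ 2 = 1 ^+ 2 by rewrite -e1; apply: Wt_sq => //; exact: pt_notT.
have hv : Wt a b c (p v) ^+ 2 = 1 ^+ 2 by rewrite -e1; apply: Wt_sq => //; exact: pt_notT.
have n1 : (-1 == 1 :> C) = false.
  by apply/negbTE; rewrite eq_sym -subr_eq0 opprK -mulr2n pnatr_eq0.
by move: hu hv => /sqr_sign[->|->] /sqr_sign[->|->]; rewrite ?eqxx ?n1 // [1 == -1]eq_sym n1.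
Qed.

Lemma side_adj T (u v : V) : T \in three_cycles G -> G u v -> u \notin T -> v \notin T -> side T u = side T v.
Proof.
by move=> /sideP[a [b [c [abc -> H]]]] uv uT vT; rewrite !H (side_edge abc uv uT vT).
Qed.

Lemma side_nested S T (s m y : V) : S \in three_cycles G -> T \in three_cycles G ->
  s \in S -> s \notin T -> m \in T -> m \notin S -> y \notin S -> y \notin T ->
  side S y != side S m -> side T y = side T s.
Proof.
move=> /sideP[a [b [c [abc -> H]]]] /sideP[a' [b' [c' [abc' -> H']]]] sS sT mT mS yS yT.
rewrite !H !H' (sideE abc yS mS) => ne.
have := sideE abc' yT sT; rewrite (nested abc abc' sS sT mT mS yS yT ne) eqxx => /eqP.
exact.
Qed.

Lemma side_two_nbrs a b : (3 < #|V|)%N -> G a b -> exists c d : V, [/\ c != d, G a c && G b c, G a d && G b d &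
  forall w : V, G a w -> G b w -> w != c -> w != d -> side [set a; b; w] c != side [set a; b; w] d].
Proof.
move=> n4 ab; have [c [d [cd abc abd H]]] := two_nbrs n4 ab.
have [_ bc ca] := and3P abc; have [_ bd da] := and3P abd.
have [_ nbc nca] := tri_neq abc; have [_ nbd nda] := tri_neq abd.
exists c, d; split=> //; [by rewrite bc adjC ca|by rewrite bd adjC da|].
move=> w aw bw wc wd; have abw : tri a b w by apply/and3P; split=> //; rewrite adjC.
have cT : c \notin [set a; b; w] by rewrite !inE !negb_or nca eq_sym nbc eq_sym wc.
have dT : d \notin [set a; b; w] by rewrite !inE !negb_or nda eq_sym nbd eq_sym wd.
have [a' [b' [c' [T' E HT]]]] := sideP (tri_cycle abw).
have [cT' dT'] : c \notin [set a'; b'; c'] /\ d \notin [set a'; b'; c'] by rewrite -E.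
rewrite !HT sideE //.
by apply: contra (H w abw wc wd) => /eqP e; apply/eqP; apply: (same_side T' abw) e.
Qed.
End Faces.
End Plane.

(** * Separating 3-cycles *)

Section Facts.
(* [sd T u] is the side of the 3-cycle [T] on which the vertex [u] lies; it is meaningless for [u] in [T]. *)
Variables (V : finType) (G : sgraph V) (sd : {set V} -> V -> bool).
Hypothesis nbr : forall u, exists v, G u v.
Hypothesis two : forall a b, G a b -> exists c d, [/\ c != d, G a c && G b c, G a d && G b d &
  forall w, G a w -> G b w -> w != c -> w != d -> sd [set a; b; w] c != sd [set a; b; w] d].
Hypothesis sd_adj : forall T u v, T \in three_cycles G -> G u v -> u \notin T -> v \notin T -> sd T u = sd T v.
Hypothesis sd_nested : forall S T s m y, S \in three_cycles G -> T \in three_cycles G ->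
  s \in S -> s \notin T -> m \in T -> m \notin S -> y \notin S -> y \notin T ->
  sd S y != sd S m -> sd T y = sd T s.

Let adjN a b : G a b -> a != b. Proof. by apply: contraTneq => ->; rewrite adj_irr. Qed.
Let adjS a b : G a b = G b a. Proof. exact: adj_sym. Qed.

Lemma three_nbrs u : exists a c d, [/\ G u a, G u c, G u d, G a c & G a d /\ uniq [:: u; a; c; d]].
Proof.
have [a ua] := nbr u; have [c [d [cd /andP[uc ac] /andP[ud ad] _]]] := two ua.
exists a, c, d; split=> //; split=> //=.
by rewrite !inE !negb_or (adjN ua) (adjN uc) (adjN ud) (adjN ac) (adjN ad) cd.
Qed.

Lemma not_complete5 : (4 < #|V|)%N -> ~ (forall u v, u != v -> G u v).
Proof.
move=> n5 K; have [u _] : exists u : V, true by have /card_gt0P[u _] : (0 < #|V|)%N by exact: leq_trans n5; exists u.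
have [a ua] := nbr u; have [c [d [cd /andP[uc ac] /andP[ud ad] H]]] := two ua.
have [w wn] := @exists_notin _ [:: u; a; c; d] n5.
move: wn; rewrite !inE !negb_or => /and4P[wu wa wc wd].
have uw : G u w by apply: K; rewrite eq_sym.
have aw : G a w by apply: K; rewrite eq_sym.
have wu' : G w u by rewrite adjS.
have := H w uw aw wc wd; rewrite (sd_adj (cycleP ua aw wu') (K c d cd)) ?eqxx // !inE !negb_or.
  by rewrite eq_sym (adjN uc) eq_sym (adjN ac) eq_sym wc.
by rewrite eq_sym (adjN ud) eq_sym (adjN ad) eq_sym wd.
Qed.

Lemma nonadj_card u v : u != v -> ~~ G u v -> (4 < #|V|)%N.
Proof.
move=> uv nuv; have [a [c [d [ua uc ud ac [ad /= U]]]]] := three_nbrs u.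
apply: (@uniq_size _ [:: v; u; a; c; d]) => /=; rewrite U andbT !inE !negb_or eq_sym uv /=.
by apply/and3P; split; apply: contraNneq nuv => ->.
Qed.

Lemma miss_uniq u v w : #|V| = 5%N -> u != v -> u != w -> ~~ G u v -> ~~ G u w -> v = w.
Proof.
move=> n5 uv uw nuv nuw; apply/eqP; apply: contraT => vw.
have [a [c [d [ua uc ud ac [ad /= U]]]]] := three_nbrs u.
have := @uniq_size _ [:: v; w; u; a; c; d]; rewrite n5 /= U !inE !negb_or vw [v == u]eq_sym uv [w == u]eq_sym uw /=.
have nv z : G u z -> v != z by move=> uz; apply: contraNneq nuv => ->.
have nw z : G u z -> w != z by move=> uz; apply: contraNneq nuw => ->.
by rewrite !nv ?nw //= => /(_ isT).
Qed.

(** By [miss_uniq] a second missing edge uv is disjoint from xy, and xu is an edge. Its two common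
    neighbours differ from y and v, which makes six vertices. *)
Lemma K5_minus x y u v : #|V| = 5%N -> x != y -> ~~ G x y -> u != v -> [set u; v] != [set x; y] -> G u v.
Proof.
move=> n5 xy nxy uv ne; apply: contraT => nuv.
have yx : y != x by rewrite eq_sym.
have vu : v != u by rewrite eq_sym.
have nyx : ~~ G y x by rewrite adjS.
have nvu : ~~ G v u by rewrite adjS.
have ux : u != x.
  apply: contraNneq ne => E; move: uv nuv; rewrite E => xv nxv.
  by rewrite (miss_uniq n5 xv xy nxv nxy).
have uy : u != y.
  apply: contraNneq ne => E; move: uv nuv; rewrite E => yv nyv.
  by rewrite (miss_uniq n5 yv yx nyv nyx) finset.setUC.
have vx : v != x.
  apply: contraNneq ne => E; move: vu nvu; rewrite E => xu nxu.
  by rewrite (miss_uniq n5 xu xy nxu nxy) finset.setUC.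
have vy : v != y.
  apply: contraNneq ne => E; move: vu nvu; rewrite E => yu nyu.
  by rewrite (miss_uniq n5 yu yx nyu nyx).
have xu : G x u.
  apply: contraT => nxu; have := miss_uniq n5 xy (_ : x != u) nxy nxu; rewrite eq_sym ux => /(_ isT) E.
  by rewrite E eqxx in uy.
have [c [d [cd /andP[xc uc] /andP[xd ud] _]]] := two xu.
have := @uniq_size _ [:: x; y; u; v; c; d]; rewrite n5 /= !inE !negb_or cd xy uv (adjN xc) (adjN xd) (adjN uc) (adjN ud).
rewrite ![_ == u]eq_sym ![_ == v]eq_sym ux uy vx vy /=.
have ny z : G x z -> y != z by move=> xz; apply: contraNneq nxy => ->.
have nv z : G u z -> v != z by move=> uz; apply: contraNneq nuv => ->.
by rewrite !ny ?nv //= => /(_ isT).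
Qed.

(** The edge lies on a separating 3-cycle: the obstacle to contraction in the graph without its
    brace. *)
Definition pinched a b := exists w c d, [/\ [set a; b; w] \in three_cycles G, c \notin [set a; b; w],
  d \notin [set a; b; w] & sd [set a; b; w] c != sd [set a; b; w] d].

Lemma contractible_or_pinched a b : G a b -> contractible G [set a; b] \/ pinched a b.
Proof.
move=> ab; have [c [d [cd /andP[ac bc] /andP[ad bd] H]]] := two ab.
have [[w [aw bw wc wd]]|nw] := pselect (exists w, [/\ G a w, G b w, w != c & w != d]).
  right; exists w, c, d; split; last exact: H.
  - by apply: cycleP => //; rewrite adjS.
  - by rewrite !inE !negb_or eq_sym (adjN ac) eq_sym (adjN bc) eq_sym wc.
  - by rewrite !inE !negb_or eq_sym (adjN ad) eq_sym (adjN bd) eq_sym wd.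
left; apply/andP; split; first by apply/imsetP; exists (a, b); rewrite ?inE.
have -> : [set T in three_cycles G | [set a; b] \subset T] = [set [set a; b; c]; [set a; b; d]].
  apply/setP => T; rewrite finset.in_set2 finset.inE; apply/andP/orP; last first.
    case=> /eqP ->; split; try (by rewrite set2_in !inE !eqxx orbT); apply: cycleP => //; by rewrite adjS.
  rewrite set2_in => -[cT /andP[aT bT]]; have [e [-> ae be]] := cycle_third cT aT bT (adjN ab).
  have [->|ec] := eqVneq e c; first by left.
  have [->|ed] := eqVneq e d; first by right.
  by case: nw; exists e.
have ne : [set a; b; c] != [set a; b; d]; last by rewrite cards2 ne.
apply/eqP => E; have : c \in [set a; b; d] by rewrite -E !inE eqxx orbT.
by rewrite !inE -orbA ![c == _]eq_sym (negbTE (adjN ac)) (negbTE (adjN bc)) eq_sym (negbTE cd).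
Qed.

(** * Vertices around the brace of an irreducible braced triangulation *)

Section Brace.
Variables x y : V.
Hypothesis xy : x != y.
Hypothesis nxy : ~~ G x y.
(** Irreducibility in combinatorial form. A 3-cycle with the brace cannot contain an edge avoiding x
    and y, and it contains xa only if a is also adjacent to y; in all other cases an edge must fail
    to be contractible already without the brace. *)
Hypothesis pinch0 : forall a b, G a b -> a \notin [set x; y] -> b \notin [set x; y] -> pinched a b.
Hypothesis pinchx : forall a, G x a -> ~~ G y a -> pinched x a.
Hypothesis pinchy : forall a, G y a -> ~~ G x a -> pinched y a.

Definition sides (T : {set V}) u := [set v | (v \notin T) && (sd T v == sd T u)].

Lemma nbr_off u : u \notin [set x; y] -> exists2 b, G u b & b \notin [set x; y].
Proof.
move=> uxy; have [a [c [d [ua uc _ ac _]]]] := three_nbrs u.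
have [aN|] := boolP (a \notin [set x; y]); first by exists a.
have [cN|] := boolP (c \notin [set x; y]); first by exists c.
rewrite !negbK !inE => /orP[] /eqP Ec /orP[] /eqP Ea; subst a c; rewrite ?adj_irr // in ac.
  by have := nxy; rewrite adjS ac.
by have := nxy; rewrite ac.
Qed.

Lemma side_meets T u : T \in three_cycles G -> u \notin T ->
  (x \notin T /\ sd T x = sd T u) \/ (y \notin T /\ sd T y = sd T u).
Proof.
have [n hn] := ubnP #|sides T u|; elim: n T u hn => // n IH T v hn cT vT.
apply: contrapT => nxyT.
have avoid z : z \in sides T v -> z \notin [set x; y].
  rewrite inE => /andP[zT /eqP E]; rewrite !inE negb_or.
  by apply/andP; split; apply/eqP => Ez; apply: nxyT; [left|right]; rewrite -Ez.
have vS : v \in sides T v by rewrite inE vT eqxx.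
have [b vb bN] := nbr_off (avoid v vS).
have [w [c [d]]] := pinch0 vb (avoid v vS) bN; set S := [set v; b; w] => -[cS cnS dnS ne].
have vinS : v \in S by rewrite !inE eqxx.
have [m mT mS] : exists2 m, m \in T & m \notin S.
  apply/subsetPn; apply: contra vT => TS.
  by have /eqP -> // : T == S by rewrite eqEcard TS (cycle_card cT) (cycle_card cS).
(* The vertices c and d are on different sides of S, so one of them is not on the side of m. *)
have [e [eS ene]] : exists e, e \notin S /\ sd S e != sd S m.
  have [E|E] := eqVneq (sd S c) (sd S m); last by exists c.
  by exists d; rewrite -E eq_sym.
(* A vertex of T off S is m or adjacent to m, hence on the side of m; so the side of e avoids T, and
   [sd_nested] puts it on the side of v. It is strictly smaller because v lies on S. *)
have sub z : z \in sides S e -> z \in sides T v /\ z != v.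
  rewrite inE => /andP[zS /eqP zE]; have zm : sd S z != sd S m by rewrite zE.
  split; last by apply: contraNneq zS => ->.
  have zT : z \notin T.
    apply/negP => zT; have zm' : z != m by apply: contraNneq zm => ->.
    by rewrite (sd_adj cS (cycle_adj cT zT mT zm') zS mS) eqxx in zm.
  by rewrite inE zT; apply/eqP; apply: sd_nested zm.
have lt : (#|sides S e| < n)%N.
  rewrite -ltnS; apply: leq_trans hn; rewrite ltnS; apply: proper_card; apply/properP; split.
    by apply/fintype.subsetP => z /sub[].
  by exists v => //; apply/negP => /sub[_]; rewrite eqxx.
have [[h1 h2]|[h1 h2]] := IH S e lt cS eS.
  have /sub[/avoid] : x \in sides S e by rewrite inE h1 h2 eqxx.
  by rewrite !inE eqxx.
have /sub[/avoid] : y \in sides S e by rewrite inE h1 h2 eqxx.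
by rewrite !inE eqxx orbT.
Qed.

Lemma pinch_sides T c d : T \in three_cycles G -> c \notin T -> d \notin T -> sd T c != sd T d ->
  [/\ x \notin T, y \notin T & sd T x != sd T y].
Proof.
move=> cT cn dn ne.
case: (side_meets cT cn) => -[h1 e1]; case: (side_meets cT dn) => -[h2 e2]; rewrite -e1 -e2 ?eqxx // in ne.
by split; rewrite // eq_sym.
Qed.

Lemma same_nbrs a : G x a = G y a.
Proof.
apply/idP/idP => h; apply: contraT => nh.
  have [w [c [d [cT cn dn ne]]]] := pinchx h nh.
  by have [] := pinch_sides cT cn dn ne; rewrite !inE eqxx.
have [w [c [d [cT cn dn ne]]]] := pinchy h nh.
by have [_] := pinch_sides cT cn dn ne; rewrite !inE eqxx.
Qed.

Lemma few_vertices : (#|V| <= 5)%N.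
Proof.
pose N := [set a | G x a].
(* The separating 3-cycle through ab separates x from y, so a common neighbour of x and y off it
   would be on both sides. *)
have NS a b : G a b -> a \notin [set x; y] -> b \notin [set x; y] -> exists w, N \subset [set a; b; w].
  move=> ab aN bN; have [w [c [d [cT cn dn ne]]]] := pinch0 ab aN bN; exists w.
  have [xT yT nexy] := pinch_sides cT cn dn ne; apply/fintype.subsetP => e; rewrite inE => xe.
  apply: contraT => eT; have ye : G y e by rewrite -same_nbrs.
  by rewrite (sd_adj cT xe xT eT) (sd_adj cT ye yT eT) eqxx in nexy.
have Noff a : a \in N -> a \notin [set x; y].
  rewrite !inE negb_or => xa; rewrite eq_sym (adjN xa).
  by apply: contraNneq nxy => <-.
have [a [c [d [xa xc xd ac [ad /= /andP[_ U]]]]]] := three_nbrs x.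
have aN : a \in N by rewrite inE.
have cN : c \in N by rewrite inE.
have dN : d \in N by rewrite inE.
have N3 : (3 <= #|N|)%N.
  have U3 : uniq [:: a; c; d] by [].
  rewrite -[3%N]/(size [:: a; c; d]) -(card_uniqP U3); apply: subset_leq_card.
  by apply/fintype.subsetP => z; rewrite !inE => /or3P[] /eqP ->.
have le3 (u v w : V) : (#|[set u; v; w]| <= 3)%N.
  by rewrite finset.setUC cardsU1 cards2; case: (u != v); case: (w \notin _).
have NE (u v w : V) : N \subset [set u; v; w] -> N = [set u; v; w].
  by move=> h; apply/eqP; rewrite eqEcard h (leq_trans (le3 u v w)).
(* A vertex z outside {x, y} has an edge zb avoiding x and y; as N has at least three elements, it
   is the whole 3-cycle given by [NS], which contains z. *)
have all z : z \in N :|: [set x; y].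
  rewrite finset.in_setU; have [//|zxy] := boolP (z \in [set x; y]); first by rewrite orbT.
  have [b zb bN] := nbr_off zxy; have [w /NE ->] := NS z b zb zxy bN.
  by rewrite !inE eqxx.
have [w /subset_leq_card h] := NS a c ac (Noff a aN) (Noff c cN).
rewrite -cardsT; apply: (@leq_trans #|N :|: [set x; y]|).
  by apply: subset_leq_card; apply/fintype.subsetP => z _; apply: all.
apply: leq_trans (leq_card_setU _ _) _; rewrite cards2 xy addn2 !ltnS.
exact: leq_trans h (le3 _ _ _).
Qed.
End Brace.
End Facts.

(** * Charts of the sphere *)

Section Plane.
Variable R : realType.
Notation C := R[i].
Notation Re := (@complex.Re R).
Notation Im := (@complex.Im R).
Notation "x %:c" := (real_complex R x) (at level 1, format "x %:c").
Implicit Types (x y z w : C) (t s : R).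

Notation E3 := 'rV[R]_3.

Definition i1 : 'I_3 := lift ord0 ord0.
Definition i2 : 'I_3 := lift ord0 (lift ord0 ord0).
Definition x0 (v : E3) : R := v ord0 ord0.
Definition x1 (v : E3) : R := v ord0 i1.
Definition x2 (v : E3) : R := v ord0 i2.
Definition mk3 (a b c : R) : E3 := \row_(i < 3) nth 0 [:: a; b; c] i.

Lemma mk3E a b c : [/\ x0 (mk3 a b c) = a, x1 (mk3 a b c) = b & x2 (mk3 a b c) = c].
Proof. by split; rewrite /x0 /x1 /x2 mxE. Qed.

Lemma coord_ind (P : 'I_3 -> Prop) : P ord0 -> P i1 -> P i2 -> forall i, P i.
Proof.
move=> h0 h1 h2 [[|[|[|//]]] h].
- by have -> : Ordinal h = ord0 by apply: val_inj.
- by have -> : Ordinal h = i1 by apply: val_inj.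
- by have -> : Ordinal h = i2 by apply: val_inj.
Qed.

Lemma ext3 (u v : E3) : x0 u = x0 v -> x1 u = x1 v -> x2 u = x2 v -> u = v.
Proof. by move=> h0 h1 h2; apply/rowP; apply: coord_ind. Qed.

Lemma sphereE (v : E3) : sphere2 v <-> x0 v ^+ 2 + x1 v ^+ 2 + x2 v ^+ 2 = 1.
Proof. by rewrite /sphere2 /= !big_ord_recl big_ord0 addr0 addrA. Qed.

Section RAt.
Context {X : Type}.
Variables (d : X -> X -> R) (K : X -> Prop).
Definition rAt (f : X -> R) (a : X) := cAt d K (fun q => (f q)%:c) a.

Lemma rAtP f a : rAt f a <-> forall e, 0 < e -> exists2 r, 0 < r & forall q, K q -> d q a < r -> `|f q - f a| < e.
Proof.
by split=> H e e0; have [r r0 Hr] := H e e0; exists r => // q Kq hq; have := Hr q Kq hq; rewrite -rcB nm_real.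
Qed.

Lemma rAt_cst (c : R) a : rAt (fun=> c) a. Proof. exact: cAt_cst. Qed.

Lemma rAtD f g a : rAt f a -> rAt g a -> rAt (fun q => f q + g q) a.
Proof. by move=> cf cg; apply: (@eq_cAt _ _ _ _ (fun q => (f q)%:c + (g q)%:c)); [move=> q; rewrite rcD|exact: cAtD]. Qed.

Lemma rAtB f g a : rAt f a -> rAt g a -> rAt (fun q => f q - g q) a.
Proof. by move=> cf cg; apply: (@eq_cAt _ _ _ _ (fun q => (f q)%:c - (g q)%:c)); [move=> q; rewrite rcB|exact: cAtB]. Qed.

Lemma rAtM f g a : rAt f a -> rAt g a -> rAt (fun q => f q * g q) a.
Proof. by move=> cf cg; apply: (@eq_cAt _ _ _ _ (fun q => (f q)%:c * (g q)%:c)); [move=> q; rewrite rcM|exact: cAtM]. Qed.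

Lemma rAt_div f g a : g a != 0 -> rAt f a -> rAt g a -> rAt (fun q => f q / g q) a.
Proof.
move=> g0 cf cg; apply: (@eq_cAt _ _ _ _ (fun q => (f q)%:c / (g q)%:c)); last by apply: cAt_div; rewrite ?rc_eq0.
by move=> q; rewrite rcM (fmorphV (real_complex R)).
Qed.

Lemma cAt_mk f g a : rAt f a -> rAt g a -> cAt d K (fun q => Complex (f q) (g q)) a.
Proof.
move=> cf cg; apply: (@eq_cAt _ _ _ _ (fun q => (f q)%:c + 'i%C * (g q)%:c)).
  by move=> q; rewrite [RHS]complexE.
by apply: cAtD => //; apply: cAtM => //; exact: cAt_cst.
Qed.

Definition cAt3 (f : X -> E3) a := forall i, rAt (fun q => f q ord0 i) a.

Lemma cAt3_mk f g h a : rAt f a -> rAt g a -> rAt h a -> cAt3 (fun q => mk3 (f q) (g q) (h q)) a.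
Proof.
by move=> cf cg ch; apply: coord_ind; [move: cf|move: cg|move: ch]; apply: eq_cAt => q; rewrite mxE.
Qed.
End RAt.

Definition pcon3 (g : R -> E3) := forall t, I01 t -> cAt3 (@dR R) (@I01 R) g t.

Lemma pcon3P (g : R -> E3) : {within `[0, 1], continuous g}%classic <-> pcon3 g.
Proof.
split=> [/subspace_continuousP H t ht i|H].
  apply/rAtP => e e0; have ht' : `[0, 1]%classic t by rewrite /= in_itv.
  have /cvg_ballP /(_ _ e0) := H t ht'.
  rewrite near_withinE => /nbhs_ballP[r /= r0 Hr]; exists r => // s hs hst.
  have : ball (g t) e (g s) by apply: Hr; [rewrite /ball /= distrC|rewrite /= in_itv].
  by case=> _ /(_ ord0 i); rewrite /ball /= distrC.
apply/subspace_continuousP => t /=; rewrite in_itv => ht.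
apply/cvg_ballP => e e0.
have [r r0 Hr] := @fin_min _ _ (fun i r => forall s, I01 s -> `|s - t| < r -> `|g s ord0 i - g t ord0 i| < e)
  (fun i r s Hi sr _ q Kq h => Hi q Kq (lt_le_trans h sr)) (fun i => (rAtP _ _ _ _).1 (H t ht i) e e0).
rewrite near_withinE; apply/nbhs_ballP; exists r => //= s hs; rewrite /= in_itv => hs'.
split=> // i j; rewrite ord1 /ball /= distrC; apply: Hr => //.
by rewrite distrC; exact: hs.
Qed.

(** Stereographic projection from the pole (0, 0, 1), with [unstereo] as its inverse; the formula is
    meaningless at the pole itself. *)
Definition stereo (v : E3) : C := Complex (x0 v / (1 - x2 v)) (x1 v / (1 - x2 v)).
Definition unstereo z : E3 := let D := Re z ^+ 2 + Im z ^+ 2 + 1 in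
  mk3 (2 * Re z / D) (2 * Im z / D) ((D - 2) / D).

Let Dpos z : 0 < Re z ^+ 2 + Im z ^+ 2 + 1.
Proof. by rewrite ltr_pwDr // addr_ge0 ?sqr_ge0. Qed.

Lemma unstereo_sphere z : sphere2 (unstereo z).
Proof.
apply/sphereE; rewrite /unstereo /=; have D0 := lt0r_neq0 (Dpos z).
by have [-> -> ->] := mk3E (2 * Re z / (Re z ^+ 2 + Im z ^+ 2 + 1)) (2 * Im z / (Re z ^+ 2 + Im z ^+ 2 + 1)) ((Re z ^+ 2 + Im z ^+ 2 + 1 - 2) / (Re z ^+ 2 + Im z ^+ 2 + 1)); field.
Qed.

Lemma unstereo2 z : x2 (unstereo z) != 1.
Proof.
rewrite /unstereo /=; have D0 := lt0r_neq0 (Dpos z).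
have [_ _ ->] := mk3E (2 * Re z / (Re z ^+ 2 + Im z ^+ 2 + 1)) (2 * Im z / (Re z ^+ 2 + Im z ^+ 2 + 1)) ((Re z ^+ 2 + Im z ^+ 2 + 1 - 2) / (Re z ^+ 2 + Im z ^+ 2 + 1)).
by apply/eqP => /(canRL (divfK D0)); lra.
Qed.

Lemma unstereoK z : stereo (unstereo z) = z.
Proof.
rewrite /stereo /unstereo /=; have D0 := lt0r_neq0 (Dpos z).
have [-> -> ->] := mk3E (2 * Re z / (Re z ^+ 2 + Im z ^+ 2 + 1)) (2 * Im z / (Re z ^+ 2 + Im z ^+ 2 + 1)) ((Re z ^+ 2 + Im z ^+ 2 + 1 - 2) / (Re z ^+ 2 + Im z ^+ 2 + 1)).
case: z D0 => a b /= D0; congr Complex; field; rewrite D0 /=.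
  by rewrite (_ : _ - _ = 2) // ; ring.
by rewrite (_ : _ - _ = 2) // ; ring.
Qed.

Lemma stereoK (v : E3) : sphere2 v -> x2 v != 1 -> unstereo (stereo v) = v.
Proof.
move=> /sphereE Sv n1; have n0 : 1 - x2 v != 0 by rewrite subr_eq0 eq_sym.
have DE : (x0 v / (1 - x2 v)) ^+ 2 + (x1 v / (1 - x2 v)) ^+ 2 + 1 = 2 / (1 - x2 v).
  rewrite (_ : 2 = (x0 v ^+ 2 + x1 v ^+ 2 + x2 v ^+ 2) + 1 ); last by rewrite Sv.
  have := Sv; move: (x0 v) (x1 v) (x2 v) n0 => a b c n0 E.
  apply: (mulIf n0); rewrite divfK //; apply: (mulIf n0).
  have -> : ((a / (1 - c)) ^+ 2 + (b / (1 - c)) ^+ 2 + 1) * (1 - c) * (1 - c) = a ^+ 2 + b ^+ 2 + (1 - c) ^+ 2 by field.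
  by rewrite E; have -> : a ^+ 2 + b ^+ 2 = 1 - c ^+ 2 by [rewrite -E; ring]; ring.
rewrite /unstereo /= DE.
have [e0 e1 e2] := mk3E (2 * (x0 v / (1 - x2 v)) / (2 / (1 - x2 v))) (2 * (x1 v / (1 - x2 v)) / (2 / (1 - x2 v))) ((2 / (1 - x2 v) - 2) / (2 / (1 - x2 v))).
by apply: ext3; rewrite ?e0 ?e1 ?e2; field; rewrite n0.
Qed.

Lemma unstereo_inj : injective unstereo.
Proof. exact: can_inj unstereoK. Qed.

Lemma cAt3_unstereo {X : Type} (d : X -> X -> R) K f a : cAt d K f a -> cAt3 d K (fun q => unstereo (f q)) a.
Proof.
move=> cf; have cr : rAt d K (fun q => Re (f q)) a by exact: cAt_Re.
have ci : rAt d K (fun q => Im (f q)) a by exact: cAt_Im.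
have cD : rAt d K (fun q => Re (f q) ^+ 2 + Im (f q) ^+ 2 + 1) a.
  by apply: rAtD; [apply: rAtD; apply: rAtM|exact: rAt_cst].
have D0 := lt0r_neq0 (Dpos (f a)).
by apply: cAt3_mk; apply: rAt_div => //; [apply: rAtM => //; exact: rAt_cst|apply: rAtM => //; exact: rAt_cst|apply: rAtB => //; exact: rAt_cst].
Qed.

Lemma cAt_stereo {X : Type} (d : X -> X -> R) K f a : x2 (f a) != 1 -> cAt3 d K f a -> cAt d K (fun q => stereo (f q)) a.
Proof.
move=> n1 cf; have n0 : 1 - x2 (f a) != 0 by rewrite subr_eq0 eq_sym.
have c2 : rAt d K (fun q => 1 - x2 (f q)) a by apply: rAtB; [exact: rAt_cst|exact: cf].
by apply: cAt_mk; apply: rAt_div => //; apply: cf.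
Qed.

(** By compactness of the interval. For an injective path this is the continuity of the inverse;
    with e = 0 it says that the set of points missed by the path is open. *)
Lemma time_near (g : R -> E3) z (t1 e : R) : pcon3 g ->
  (forall t, I01 t -> g t = unstereo z -> `|t - t1| < e) -> exists2 r, 0 < r &
  forall w, nm (w - z) < r -> forall t, I01 t -> g t = unstereo w -> `|t - t1| < e.
Proof.
move=> cg H.
apply: (@CIR _ 0 1 (fun A => exists2 r, 0 < r & forall w, nm (w - z) < r -> forall t, A t -> g t = unstereo w -> `|t - t1| < e)).
- by exists 1.
- move=> A B [r r0 Hr] [r' r'0 Hr']; exists (Num.min r r'); first by rewrite lt_min r0.
  by move=> w; rewrite lt_min => /andP[h h'] t [At|Bt]; [exact: Hr|exact: Hr'].
- by move=> A B AB [r r0 Hr]; exists r => // w hw t At; apply: (Hr w hw); exact: AB.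
move=> t ht; have [E|/eqP ne] := pselect (g t = unstereo z).
  have lt := H t ht E; exists (e - `|t - t1|); first by rewrite subr_gt0.
  exists 1 => // w _ s [_ hs] _.
  have := ler_normD (s - t) (t - t1); rewrite (_ : s - t + (t - t1) = s - t1); last by ring.
  lra.
have [i ni] : exists i, g t ord0 i != unstereo z ord0 i.
  apply: contrapT => nex; move/eqP: ne; apply; apply/rowP => i; apply/eqP; apply: contraT => h.
  by case: nex; exists i.
set δ := `|g t ord0 i - unstereo z ord0 i|.
have δ0 : 0 < δ / 2 by rewrite divr_gt0 // normr_gt0 subr_eq0.
have [r r0 Hr] := (rAtP _ _ _ _).1 (cg t ht i) _ δ0.
have [r' r'0 Hr'] := (rAtP _ _ _ _).1 (@cAt3_unstereo _ _ (@full R) _ z (@cAt_id _ _ _) i) _ δ0.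
exists r => //; exists r' => // w hw s [hs hst] E; exfalso.
have h1 := Hr s hs hst; have h2 := Hr' w I hw; rewrite E in h1; rewrite distrC in h1.
have := ler_normD (g t ord0 i - unstereo w ord0 i) (unstereo w ord0 i - unstereo z ord0 i).
by rewrite addrA subrK -/δ; lra.
Qed.

(* An injective arc covering a disc would give, by composition with its inverse, an injective real
   function on the disc; but the difference of its values at antipodal points changes sign. *)
Lemma no_arc_disc (g : R -> E3) z0 (r : R) : pcon3 g ->
  (forall t s, I01 t -> I01 s -> g t = g s -> t = s) -> 0 < r ->
  exists z, nm (z - z0) < r /\ ~ exists2 t, I01 t & g t = unstereo z.
Proof.
move=> cg ig r0; apply: contrapT => nex.
have /choice[τ Hτ] z : exists t, nm (z - z0) < r -> I01 t /\ g t = unstereo z.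
  have [hz|hz] := ltP (nm (z - z0)) r; last by exists 0.
  have [[t ht E]|nt] := pselect (exists2 t, I01 t & g t = unstereo z); first by exists t.
  by case: nex; exists z.
(* A path from 1 to -1 off 0 and of modulus at most 2. The paths [A 1] and [A (-1)] are antipodal
   about z0, stay in the disc thanks to the factor r / 4, and exchange their roles between the times
   0 and 1. *)
pose W (t : R) : C := Complex (1 - 2 * t) (t * (1 - t)).
pose A (k : R) t := z0 + (k * (r / 4))%:c * W t.
have cA k K t : cAt (@dR R) K (A k) t.
  apply: cAtD; first exact: cAt_cst.
  apply: cAtM; first exact: cAt_cst.
  have ct : rAt (@dR R) K (fun t => t) t by exact: cAt_rc.
  by apply: cAt_mk; [apply: rAtB; [exact: rAt_cst|apply: rAtM => //; exact: rAt_cst]|apply: rAtM => //; apply: rAtB => //; exact: rAt_cst].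
have inA (k : R) t : `|k| = 1 -> I01 t -> nm (A k t - z0) < r.
  move=> k1 /andP[h0 h1]; rewrite /A addrC addKr nmM nm_real normrM k1 mul1r gtr0_norm ?divr_gt0 //.
  have W2 : nm (W t) <= 2.
    apply: le_trans (nm_le _) _; rewrite /=.
    have : `|1 - 2 * t| <= 1 by rewrite ler_norml; apply/andP; split; lra.
    have : `|t * (1 - t)| <= 1 by rewrite ler_norml; apply/andP; split; nra.
    lra.
  have := nm_ge0 (W t); nra.
have n1 : `|1 : R| = 1 by rewrite normr1.
have n1' : `|-1 : R| = 1 by rewrite normrN1.
have rτ (k : R) t : `|k| = 1 -> I01 t -> rAt (@dR R) (@I01 R) (fun t => τ (A k t)) t.
  move=> k1 ht; apply/rAtP => e e0.
  have [hs gs] := Hτ _ (inA k t k1 ht).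
  have [|r' r'0 Hr'] := @time_near g (A k t) (τ (A k t)) e cg.
    by move=> s0 hs0; rewrite -gs => /(ig _ _ hs0 hs) ->; rewrite subrr normr0.
  have [r2 r20 Hr2] := cA k (@I01 R) t r' r'0.
  exists r2 => // q Iq hq; apply: (Hr' (A k q) (Hr2 q Iq hq)); by have [] := Hτ _ (inA k q k1 Iq).
pose f t := τ (A 1 t) - τ (A (-1) t).
have cf t : I01 t -> rAt (@dR R) (@I01 R) f t by move=> ht; apply: rAtB; apply: rτ.
have f0 t : I01 t -> f t != 0.
  move=> ht; rewrite subr_eq0; apply/eqP => E.
  have [_ g1] := Hτ _ (inA 1 t n1 ht); have [_ g2] := Hτ _ (inA (-1) t n1' ht).
  have := g1; rewrite E g2 => /unstereo_inj /addrI [].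
  rewrite !mul0r !subr0 !addr0 => h1 h2.
  have {}h1 : r * (1 - 2 * t) = 0 by lra.
  have {}h2 : r * (t * (1 - t)) = 0 by lra.
  move/eqP: h1; rewrite mulf_eq0 (gt_eqF r0) /= => /eqP h1.
  move/eqP: h2; rewrite mulf_eq0 (gt_eqF r0) /= => /eqP h2.
  nra.
have : (0 < f 1) = (0 < f 0).
  apply: (@locconst _ (fun t => (0 < f t) = (0 < f 0))) (@I01_1 R) => //.
  move=> t ht; have fp : 0 < `|f t| by rewrite normr_gt0 f0.
  have [r' r'0 Hr'] := (rAtP _ _ _ _).1 (cf t ht) _ fp; exists r' => // s hs hst.
  suff -> : (0 < f s) = (0 < f t) by [].
  have := Hr' s hs hst; have := f0 t ht; case: (ltrgtP (f t) 0) => // h _.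
    by rewrite (ltr0_norm h) ltr_norml => /andP[h1 h2]; apply/negbTE; rewrite -leNgt; lra.
  by rewrite (gtr0_norm h) ltr_norml => /andP[h1 h2]; lra.
have A01 k : A k 1 = A (- k) 0.
  by rewrite /A /W; congr (z0 + _); apply/eqP; rewrite eq_complex /=; apply/andP; split; apply/eqP; ring.
have -> : f 1 = - f 0 by rewrite /f !A01 opprK opprB.
by have := f0 0 (@I01_0 R); rewrite oppr_gt0; case: (ltrgtP (f 0) 0).
Qed.

(** Finitely many closed sets without interior are avoided one after another, each time inside the
    ball obtained before. *)
Lemma avoid (I : eqType) (s : seq I) (K : I -> C -> Prop) : (forall i, closedK (K i)) ->
  (forall i z r, 0 < r -> exists z', nm (z' - z) < r /\ ~ K i z') ->
  exists z r, 0 < r /\ forall w, nm (w - z) < r -> forall i, i \in s -> ~ K i w.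
Proof.
move=> cK eK; elim: s => [|i s [z [r [r0 Hr]]]]; first by exists 0, 1.
have [z' [hz' nz']] := eK i z r r0; have [r' r'0 Hr'] := cK i z' nz'.
exists z', (Num.min r' (r - nm (z' - z))); split; first by rewrite lt_min r'0 subr_gt0.
move=> w; rewrite lt_min => /andP[h1 h2] j; rewrite inE => /orP[/eqP ->|js]; first exact: Hr'.
by apply: (Hr w) => //; have := nm_tri z' w z; lra.
Qed.

Section Chart.
Variable q : E3.
Hypothesis Sq : sphere2 q.
Hypothesis q2 : x2 q != 1.

(* The reflection exchanging q and (0, 0, 1) *)
Definition refl_coef (v : E3) : R := (x0 v * x0 q + x1 v * x1 q + x2 v * x2 q - x2 v) / (1 - x2 q).
Definition refl (v : E3) : E3 := mk3 (x0 v - refl_coef v * x0 q) (x1 v - refl_coef v * x1 q)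
  (x2 v - refl_coef v * (x2 q - 1)).

Let n0 : 1 - x2 q != 0. Proof. by rewrite subr_eq0 eq_sym. Qed.

Lemma reflE v : [/\ x0 (refl v) = x0 v - refl_coef v * x0 q, x1 (refl v) = x1 v - refl_coef v * x1 q &
  x2 (refl v) = x2 v - refl_coef v * (x2 q - 1)].
Proof. exact: mk3E. Qed.

Let kE v : refl_coef v * (1 - x2 q) = x0 v * x0 q + x1 v * x1 q + x2 v * x2 q - x2 v.
Proof. by rewrite divfK. Qed.

Lemma refl_sphere v : sphere2 v -> sphere2 (refl v).
Proof.
move=> /sphereE Sv; apply/sphereE; have [-> -> ->] := reflE v; have := kE v; have /sphereE := Sq.
move: Sv (refl_coef v) => Sv k Eq Ek.
transitivity (x0 v ^+ 2 + x1 v ^+ 2 + x2 v ^+ 2 - 2 * k * (x0 v * x0 q + x1 v * x1 q + x2 v * x2 q - x2 v)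
  + k ^+ 2 * (x0 q ^+ 2 + x1 q ^+ 2 + x2 q ^+ 2 - 2 * x2 q + 1)); first by ring.
by rewrite Sv Eq -Ek; ring.
Qed.

Lemma reflK v : refl (refl v) = v.
Proof.
have [h0 h1 h2] := reflE v; have [g0 g1 g2] := reflE (refl v).
have K : refl_coef (refl v) = - refl_coef v.
  apply: (mulIf n0); rewrite kE h0 h1 h2 mulNr kE; have := kE v; have /sphereE := Sq.
  move: (refl_coef v) => k Eq Ek.
  transitivity (x0 v * x0 q + x1 v * x1 q + x2 v * x2 q - x2 v - k * (x0 q ^+ 2 + x1 q ^+ 2 + x2 q ^+ 2 - 2 * x2 q + 1)); first by ring.
  by rewrite Eq -Ek; ring.
by apply: ext3; rewrite ?g0 ?g1 ?g2 K ?h0 ?h1 ?h2; ring.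
Qed.

Lemma refl_pole v : sphere2 v -> v != q -> x2 (refl v) != 1.
Proof.
move=> Sv vq; apply: contraNneq vq => E; have /sphereE := refl_sphere Sv; rewrite E => S1.
have s0 : x0 (refl v) ^+ 2 = 0 by have := sqr_ge0 (x0 (refl v)); have := sqr_ge0 (x1 (refl v)); lra.
have s1 : x1 (refl v) ^+ 2 = 0 by have := sqr_ge0 (x0 (refl v)); have := sqr_ge0 (x1 (refl v)); lra.
move/eqP: s0; rewrite sqrf_eq0 => /eqP s0; move/eqP: s1; rewrite sqrf_eq0 => /eqP s1.
have kq : refl_coef q = 1.
  apply: (mulIf n0); rewrite kE mul1r; have /sphereE := Sq => Eq.
  by rewrite -Eq; ring.
have [h0 h1 h2] := reflE q; rewrite kq !mul1r in h0 h1 h2.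
rewrite -(reflK v) -[X in _ == X](reflK q); apply/eqP; congr refl.
by apply: ext3; rewrite ?s0 ?s1 ?E ?h0 ?h1 ?h2; ring.
Qed.

Lemma cAt3_refl {X : Type} (d : X -> X -> R) K (f : X -> E3) a : cAt3 d K f a -> cAt3 d K (fun v => refl (f v)) a.
Proof.
move=> cf; have ck : rAt d K (fun v => refl_coef (f v)) a.
  apply: rAt_div => //; last exact: rAt_cst.
  apply: rAtB; last exact: cf.
  by apply: rAtD; [apply: rAtD|]; apply: rAtM; [exact: cf|exact: rAt_cst|exact: cf|exact: rAt_cst|exact: cf|exact: rAt_cst].
by apply: cAt3_mk; apply: rAtB; try exact: cf; apply: rAtM => //; exact: rAt_cst.
Qed.

(** In effect the stereographic projection from q. *)
Definition chart (v : E3) : C := stereo (refl v).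
Definition unchart z : E3 := refl (unstereo z).

Lemma unchart_sphere z : sphere2 (unchart z).
Proof. exact/refl_sphere/unstereo_sphere. Qed.

Lemma unchartK z : chart (unchart z) = z.
Proof. by rewrite /chart /unchart reflK unstereoK. Qed.

Lemma chartK v : sphere2 v -> v != q -> unchart (chart v) = v.
Proof. by move=> Sv vq; rewrite /chart /unchart stereoK ?reflK //; [exact: refl_sphere|exact: refl_pole]. Qed.

Lemma chart_inj u v : sphere2 u -> sphere2 v -> u != q -> v != q -> chart u = chart v -> u = v.
Proof. by move=> Su Sv uq vq E; rewrite -(chartK Su uq) E chartK. Qed.

Lemma pcon_chart (g : R -> E3) : pcon3 g -> (forall t, I01 t -> sphere2 (g t) /\ g t != q) ->
  pcon (fun t => chart (g t)).
Proof.
move=> cg Sg t ht; have [S1 S2] := Sg t ht.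
by apply: cAt_stereo; [exact: refl_pole|apply: cAt3_refl; exact: cg].
Qed.

Lemma pcon3_unchart (g : R -> C) : pcon g -> pcon3 (fun t => unchart (g t)).
Proof. by move=> cg t ht; apply: cAt3_refl; apply: cAt3_unstereo; exact: cg. Qed.
End Chart.
End Plane.

(** * Maximal sphere graphs *)

Section Plane.
Variable R : realType.
Notation C := R[i].
Notation Re := (@complex.Re R).
Notation Im := (@complex.Im R).
Notation "x %:c" := (real_complex R x) (at level 1, format "x %:c").
Implicit Types (x y z w : C) (t s : R).

Notation E3 := 'rV[R]_3.

Lemma is_arcP (a b : E3) (A : set E3) : is_arc a b A <-> exists g : R -> E3,
  [/\ pcon3 g, forall t s, I01 t -> I01 s -> g t = g s -> t = s, g 0 = a, g 1 = b &
      (forall v, A v <-> exists2 t, I01 t & v = g t) /\ forall t, I01 t -> sphere2 (g t)].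
Proof.
split=> [[g [cg ig g0 g1 [EA SA]]]|[g [cg ig g0 g1 [EA SA]]]]; exists g; split=> //.
- exact/pcon3P.
- split; first move=> v.
    rewrite EA; split=> [[t /= ht <-]|[t ht ->]]; first by rewrite in_itv in ht; exists t.
    by exists t => //=; rewrite in_itv.
  by move=> t ht; apply: SA; rewrite EA; exists t => //=; rewrite in_itv.
- exact/pcon3P.
split.
  apply/seteqP; split=> v; first by move=> /EA[t ht ->]; exists t => //=; rewrite in_itv.
  by move=> [t /=]; rewrite in_itv => ht <-; apply/EA; exists t.
by move=> v /EA[t ht ->]; apply: SA.
Qed.

Lemma is_arc_sym (a b : E3) A : is_arc a b A -> is_arc b a A.
Proof.
move=> /is_arcP[g [cg ig g0 g1 [EA SA]]]; apply/is_arcP.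
have I1 t : I01 t -> I01 (1 - t) by move=> /andP[h0 h1]; apply/andP; split; lra.
exists (fun t => g (1 - t)); split.
- move=> t ht i; apply: (@cAt_pre _ _ _ (@dR R) (@dR R) (@I01 R) (@I01 R) (fun t => 1 - t) (fun t => (g t ord0 i)%:c) t); [exact: I1| |exact: cg (I1 t ht) i].
  move=> r r0; exists r => // s _; rewrite /dR (_ : 1 - s - (1 - t) = t - s); last by ring.
  by rewrite distrC.
- by move=> t s ht hs /(ig _ _ (I1 t ht) (I1 s hs)); lra.
- by rewrite subr0.
- by rewrite subrr.
split=> [v|t ht]; last exact/SA/I1.
split=> [/EA[t ht ->]|[t ht ->]]; last by apply/EA; exists (1 - t); first exact: I1.
by exists (1 - t); [exact: I1|rewrite (_ : 1 - (1 - t) = t) //; ring].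
Qed.

Section SphereGraphs.
Variables (V : finType) (P : sphere_graph R V).
Implicit Types (u v : V).

(** With uv drawn as the arc A, the graph remains a sphere graph and is strictly larger. *)
Lemma not_maximal u v (A : set E3) : u != v -> ~~ P u v -> is_arc (pt P u) (pt P v) A ->
  (forall w : V, A (pt P w) -> w \in [set u; v]) ->
  (forall (x y : V) a, P x y -> A a -> curve P x y a -> exists2 w : V, w \in [set u; v] :&: [set x; y] & a = pt P w) ->
  ~ sg_maximal P.
Proof.
move=> uv nuv arcA ptA crA M.
pose ad a b := P a b || ([set a; b] == [set u; v]).
have ad_sym : symmetric ad by move=> a b; rewrite /ad adj_sym finset.setUC.
have ad_irr : irreflexive ad.
  move=> a; rewrite /ad adj_irr /=; apply/negP => /eqP E; have := cards2 u v.
  by rewrite -E uv cards2 eqxx.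
have ad_new a b : ad a b -> [set a; b] = [set u; v] -> (a = u /\ b = v) \/ (a = v /\ b = u).
  by move=> ab; apply: set2_eq; apply: contraTneq ab => ->; rewrite ad_irr.
have ad_old a b : ad a b -> [set a; b] != [set u; v] -> P a b.
  by rewrite /ad => /orP[//|->].
pose cu a b := if [set a; b] == [set u; v] then A else curve P a b.
have f1 a b : SGraph ad_sym ad_irr a b -> cu a b = cu b a.
  rewrite /= /cu [in RHS]finset.setUC => ab; case: eqVneq => // /(ad_old _ _ ab); exact: curve_sym.
have f2 a b : SGraph ad_sym ad_irr a b -> is_arc (pt P a) (pt P b) (cu a b).
  move=> ab; rewrite /cu; case: eqVneq => [/(ad_new _ _ ab)[[-> ->]|[-> ->]]|/(ad_old _ _ ab)] //.
    exact: is_arc_sym.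
  exact: curve_arc.
have f3 a b (w : V) : SGraph ad_sym ad_irr a b -> cu a b (pt P w) -> w \in [set a; b].
  move=> ab; rewrite /cu; case: eqVneq => [-> /ptA //|/(ad_old _ _ ab)].
  exact: curve_pt.
have f4 a b c d : SGraph ad_sym ad_irr a b -> SGraph ad_sym ad_irr c d -> [set a; b] != [set c; d] ->
    forall p, cu a b p -> cu c d p -> exists2 w : V, w \in [set a; b] :&: [set c; d] & p = pt P w.
  move=> ab cd ne p; rewrite /cu; case: eqVneq => [E1|/(ad_old _ _ ab) ab'];
    case: eqVneq => [E2|/(ad_old _ _ cd) cd'].
  - by rewrite E1 E2 eqxx in ne.
  - by rewrite E1 => Ap; apply: crA.
  - by rewrite E2 => h Ap; rewrite finset.setIC; apply: crA Ap h.
  - exact: curve_no_crossing.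
have sub : sg_sub P (SphereGraph (@pt_sphere _ _ P) (@pt_inj _ _ P) f1 f2 f3 f4).
  split=> // a b ab; split; first by rewrite /= /ad ab.
  rewrite /= /cu; case: eqVneq => // E; case/negP: nuv.
  have nab : a != b by apply: contraTneq ab => ->; rewrite adj_irr.
  by have [[<- <-]|[<- <-]] := set2_eq nab E; rewrite // adj_sym.
by have [_ /(_ u v)] := M _ sub; rewrite /= /ad eqxx orbT (negbTE nuv) => /(_ isT)[].
Qed.

(** The vertices and edges are finitely many closed sets without interior, so some point q of the
    sphere is off the drawing, and projection from q gives the plane picture. If a face touched two
    non-adjacent vertices, [new_arc] would give an arc in it, and the image of this arc on the
    sphere could be added to P. *)
Lemma planar_pgraph : sg_maximal P -> exists G : pgraph R V, pg G = P :> sgraph V /\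
  forall z u v, touch G z (pp G u) -> touch G z (pp G v) -> u != v -> G u v.
Proof.
move=> M; have [I0 I1] := (@I01_0 R, @I01_1 R).
have /choice[g Hg] (uv : V * V) : exists g : R -> E3, P uv.1 uv.2 ->
    [/\ pcon3 g, forall t s, I01 t -> I01 s -> g t = g s -> t = s, g 0 = pt P uv.1, g 1 = pt P uv.2 &
      (forall a, curve P uv.1 uv.2 a <-> exists2 t, I01 t & a = g t) /\ forall t, I01 t -> sphere2 (g t)].
  have [e|ne] := boolP (P uv.1 uv.2); last by exists (fun=> 0).
  by have /is_arcP[h hh] := curve_arc e; exists h.
have c3 (a : E3) : pcon3 (fun=> a) by move=> t _ i; exact: rAt_cst.
(* Vertices, and pairs that are not edges, are treated as constant paths. *)
pose gg (i : V + V * V) : R -> E3 := match i with inl v => fun=> pt P v | inr uv => if P uv.1 uv.2 then g uv else fun=> 0 end.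
have cgg i : pcon3 (gg i).
  case: i => [v|uv] /=; first exact: c3.
  by case: ifP => [e|_]; [have [] := Hg uv e|exact: c3].
have const_empty (a : E3) w (r : R) : 0 < r -> exists w', nm (w' - w) < r /\ ~ exists2 t : R, I01 t & (fun=> a) t = unstereo w'.
  move=> r0; have [E|ne] := pselect (a = unstereo w); last by exists w; rewrite subrr nm0; split=> // -[].
  exists (w + (r / 2)%:c); rewrite addrC addKr nm_real gtr0_norm ?divr_gt0 //; split; first by lra.
  case=> _ _; rewrite E => /unstereo_inj E2.
  have /eqP : (r / 2)%:c = 0 by apply: (addrI w); rewrite -E2 addr0.
  by rewrite rc_eq0 gt_eqF // divr_gt0.
have closed_gg i : closedK (fun z => exists2 t, I01 t & gg i t = unstereo z).
  (* With e = 0 the hypothesis is vacuous and the conclusion impossible, so no point near z is on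
     the path. *)
  move=> z nz; have [|r r0 Hr] := @time_near _ (gg i) z 0 0 (cgg i).
    by move=> t ht E; case: nz; exists t.
  by exists r => // w hw [t ht E]; have := Hr w hw t ht E; rewrite ltNge normr_ge0.
have empty_gg i w (r : R) : 0 < r -> exists w', nm (w' - w) < r /\ ~ exists2 t, I01 t & gg i t = unstereo w'.
  case: i => [v|uv] r0 /=; first exact: const_empty.
  case: ifP => [e|_]; last exact: const_empty.
  by have [cg ig _ _ _] := Hg uv e; apply: no_arc_disc.
have [z0 [r [r0 Hz]]] := @avoid _ _ (enum {: V + V * V}) _ closed_gg empty_gg.
have {r r0}Hz i t : I01 t -> gg i t != unstereo z0.
  move=> ht; apply/eqP => E; apply: (Hz z0 _ i); rewrite ?mem_enum //; last by exists t.
  by rewrite subrr nm0.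
set q := unstereo z0 in Hz; have Sq : sphere2 q by exact: unstereo_sphere.
have q2 : x2 q != 1 by exact: unstereo2.
have ptq v : pt P v != q by exact: (Hz (inl v) 0 I0).
have gq u v t : P u v -> I01 t -> g (u, v) t != q by move=> uv ht; have := Hz (inr (u, v)) t ht; rewrite /= uv.
have Spt v : sphere2 (pt P v) by exact: pt_sphere.
have gP u v : P u v -> [/\ pcon3 (g (u, v)), forall t s, I01 t -> I01 s -> g (u, v) t = g (u, v) s -> t = s,
    g (u, v) 0 = pt P u, g (u, v) 1 = pt P v & (forall a, curve P u v a <-> exists2 t, I01 t & a = g (u, v) t) /\
    forall t, I01 t -> sphere2 (g (u, v) t)] by move=> uv; exact: (Hg (u, v) uv).
have gcu u v t : P u v -> I01 t -> curve P u v (g (u, v) t).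
  by move=> uv ht; have [_ _ _ _ [EA _]] := gP u v uv; apply/EA; exists t.
have Sg u v t : P u v -> I01 t -> sphere2 (g (u, v) t) by move=> uv ht; have [_ _ _ _ [_]] := gP u v uv; apply.
pose pp v := chart q (pt P v); pose ga u v t := chart q (g (u, v) t).
have ci := @chart_inj R q Sq q2.
have f1 : injective pp by move=> u v /(ci _ _ (Spt u) (Spt v) (ptq u) (ptq v)); exact: pt_inj.
have f2 u v : P u v -> pcon (ga u v).
  by move=> uv; have [cg _ _ _ _] := gP u v uv; apply: pcon_chart => // t ht; split; [exact: Sg|exact: gq].
have f3 u v : P u v -> inj01 (ga u v).
  move=> uv t s ht hs /(ci _ _ (Sg u v t uv ht) (Sg u v s uv hs) (gq u v t uv ht) (gq u v s uv hs)).
  by have [_ ig _ _ _] := gP u v uv; exact: ig.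
have f4 u v : P u v -> ga u v 0 = pp u by move=> uv; rewrite /ga; have [_ _ -> _ _] := gP u v uv.
have f5 u v : P u v -> ga u v 1 = pp v by move=> uv; rewrite /ga; have [_ _ _ -> _] := gP u v uv.
have f6 u v t : P u v -> I01 t -> img (ga v u) (ga u v t).
  move=> uv ht; have vu : P v u by rewrite adj_sym.
  have := gcu u v t uv ht; rewrite (curve_sym uv); have [_ _ _ _ [EA _]] := gP v u vu.
  by case/EA => s hs E; exists s => //; rewrite /ga E.
have f7 (u v : V) t (w : V) : P u v -> I01 t -> ga u v t = pp w -> w = u \/ w = v.
  move=> uv ht /(ci _ _ (Sg u v t uv ht) (Spt w) (gq u v t uv ht) (ptq w)) E.
  have := gcu u v t uv ht; rewrite E => /(curve_pt uv); rewrite !inE => /orP[] /eqP; [by left|by right].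
have f8 (u v x y : V) t s : P u v -> P x y -> [set u; v] != [set x; y] -> I01 t -> I01 s ->
    ga u v t = ga x y s -> exists w : V, ga u v t = pp w.
  move=> uv xy ne ht hs /(ci _ _ (Sg u v t uv ht) (Sg x y s xy hs) (gq u v t uv ht) (gq x y s xy hs)) E.
  have h := gcu x y s xy hs; rewrite -E in h.
  by have [w _ Ew] := curve_no_crossing uv xy ne (gcu u v t uv ht) h; exists w; rewrite /ga Ew.
pose G := @PGraph R V P pp ga f1 f2 f3 f4 f5 f6 f7 f8.
exists G; split=> // z u v tu tv uv; apply: contraT => nuv; exfalso.
suff : ~ sg_maximal P by move/(_ M).
have [h [ch ih h0 h1 fh]] := new_arc tu tv uv.
pose A : set E3 := fun a => exists2 t, I01 t & a = unchart q (h t).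
have onG a t : I01 t -> sphere2 a -> a != q -> Gset G (chart q a) -> a = unchart q (h t) -> a = pt P u \/ a = pt P v.
  move=> ht Sa aq Ga E; have [/andP[t0 t1]] := ht; rewrite E unchartK // in Ga.
  have [t00|t0'] := eqVneq t 0; first by left; rewrite E t00 h0 /= chartK.
  have [t11|t1'] := eqVneq t 1; first by right; rewrite E t11 h1 /= chartK.
  by case: (fh t _ Ga); rewrite !lt_neqAle eq_sym t0' t0 t1'.
apply: (@not_maximal u v A) => //.
- apply/is_arcP; exists (fun t => unchart q (h t)); split.
  + exact: pcon3_unchart.
  + by move=> t s ht hs /(congr1 (chart q)); rewrite !unchartK //; exact: ih.
  + by rewrite h0 chartK.
  + by rewrite h1 chartK.
  + by split=> // t _; exact: unchart_sphere.
- move=> w [t ht E]; have [|/pt_inj ->|/pt_inj ->] := onG (pt P w) t ht (Spt w) (ptq w) _ E; rewrite ?inE ?eqxx ?orbT //.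
  by left; exists w.
- move=> x y a xy [t ht E] cxy; have [_ _ _ _ [EA _]] := gP x y xy; have [s hs Es] := (EA a).1 cxy.
  have [|||aE|aE] := onG a t ht _ _ _ E.
  + by rewrite Es; apply: Sg.
  + by rewrite Es; apply: gq.
  + by right; exists (x, y); split=> //; exists s => //; rewrite Es.
  + by exists u => //; rewrite finset.in_setI !inE eqxx /=; rewrite aE in cxy; have := curve_pt xy cxy; rewrite !inE.
  + by exists v => //; rewrite finset.in_setI !inE eqxx orbT /=; rewrite aE in cxy; have := curve_pt xy cxy; rewrite !inE.
Qed.

(** Everything that the combinatorial part needs to know about the embedding. The case of three
    vertices is separate, because there an edge has only one common neighbour. *)
Definition triangulation_facts (G : sgraph V) := [/\ forall u, exists v : V, G u v,
  #|V| = 3%N -> forall u v, u != v -> G u v & (3 < #|V|)%N -> exists sd : {set V} -> V -> bool, [/\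
  forall a b : V, G a b -> exists c d : V, [/\ c != d, G a c && G b c, G a d && G b d &
    forall w : V, G a w -> G b w -> w != c -> w != d -> sd [set a; b; w] c != sd [set a; b; w] d],
  forall T u v, T \in three_cycles G -> G u v -> u \notin T -> v \notin T -> sd T u = sd T v &
  forall S T (s m y : V), S \in three_cycles G -> T \in three_cycles G ->
    s \in S -> s \notin T -> m \in T -> m \notin S -> y \notin S -> y \notin T ->
    sd S y != sd S m -> sd T y = sd T s]].

Lemma triangulationP : triangulation P -> triangulation_facts P.
Proof.
move=> [M n3]; have [G [<- CL]] := planar_pgraph M; split.
- by move=> u; apply: (has_nbr CL); exact: ltnW.
- exact: complete3 CL.
move=> n4; exists (side G); split.
- by move=> a b; exact: side_two_nbrs.
- exact: side_adj.
- exact: side_nested.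
Qed.
End SphereGraphs.
End Plane.

(** * Braced triangulations *)

Section BracedGraphs.
Variables (R : realType) (V : finType) (G : braced_triangulation R V).
Notation P := (bt_tri G).

Lemma one_brace : #|braces G| = 1%N -> exists x y, [/\ x != y, ~~ P x y & braces G = [set [set x; y]]].
Proof.
move=> /eqP/cards1P[b Eb]; have : b \in braces G by rewrite Eb finset.in_set1.
by move=> /bracesP[x [y [xy nxy E]]]; exists x, y; rewrite Eb E.
Qed.

Lemma braced_facts : triangulation_facts P. Proof. exact: triangulationP (bt_triP G). Qed.

Let adjN u v : P u v -> u != v. Proof. by apply: contraTneq => ->; rewrite adj_irr. Qed.

Section OneBrace.
Variables x y : V.
Hypotheses (xy : x != y) (nxy : ~~ P x y) (Exy : braces G = [set [set x; y]]).

Lemma contractible_braced a b : contractible P [set a; b] ->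
  (forall T, T \in three_cycles (bt_graph G) -> a \in T -> b \in T -> x \in T -> y \in T -> False) ->
  bt_contractible G [set a; b].
Proof.
move=> cab H; rewrite /bt_contractible cab; apply/existsP => -[T /and3P[cT abT /existsP[c]]].
rewrite Exy finset.in_set1 => /andP[/eqP -> xyT].
by move: abT xyT; rewrite !set2_in => /andP[aT bT] /andP[xT yT]; apply: (H T).
Qed.

Lemma edge_avoiding a b : contractible P [set a; b] -> P a b -> a \notin [set x; y] -> b \notin [set x; y] ->
  bt_contractible G [set a; b].
Proof.
rewrite !inE !negb_or => cab ab /andP[ax ay] /andP[bx b_y]; apply: contractible_braced => // T cT aT bT xT yT.
have U : uniq [:: a; b; x; y] by rewrite /= !inE !negb_or (adjN ab) ax ay bx b_y xy.
have := cycle_card cT; have /subset_leq_card : [:: a; b; x; y] \subset T.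
  by apply/fintype.subsetP => z; rewrite !inE => /or4P[] /eqP ->.
by move/card_uniqP: U => -> /= h E; rewrite E in h.
Qed.

(** A 3-cycle through xa and the brace would contain the pair ya, which is neither an edge of P nor
    the brace. *)
Lemma edge_meeting a : contractible P [set x; a] -> P x a -> ~~ P y a -> bt_contractible G [set x; a].
Proof.
move=> cxa xa nya; apply: contractible_braced => // T cT xT aT _ yT.
have ya : y != a by apply: contraNneq nxy => ->.
have := cycle_adj cT yT aT ya; rewrite /= (negbTE nya) Exy finset.in_set1 => /eqP E.
have : x \in [set y; a] by rewrite E !inE eqxx.
by rewrite !inE (negbTE xy) (negbTE (adjN xa)).
Qed.
End OneBrace.

Lemma braced_contractible : #|braces G| = 1%N -> (6 <= #|V|)%N ->
  exists e, e \in edges P /\ bt_contractible G e.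
Proof.
move=> /one_brace[x [y [xy nxy Exy]]] n6; apply: contrapT => ne.
have irr a b : P a b -> ~ bt_contractible G [set a; b].
  move=> ab h; apply: ne; exists [set a; b]; split=> //.
  by move: h => /andP[/andP[]].
have [nbr _ [|sd [two sd_adj sd_nested]]] := braced_facts; first by apply: leq_trans n6.
have yx : y != x by rewrite eq_sym.
have nyx : ~~ P y x by rewrite adj_sym.
have Eyx : braces G = [set [set y; x]] by rewrite Exy finset.setUC.
have : (#|V| <= 5)%N; last by rewrite leqNgt n6.
apply: (@few_vertices _ _ _ nbr two sd_adj sd_nested x y) => //.
- move=> a b ab aN bN; have [c|//] := contractible_or_pinched two ab.
  by case: (irr a b ab); apply: (edge_avoiding xy Exy).
- move=> a xa nya; have [c|//] := contractible_or_pinched two xa.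
  by case: (irr x a xa); apply: (edge_meeting xy nxy Exy).
- move=> a ya nxa; have [c|//] := contractible_or_pinched two ya.
  by case: (irr y a ya); apply: (edge_meeting yx nyx Eyx).
Qed.

Lemma braced_card : #|braces G| = 1%N -> (4 < #|V|)%N.
Proof.
move=> /one_brace[x [y [xy nxy Exy]]]; have [nbr c3 f4] := braced_facts.
have [_ n3] := bt_triP G.
have [E|ne] := eqVneq #|V| 3%N; first by case/negP: nxy; apply: c3.
have n4 : (3 < #|V|)%N by rewrite ltn_neqAle eq_sym ne.
by have [sd [two _ _]] := f4 n4; apply: (nonadj_card nbr two xy nxy).
Qed.

Lemma braced5 x y : #|V| = 5%N -> x != y -> ~~ P x y -> forall u v, P u v = (u != v) && ([set u; v] != [set x; y]).
Proof.
move=> n5 xy nxy u v; have [nbr _ [|sd [two _ _]]] := braced_facts; first by rewrite n5.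
apply/idP/andP => [uv|[uv ne]]; last exact: (K5_minus nbr two n5 xy nxy).
split; first exact: adjN.
apply: contraNneq nxy => E; have [[<- <-]|[<- <-]] := set2_eq (adjN uv) E => //.
by rewrite adj_sym.
Qed.

(** An edge with an end in {x, y} has its other end b adjacent to both x and y, so it lies on the
    3-cycle xyb through the brace. An edge avoiding x and y has all three remaining vertices as
    common neighbours, so it lies on three 3-cycles of P. *)
Lemma braced5_irreducible : #|braces G| = 1%N -> #|V| = 5%N -> bt_irreducible G.
Proof.
move=> /one_brace[x [y [xy nxy Exy]]] n5; have adjE := braced5 n5 xy nxy.
move=> e /imsetP[[a b]]; rewrite inE /= => ab ->.
wlog abx : a b ab / (b \notin [set x; y]).
  move=> W; have [bxy|] := boolP (b \notin [set x; y]); first exact: W.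
  rewrite negbK => bxy; rewrite finset.setUC; apply: W; first by rewrite adj_sym.
  apply/negP => axy; move: ab; rewrite adjE => /andP[nab /negP]; apply.
  rewrite eqEcard !cards2 nab xy leqnn andbT; apply/fintype.subsetP => z.
  by rewrite in_set2 => /orP[] /eqP ->.
have bxy := abx; rewrite !inE negb_or in bxy; have {bxy}[bx b_y] := andP bxy.
have [axy|axy] := boolP (a \in [set x; y]).
  rewrite negb_and negbK; apply/orP; right; apply/existsP; exists [set x; y; b].
  have nbrE u : u \in [set x; y] -> P u b.
    rewrite adjE !inE => /orP[] /eqP ->; rewrite eq_sym ?bx ?b_y /=; apply: contra abx => /eqP <-;
      by rewrite !inE eqxx orbT.
  apply/and3P; split.
  - apply: cycleP; rewrite /= ?nbrE ?inE ?eqxx ?orbT //.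
      by rewrite Exy finset.in_set1 eqxx orbT.
    by rewrite adj_sym nbrE // !inE eqxx.
  - by rewrite set2_in !inE eqxx orbT andbT; move: axy; rewrite !inE => ->.
  - apply/existsP; exists [set x; y]; rewrite Exy finset.in_set1 eqxx /=.
    by rewrite set2_in !inE !eqxx orbT.
rewrite negb_and; apply/orP; left; rewrite negb_and; apply/orP; right.
have axy' := axy; rewrite !inE negb_or in axy'; have {axy'}[ax ay] := andP axy'.
have nab := adjN ab.
have [|m] := @exists_notin _ [:: a; b; x; y]; first by rewrite n5.
rewrite !inE !negb_or => /and4P[ma mb mx my].
set S := [set T in three_cycles P | [set a; b] \subset T].
have inS c : c != a -> c != b -> [set a; b; c] \in S.
  move=> ca cb; have ne (u v : V) : u \notin [set x; y] -> [set u; v] != [set x; y].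
    by apply: contraNneq => <-; rewrite !inE eqxx.
  rewrite finset.in_set; apply/andP; split; last by rewrite set2_in !inE !eqxx orbT.
  apply: cycleP => //.
    by rewrite adjE eq_sym cb ne.
  by rewrite adj_sym adjE eq_sym ca ne.
have sub : [set [set a; b; x]; [set a; b; y]; [set a; b; m]] \subset S.
  by rewrite finset.subUset set2_in finset.sub1set !inS // eq_sym.
have nT c d : d != a -> d != b -> d != c -> [set a; b; c] != [set a; b; d].
  move=> da db dc; apply/eqP => E; have : d \in [set a; b; c] by rewrite E !inE eqxx orbT.
  by rewrite !inE (negbTE da) (negbTE db) (negbTE dc).
have := subset_leq_card sub; rewrite finset.setUC cardsU1 cards2 finset.in_set2 negb_or.
rewrite ![[set a; b; m] == _]eq_sym !nT // 1?eq_sym // => h.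
by apply/eqP => E; rewrite -E in h.
Qed.
End BracedGraphs.

(** * Five vertices: uniqueness and existence *)

Lemma braced5_iso (R : realType) (V W : finType) (G : braced_triangulation R V) (H : braced_triangulation R W) :
  #|braces G| = 1%N -> #|braces H| = 1%N -> #|V| = 5%N -> #|W| = 5%N -> bt_iso G H.
Proof.
move=> /one_brace[x [y [xy nxy Exy]]] /one_brace[x' [y' [xy' nxy' Exy']]] nV nW.
have [f0 bf0] : exists f0 : V -> W, bijective f0.
  have E : #|V| = #|W| by rewrite nV nW.
  exists (fun v => enum_val (cast_ord E (enum_rank v))); exists (fun w => enum_val (cast_ord (esym E) (enum_rank w))) => z;
    by rewrite enum_valK ?cast_ordK ?cast_ordKV enum_rankK.
(* An arbitrary bijection is corrected by two transpositions; the second one does not move x', so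
   that x and y both arrive where they should. *)
pose f1 v := tperm (f0 x) x' (f0 v).
pose f v := tperm (f1 y) y' (f1 v).
have f1x : f1 x = x' by rewrite /f1 tpermL.
have bf : bijective f by apply: (bij_comp (injF_bij (@perm_inj _ _))); apply: (bij_comp (injF_bij (@perm_inj _ _))).
have inf := bij_inj bf.
have fx : f x = x'.
  rewrite /f f1x tpermD // 1?eq_sym // -f1x; apply: contraNneq xy.
  by move=> /perm_inj /(bij_inj bf0) ->.
have fy : f y = y' by rewrite /f tpermL.
have fE u v : f @: [set u; v] = [set f u; f v] by rewrite imsetU1 imset_set1.
have fxy : f @: [set x; y] = [set x'; y'] by rewrite fE fx fy.
have ini : injective (fun A : {set V} => f @: A) by exact: imset_inj.
exists f; split=> //.
- move=> u v; rewrite (braced5 nV xy nxy) (braced5 nW xy' nxy') (inj_eq inf).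
  by rewrite -fxy -fE (inj_eq ini).
- by move=> b; rewrite Exy Exy' !finset.in_set1 -fxy (inj_eq ini).
Qed.

Lemma bt_iso_card (R : realType) (V W : finType) (G : braced_triangulation R V) (H : braced_triangulation R W) :
  bt_iso G H -> #|V| = #|W|.
Proof. by move=> [f [bf _ _]]; apply: bij_eq_card bf. Qed.

(* A sphere graph with the largest possible number of edges is maximal. *)
Lemma exists_maximal (R : realType) (V : finType) : exists P : sphere_graph R V, sg_maximal P.
Proof.
pose sz (P : sphere_graph R V) := #|[set e : V * V | P e.1 e.2]|.
pose Q n := `[< exists P, sz P = n >].
have ad_irr : irreflexive (fun _ _ : V => false) by [].
have ad_sym : symmetric (fun _ _ : V => false) by [].
(* Any distinct points of the sphere would do; these are the images of distinct integers on the real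
   axis. *)
pose ps (v : V) : 'rV[R]_3 := @unstereo R (real_complex R (enum_rank v)%:R).
have ps_inj : injective ps.
  move=> u v /(@unstereo_inj R) /(@complexI R) /eqP; rewrite eqr_nat => /eqP h.
  exact/enum_rank_inj/val_inj.
have exQ : exists n, Q n.
  pose P0 : sphere_graph R V := @SphereGraph R V (SGraph ad_sym ad_irr) ps (fun _ _ => set0)
    (fun v => unstereo_sphere _) ps_inj (fun _ _ h => False_ind _ (notF h)) (fun _ _ h => False_ind _ (notF h))
    (fun _ _ _ h => False_ind _ (notF h)) (fun _ _ _ _ h => False_ind _ (notF h)).
  by exists (sz P0); apply/asboolP; exists P0.
have ubQ n : Q n -> (n <= #|{: V * V}|)%N by move=> /asboolP[P <-]; apply: max_card.
have [n /asboolP[P Pn] maxn] := ex_maxnP exQ ubQ.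
exists P => Q' [ptE sub].
have subE : [set e : V * V | P e.1 e.2] \subset [set e : V * V | Q' e.1 e.2].
  by apply/fintype.subsetP => e; rewrite !inE => /sub[].
have EE : [set e : V * V | P e.1 e.2] = [set e : V * V | Q' e.1 e.2].
  apply/eqP; rewrite eqEcard subE /= -/(sz P) Pn; apply: maxn.
  by apply/asboolP; exists Q'.
split=> [v|u v uv]; first by rewrite ptE.
have : (u, v) \in [set e : V * V | Q' e.1 e.2] by rewrite inE.
by rewrite -EE inE /= => /[dup] Puv /sub[].
Qed.

Lemma exists_braced5 (R : realType) : exists G : braced_triangulation R 'I_5, #|braces G| = 1%N.
Proof.
have [P M] := exists_maximal R 'I_5.
have T : triangulation P by split=> //; rewrite card_ord.
have [nbr _ [|sd [two sd_adj _]]] := triangulationP T; first by rewrite card_ord.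
have [x [y [xy nxy]]] : exists x y, x != y /\ ~~ P x y.
  apply: contrapT => h; apply: (not_complete5 nbr two sd_adj); first by rewrite card_ord.
  by move=> u v uv; apply: contraT => nuv; case: h; exists u, v.
have B b : b \in [set [set x; y]] -> exists x y, [/\ x != y, ~~ P x y & b = [set x; y]].
  by rewrite finset.in_set1 => /eqP ->; exists x, y.
by exists (BracedTriangulation T B); rewrite cards1.
Qed.

Theorem theorem3p1 (R : realType) :
  (forall (V : finType) (G : braced_triangulation R V),
     #|braces G| = 1%N -> (6 <= #|V|)%N ->
     exists e : {set V}, e \in edges (bt_tri G) /\ bt_contractible G e)
  /\
  (exists G0 : braced_triangulation R 'I_5,
     [/\ #|braces G0| = 1%N,
         forall (V : finType) (G : braced_triangulation R V),
           #|braces G| = 1%N -> #|V| = 5%N -> bt_iso G G0 &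
         forall (V : finType) (G : braced_triangulation R V),
           #|braces G| = 1%N -> (bt_irreducible G <-> bt_iso G G0)]).
Proof.
split=> [V G|]; first exact: braced_contractible.
have [G0 b0] := exists_braced5 R; exists G0; split=> // V G b1; first by move=> n5; apply: braced5_iso; rewrite ?card_ord.
split=> [irr|/bt_iso_card n5]; last by apply: braced5_irreducible; rewrite // n5 card_ord.
apply: braced5_iso; rewrite ?card_ord //; apply/eqP; rewrite eqn_leq (braced_card b1) andbT leqNgt; apply/negP => n6.
by have [e [eP ce]] := braced_contractible b1 n6; have := irr e eP; rewrite ce.
Qed.
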